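(* Let $\mathcal{C}'\subset\mathbb{P}^2$ be a plus-one generated reduced curve with exponents $(d_2,d_3)$ and level $d$, and let $L\subset\mathbb{P}^2$ be a line not contained in $\mathcal{C}'$ such that $d=\deg(\mathcal{C}')-|\mathcal{C}''|-\epsilon(\mathcal{C}',L)$, where $\mathcal{C}''=\mathcal{C}'\cap L$. Then $\mathcal{C}=\mathcal{C}'\cup L$ is free with exponents $(d_2,d_3)$.
   Context: $S=\mathbb{C}[x,y,z]$ with standard grading. A reduced curve $\mathcal{C}\subset\mathbb{P}^2$ is given by a reduced homogeneous $f_{\mathcal{C}}\in S$. A derivation $\theta=\sum f_i\partial_i$ is homogeneous of degree $k$ if all $f_i$ are homogeneous of degree $k$; $\theta_E=x\partial_x+y\partial_y+z\partial_z$. $D(\mathcal{C})=\{\theta\in\mathrm{Der}(S):\theta(f_{\mathcal{C}})\in Sf_{\mathcal{C}}\}$, $D_0(\mathcal{C})=\{\theta:\theta(f_{\mathcal{C}})=0\}$, and $D(\mathcal{C})=D_0(\mathcal{C})\oplus S\theta_E$. $\mathcal{C}$ is free if $D_0(\mathcal{C})$ is a free $S$-module (necessarily of rank 2); its exponents are the degrees of a homogeneous basis of $D_0(\mathcal{C})$ (an unordered pair). $\mathcal{C}$ is plus-one generated if $D(\mathcal{C})$ has a minimal set of homogeneous generators $\{\theta_E,\theta_2,\theta_3,\psi\}$ with a unique relation $f_1\theta_E+f_2\theta_2+f_3\theta_3+\alpha\psi=0$, $f_i\in S$, $\deg\alpha=1$; exponents $(\deg\theta_2,\deg\theta_3)$,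 level $\deg\psi$. $\mathcal{E}_{\mathcal{C}}$ is the sheafification of $D_0(\mathcal{C})$ (a rank 2 vector bundle on $\mathbb{P}^2$). $|\mathcal{C}''|$ is the number of distinct points of $\mathcal{C}'\cap L$. For a reduced curve $\mathcal{C}'$ and a line $L\not\subset\mathcal{C}'$, $\epsilon(\mathcal{C}',L)\in\mathbb{Z}$ is the integer defined by A. Dimca, which measures the failure of the singularities of $\mathcal{C}'\cup L$ on $L$ to be quasi-homogeneous (it is $0$ if all these singularities are quasi-homogeneous), and for which there is an exact sequence of vector bundles $0\to\mathcal{E}_{\mathcal{C}'}(-1)\xrightarrow{\alpha_L}\mathcal{E}_{\mathcal{C}'\cup L}\to\mathcal{O}_L(1-|\mathcal{C}'\cap L|-\epsilon(\mathcal{C}',L))\to0$, $\alpha_L$ being a linear form defining $L$. *)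

(* Defs.v *)
From mathcomp Require Import all_boot all_algebra.
From mathcomp Require Import complex.
From mathcomp.reals_stdlib Require Import Rstruct.
From mathcomp Require Import mpoly.
From Stdlib Require Import ClassicalEpsilon.

Set Implicit Arguments.
Unset Strict Implicit.
Unset Printing Implicit Defensive.

Import GRing.Theory.
Local Open Scope ring_scope.

Definition CC := (Rdefinitions.R[i])%C.

Definition S := {mpoly CC[3]}.

(* A derivation theta = sum_i theta_i d/dx_i is given by its coefficients. *)
Definition Der := 'I_3 -> S.

Definition der_apply (th : Der) (g : S) : S := \sum_(i < 3) th i * mderiv i g.

Definition der_homog (k : nat) (th : Der) : Prop := forall i, th i \is k.-homog.

Definition euler : Der := fun i => 'X_i.

Definition in_D (f : S) (th : Der) : Prop := exists g : S, der_apply th f = g * f.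
Definition in_D0 (f : S) (th : Der) : Prop := der_apply th f = 0.

Definition comb (m : nat) (c : 'I_m -> S) (ths : 'I_m -> Der) : Der :=
  fun i => \sum_(k < m) c k * ths k i.

Definition free_with_exponents (f : S) (d1 d2 : nat) : Prop :=
  exists th1 th2 : Der,
    [/\ der_homog d1 th1 /\ der_homog d2 th2, in_D0 f th1 /\ in_D0 f th2,
        (forall th, in_D0 f th ->
           exists a b : S, forall i, th i = a * th1 i + b * th2 i) &
        (forall a b : S, (forall i, a * th1 i + b * th2 i = 0) -> a = 0 /\ b = 0)].

Definition fam4 (a b c e : Der) : 'I_4 -> Der :=
  fun k => match val k with 0 => a | 1 => b | 2 => c | _ => e end.
Definition coef4 (a b c e : S) : 'I_4 -> S :=
  fun k => match val k with 0 => a | 1 => b | 2 => c | _ => e end.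

Definition plus_one_generated (f : S) (d2 d3 d : nat) : Prop :=
  exists (th2 th3 psi : Der) (f1 f2 f3 alpha : S),
    let G := fam4 euler th2 th3 psi in
    [/\ der_homog d2 th2 /\ der_homog d3 th3 /\ der_homog d psi,
        in_D f th2 /\ in_D f th3 /\ in_D f psi,
        (forall th, in_D f th -> exists c : 'I_4 -> S, forall i, th i = comb c G i),
        (forall k : 'I_4, ~ exists c : 'I_4 -> S, c k = 0 /\ forall i, G k i = comb c G i) &
        [/\ alpha \is 1.-homog, alpha != 0,
            (forall i, comb (coef4 f1 f2 f3 alpha) G i = 0) &
            (forall c : 'I_4 -> S, (forall i, comb c G i = 0) ->
               exists h : S, forall k, c k = h * coef4 f1 f2 f3 alpha k)]].

Definition reduced (f : S) : Prop :=
  f != 0 /\ forall g h : S, f = g * g * h -> (msize g <= 1)%N.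

Definition vec := 'I_3 -> CC.
Definition nonzero_vec (v : vec) : Prop := exists i, v i != 0.
Definition proportional (v w : vec) : Prop :=
  exists c : CC, c != 0 /\ forall i, w i = c * v i.

Definition intersection_points (f l : S) (pts : seq vec) : Prop :=
  [/\ (forall v, List.In v pts -> [/\ nonzero_vec v, f.@[v] = 0 & l.@[v] = 0]),
      (forall i j, (i < j < size pts)%N ->
         ~ proportional (nth (fun _ => 0) pts i) (nth (fun _ => 0) pts j)) &
      (forall w : vec, nonzero_vec w -> f.@[w] = 0 -> l.@[w] = 0 ->
         exists2 v, List.In v pts & proportional v w)].

(* affine chart x_i = 1 containing [v]: i = first nonzero coordinate *)
Definition chart_idx (v : vec) : 'I_3 := odflt ord0 [pick i | v i != 0].

Definition mon_at (v : vec) (e : 'X_{1..3}) : S :=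
  \prod_(j < 3) ('X_j - (v j / v (chart_idx v))%:MP) ^+ (e j).

(* membership in the ideal (gens) + (x_i - 1) + m_p^N, where m_p is the maximal
   ideal of the point [v] in the affine chart x_i = 1 *)
Definition in_ideal_N (k : nat) (gens : 'I_k -> S) (v : vec) (N : nat) (p : S) : Prop :=
  exists (c : 'I_k -> S) (c0 : S) (m : 'X_{1..3 < N.+1} -> S),
    p = \sum_(j < k) c j * gens j + c0 * ('X_(chart_idx v) - 1)
        + \sum_(e : 'X_{1..3 < N.+1} | mdeg e == N) m e * mon_at v e.

Definition quot_dim_ge (k : nat) (gens : 'I_k -> S) (v : vec) (N r : nat) : Prop :=
  exists ps : 'I_r -> S, forall c : 'I_r -> CC,
    in_ideal_N gens v N (\sum_(t < r) (c t)%:MP * ps t) -> forall t, c t = 0.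

(* n = dim_C O_{P^2,p} / (gens)  (= stable value of dim_C S/(gens + (x_i-1) + m_p^N)) *)
Definition is_loc_len (k : nat) (gens : 'I_k -> S) (v : vec) (n : nat) : Prop :=
  (forall N, ~ quot_dim_ge gens v N n.+1) /\ exists N, quot_dim_ge gens v N n.

Definition loc_len (k : nat) (gens : 'I_k -> S) (v : vec) : nat :=
  epsilon (inhabits 0%N) (is_loc_len gens v).

(* Milnor number mu(C,p): local length of (dg/du, dg/dw), g the affine equation *)
Definition milnor (f : S) (v : vec) : nat :=
  loc_len (fun k : 'I_2 => mderiv (lift (chart_idx v) k) f) v.

(* Tjurina number tau(C,p): local length of (g, dg/du, dg/dw) *)
Definition tjurina (f : S) (v : vec) : nat :=
  loc_len (fun k : 'I_3 =>
             if val k is j.+1 then mderiv (lift (chart_idx v) (inord j : 'I_2)) f else f) v.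

Definition eps_CL (f' l : S) (pts : seq vec) : int :=
  \sum_(v <- pts) (((milnor (f' * l) v)%:Z - (tjurina (f' * l) v)%:Z)
                   - ((milnor f' v)%:Z - (tjurina f' v)%:Z)).

(* Main.v *)
Require Import Defs.
From mathcomp Require Import all_boot all_algebra.
From mathcomp Require Import complex.
From mathcomp.reals_stdlib Require Import Rstruct.
From mathcomp Require Import mpoly.
From mathcomp Require Import order separable.
From mathcomp Require Import ring zify.
From Stdlib Require Import Classical ClassicalEpsilon.

(* Let L be the line l = 0. A derivation killing f' stays logarithmic for
   f' l exactly when l divides its value on l. At a point p of C' and L choose
   coordinates (u, w) with L = {w = 0} and let g be the local equation of C', of order i on L. Then
   mu(w g) = mu(g) + 2 i - 1, while tau(w g) <= tau(g) + i + o, where o is the order at p, on L, of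
   the value on l of any derivation killing f'. Hence this order is at least i - 1 - eps_p, and
   summing over p, a derivation of degree smaller than d = deg C' - |C''| - eps is tangent to L; in
   degree d the values on L form a space of dimension at most one. Some generator of degree d is not
   tangent to L, for otherwise the Koszul derivations would force l | f'. Subtracting multiples of it
   makes the other two generators tangent to L, and then its coefficient in the unique relation is a
   nonzero multiple of l, so that these two generators form a basis for C.

   The formula for mu is Teissier's argument: on each branch of the polar curve g_u = 0 the chain
   rule gives w d(g)/dw = w g_w, so g, w g_w and g + w g_w have the same order there. Branches are
   only needed modulo a high power of w, so that polynomial Puiseux expansions suffice.

   The argument works over any algebraically closed field F with a norm; for F = CC the notions
   [is_length], [local_length], [square_free], [dapp] and [free_exponents] are convertible with
   [is_loc_len], [loc_len], [reduced], [der_apply] and [free_with_exponents]. *)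

Set Implicit Arguments.
Unset Strict Implicit.
Unset Printing Implicit Defensive.
Import GRing.Theory Num.Theory.
Local Open Scope ring_scope.

(** * Codimension of ideals of F[w][u] *)

Notation "\w" := (('X : {poly _})%:P : {poly {poly _}}).

(** The local order bounds can be summed because the multiplicities i of C' along L add up to deg
    C'. The value on l of a derivation of degree k, restricted to L, is a binary form of degree k
    with at least d zeros. It is therefore zero if k < d, and if k = d it is zero as soon as it
    vanishes at one further point B of L off C'. Evaluation at B thus decides tangency in degree d,
    and it supplies the scalars with which multiples of the pivot generator are subtracted. An upper
    bound for tau(w g) is enough, since the generator that is not tangent to L does not come from a
    dimension count.

    Milnor and Tjurina numbers are values of [epsilon], so nothing is known about them until an
    actual length is exhibited. Hence finiteness has to be derived from square-freeness, and each
    truncation order has to exceed the intersection numbers computed with it. Local rings are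
    replaced by ideals contracted to F[w][u], with denominators nonzero at the origin cleared, so
    that all arguments are identities between polynomials. *)

Definition cst (F : fieldType) (c : F) : {poly {poly F}} := c%:P%:P.

Definition at0 (F : fieldType) (x : {poly {poly F}}) : F := x.[0].[0].

Lemma at0D (F : fieldType) (x y : {poly {poly F}}) : at0 (x + y) = at0 x + at0 y.
Proof. by rewrite /at0 !hornerD. Qed.

Lemma at0M (F : fieldType) (x y : {poly {poly F}}) : at0 (x * y) = at0 x * at0 y.
Proof. by rewrite /at0 !hornerM. Qed.

Lemma at0X (F : fieldType) (x : {poly {poly F}}) n : at0 (x ^+ n) = at0 x ^+ n.
Proof. by rewrite /at0 !horner_exp. Qed.

Lemma at0_cst (F : fieldType) (c : F) : at0 (cst c) = c.
Proof. by rewrite /at0 /cst !hornerC. Qed.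

Lemma at0_w (F : fieldType) : at0 (\w : {poly {poly F}}) = 0.
Proof. by rewrite /at0 hornerC hornerX. Qed.

Lemma cstM (F : fieldType) (a b : F) : cst (a * b) = cst a * cst b.
Proof. by rewrite /cst !polyCM. Qed.

Lemma cst_sum (F : fieldType) (T : finType) (c : T -> F) :
  cst (\sum_t c t) = \sum_t cst (c t).
Proof. by rewrite /cst !rmorph_sum. Qed.

Definition isideal (A : nzRingType) (J : A -> Prop) : Prop :=
  [/\ J 0, (forall x y, J x -> J y -> J (x + y)) & (forall a x, J x -> J (a * x))].

Lemma idealB (A : nzRingType) (J : A -> Prop) x y :
  isideal J -> J x -> J y -> J (x - y).
Proof. by case=> _ hD hM hx hy; apply: hD => //; rewrite -mulN1r; apply: hM. Qed.

Lemma ideal_sum (A : nzRingType) (J : A -> Prop) (I : Type) (r : seq I) (P : pred I)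
  (f : I -> A) : isideal J -> (forall i, P i -> J (f i)) -> J (\sum_(i <- r | P i) f i).
Proof. by case=> h0 hD _ hf; apply: (big_ind J). Qed.

Lemma idealMr (A : comNzRingType) (J : A -> Prop) a x : isideal J -> J x -> J (x * a).
Proof. by case=> _ _ hM hx; rewrite mulrC; apply: hM. Qed.

(** Either [J] is the unit ideal or it is supported at the origin alone. *)
Definition primary (F : fieldType) (J : {poly {poly F}} -> Prop) : Prop :=
  exists K, J ('X ^+ K) /\ J (\w ^+ K).

Lemma at0_eq0 (F : fieldType) (x : {poly {poly F}}) :
  at0 x = 0 -> exists y z, x = 'X * y + \w * z.
Proof.
move=> x0; have /factor_theorem [y Hy] : root (x - x.[0]%:P) 0.
  by rewrite /root !hornerE subrr.
have /factor_theorem [z Hz] : root x.[0] 0 by apply/eqP.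
exists y, (z%:P); rewrite -[LHS](subrK x.[0]%:P) Hy subr0 (mulrC y); congr (_ + _).
by rewrite Hz subr0 -polyCM mulrC.
Qed.

Lemma ideal_exprD (A : comNzRingType) (J : A -> Prop) (x y : A) m n :
  isideal J -> J (x ^+ m) -> J (y ^+ n) -> J ((x + y) ^+ (m + n)).
Proof.
move=> hJ hx hy; rewrite exprDn; apply: ideal_sum => // i _.
rewrite -mulr_natl; case: hJ => h0 hD hM; apply: (hM).
have [hi|hi] := leqP n i.
  by rewrite -[X in y ^+ X](subnK hi) exprD; do 2!apply: (hM).
have mi : (m <= m + n - i)%N by rewrite -addnBA ?leq_addr // ltnW.
by rewrite -(subnK mi) exprD mulrC; do 2!apply: (hM).
Qed.

(** The element [1 - s / s(0)] lies in the ideal (u, w), hence is nilpotent modulo [J]; a finite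
    geometric series inverts [s]. *)
Lemma unit_mod_primary (F : fieldType) (J : {poly {poly F}} -> Prop) s :
  isideal J -> primary J -> at0 s != 0 -> exists s', J (1 - s' * s).
Proof.
move=> hJ [K [hu hw]] s0.
pose nu := 1 - cst (at0 s)^-1 * s.
have [y [z Ez]] : exists y z, nu = 'X * y + \w * z.
  apply: at0_eq0; rewrite /nu at0D -[1](_ : cst 1 = 1) ?at0_cst; last first.
    by rewrite /cst !polyC1.
  by rewrite -mulNr at0M -[- cst _]mulN1r at0M at0_cst /at0 !hornerE /= mulN1r mulNr
     -/(at0 s) mulVf // subrr.
have hnu : J (nu ^+ (K + K)).
  by rewrite Ez; apply: ideal_exprD => //; rewrite exprMn; apply: idealMr.
exists ((\sum_(i < K + K) nu ^+ i) * cst (at0 s)^-1).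
rewrite -mulrA; have -> : cst (at0 s)^-1 * s = 1 - nu by rewrite /nu opprB addrC subrK.
have E : nu ^+ (K + K) - 1 = (nu - 1) * \sum_(i < K + K) nu ^+ i.
  exact: subrX1.
by rewrite mulrC -[1 - nu]opprB mulNr opprK -E addrC subrK.
Qed.

Lemma primary_sat (F : fieldType) (J : {poly {poly F}} -> Prop) s x :
  isideal J -> primary J -> at0 s != 0 -> J (s * x) -> J x.
Proof.
move=> hJ pJ s0 hx; have [s' hs'] := unit_mod_primary hJ pJ s0.
have -> : x = (1 - s' * s) * x + s' * (s * x) by ring.
by case: (hJ) => _ hD hM; apply: hD; [apply: idealMr | apply: hM].
Qed.

Definition indep (F : fieldType) (J : {poly {poly F}} -> Prop) (T : finType)
  (ps : T -> {poly {poly F}}) : Prop :=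
  forall c : T -> F, J (\sum_t cst (c t) * ps t) -> forall t, c t = 0.

Definition spans (F : fieldType) (J : {poly {poly F}} -> Prop) (T : finType)
  (ps : T -> {poly {poly F}}) : Prop :=
  forall x, exists c : T -> F, J (x - \sum_t cst (c t) * ps t).

Definition spanned_by (F : fieldType) (J : {poly {poly F}} -> Prop) (n : nat) : Prop :=
  exists (T : finType) (ps : T -> {poly {poly F}}), #|T| = n /\ spans J ps.

Definition codim (F : fieldType) (J : {poly {poly F}} -> Prop) (n : nat) : Prop :=
  exists (T : finType) (ps : T -> {poly {poly F}}), [/\ #|T| = n, indep J ps & spans J ps].

(** Steinitz exchange modulo [J]: if there were more independent elements than spanning ones, a
    nonzero vector in the left kernel of the coordinate matrix would give a dependence. *)
Lemma indep_spans_le (F : fieldType) (J : {poly {poly F}} -> Prop) (T1 T2 : finType)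
  (ps : T1 -> {poly {poly F}}) (qs : T2 -> {poly {poly F}}) :
  isideal J -> indep J ps -> spans J qs -> (#|T1| <= #|T2|)%N.
Proof.
move=> hJ hi hs.
have /fin_all_exists [A hA] : forall i, exists c : T2 -> F,
  J (ps i - \sum_t cst (c t) * qs t) by move=> i; apply: hs.
rewrite leqNgt; apply/negP => lt21.
pose M := \matrix_(i < #|T1|, j < #|T2|) A (enum_val i) (enum_val j).
have : kermx M != 0.
  by rewrite kermx_eq0 /row_free neq_ltn (leq_ltn_trans (rank_leq_col M) lt21).
case/rowV0Pn => v /sub_kermxP vM v0.
have : forall t, v 0 (enum_rank t) = 0.
  apply: hi.
  have -> : \sum_t cst (v 0 (enum_rank t)) * ps t =
     \sum_t cst (v 0 (enum_rank t)) * (ps t - \sum_s cst (A t s) * qs s).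
    under [RHS]eq_bigr => t _ do rewrite mulrBr.
    rewrite sumrB [X in _ - X](_ : _ = 0) ?subr0 //.
    transitivity (\sum_s cst (\sum_t v 0 (enum_rank t) * A t s) * qs s).
      under eq_bigr => t _ do rewrite mulr_sumr.
      rewrite exchange_big /=; apply: eq_bigr => s _; rewrite cst_sum mulr_suml.
      by apply: eq_bigr => t _; rewrite cstM mulrA.
    rewrite big1 // => s _.
    move/matrixP: vM => /(_ 0 (enum_rank s)); rewrite !mxE => vM.
    rewrite (_ : \sum_t _ = 0) ?/cst ?polyC0 ?mul0r // -[RHS]vM.
    rewrite (reindex (enum_val : 'I_#|T1| -> T1)) /=; last first.
      by exists enum_rank => x _; rewrite ?enum_valK ?enum_rankK.
    by apply: eq_bigr => i _; rewrite enum_valK mxE enum_rankK.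
  apply: ideal_sum => // t _; case: hJ => _ _; apply; exact: hA.
move=> H; case/eqP: v0; apply/rowP => i; rewrite mxE -[ i ]enum_valK; exact: H.
Qed.

Lemma codim_unique (F : fieldType) (J : {poly {poly F}} -> Prop) n m :
  isideal J -> codim J n -> codim J m -> n = m.
Proof.
move=> hJ [T1 [p1 [<- i1 s1]]] [T2 [p2 [<- i2 s2]]].
by apply/eqP; rewrite eqn_leq (indep_spans_le hJ i1 s2) (indep_spans_le hJ i2 s1).
Qed.

Lemma codim_le_spanned (F : fieldType) (J : {poly {poly F}} -> Prop) n m :
  isideal J -> codim J n -> spanned_by J m -> (n <= m)%N.
Proof.
move=> hJ [T1 [p1 [<- i1 s1]]] [T2 [p2 [<- s2]]]; exact: (indep_spans_le hJ i1 s2).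
Qed.

Lemma codim_spanned (F : fieldType) (J : {poly {poly F}} -> Prop) n :
  codim J n -> spanned_by J n.
Proof. by move=> [T [p [hn _ s]]]; exists T, p. Qed.

(* multiplication by [P] gives an exact sequence R/(J : P) -> R/J -> R/(J + P) *)
Lemma codim_exact (F : fieldType) (J J1 J2 : {poly {poly F}} -> Prop) P n1 n2 :
  isideal J ->
  (forall x, J1 x <-> exists y z, J y /\ x = y + P * z) ->
  (forall x, J2 x <-> J (P * x)) ->
  codim J1 n1 -> codim J2 n2 -> codim J (n1 + n2).
Proof.
move=> hJ h1 h2 [T1 [p1 [<- i1 s1]]] [T2 [p2 [<- i2 s2]]].
pose ps (t : T1 + T2) := match t with inl i => p1 i | inr j => P * p2 j end.
have sumE (c : T1 + T2 -> F) : \sum_t cst (c t) * ps t =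
   \sum_i cst (c (inl i)) * p1 i + P * \sum_j cst (c (inr j)) * p2 j.
  rewrite big_sumType /=; congr (_ + _); rewrite mulr_sumr.
  by apply: eq_bigr => j _; rewrite mulrCA.
exists (T1 + T2)%type, ps; split; first by rewrite card_sum.
- move=> c; rewrite sumE => hc.
  have c1 : forall i, c (inl i) = 0.
    apply: i1; apply/h1; eexists; exists (- (\sum_j cst (c (inr j)) * p2 j)); split; first exact: hc.
    by rewrite mulrN addrK.
  have c2 : forall j, c (inr j) = 0.
    apply: i2; apply/h2; move: hc; rewrite big1 ?add0r // => i _.
    by rewrite c1 /cst !polyC0 mul0r.
  by case.
- move=> x; have [c1 /h1 [y [z [hy Ey]]]] := s1 x.
  have [c2 /h2 hz] := s2 z.
  exists (fun t => match t with inl i => c1 i | inr j => c2 j end); rewrite sumE.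
  rewrite opprD addrA Ey -addrA -mulrBr; case: hJ => _ hD _; exact: hD.
Qed.

(** The upper bound half of [codim_exact]: only a spanning family is wanted, so inclusions replace
    the equivalences, and [J2] may be smaller than the colon ideal. *)
Lemma spanned_exact (F : fieldType) (J J1 J2 : {poly {poly F}} -> Prop) P n1 n2 :
  isideal J ->
  (forall x, J1 x -> exists y z, J y /\ x = y + P * z) ->
  (forall x, J2 x -> J (P * x)) ->
  spanned_by J1 n1 -> spanned_by J2 n2 -> spanned_by J (n1 + n2).
Proof.
move=> hJ h1 h2 [T1 [p1 [<- s1]]] [T2 [p2 [<- s2]]].
pose ps (t : T1 + T2) := match t with inl i => p1 i | inr j => P * p2 j end.
have sumE (c : T1 + T2 -> F) : \sum_t cst (c t) * ps t =
   \sum_i cst (c (inl i)) * p1 i + P * \sum_j cst (c (inr j)) * p2 j.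
  rewrite big_sumType /=; congr (_ + _); rewrite mulr_sumr.
  by apply: eq_bigr => j _; rewrite mulrCA.
exists (T1 + T2)%type, ps; split; first by rewrite card_sum.
move=> x; have [c1 /h1 [y [z [hy Ey]]]] := s1 x.
have [c2 /h2 hz] := s2 z.
exists (fun t => match t with inl i => c1 i | inr j => c2 j end); rewrite sumE.
rewrite opprD addrA Ey -addrA -mulrBr; case: hJ => _ hD _; exact: hD.
Qed.

Lemma spanned_codim (F : fieldType) (J : {poly {poly F}} -> Prop) n :
  isideal J -> spanned_by J n -> exists m, codim J m.
Proof.
move=> hJ; elim: n => [|n IH] [T [ps [hT hs]]].
  exists 0%N, T, ps; split=> // c _ t.
  by move/eqP: hT; rewrite -leqn0 leqNgt; case/negP; apply/card_gt0P; exists t.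
have [hi|hi] := classic (indep J ps); first by exists n.+1, T, ps.
have [c hc'] := not_all_ex_not _ _ hi.
have [hc /not_all_ex_not [t0 ct0]] := imply_to_and _ _ hc'.
(* The index [t0] has a nonzero coefficient in a dependence, so its element is a combination of the
   others and is dropped. *)
apply: IH; exists {t in predC1 t0}, (fun t => ps (val t)); split.
  by rewrite card_sig cardC1 hT.
move/eqP: ct0 => ct0; move=> x; have [d hd] := hs x.
exists (fun t => d (val t) - d t0 / c t0 * c (val t)).
have -> : x - \sum_(t : {t in predC1 t0}) cst (d (val t) - d t0 / c t0 * c (val t)) * ps (val t)
  = (x - \sum_t cst (d t) * ps t) + cst (d t0 / c t0) * \sum_t cst (c t) * ps t.
  pose f t := cst (d t - d t0 / c t0 * c t) * ps t.
  rewrite (_ : \sum_(t : {t in predC1 t0}) _ = \sum_t f t).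
    rewrite -addrA; congr (_ + _); rewrite mulr_sumr -!sumrN -big_split /=.
    by apply: eq_bigr => t _; rewrite /f /cst !(polyCB, polyCM); ring.
  rewrite [RHS](bigD1 t0) //= {1}/f divfK // subrr /cst !polyC0 mul0r add0r.
  by rewrite -(big_sub (predC1 t0) f).
by case: (hJ) => _ hD hM; apply: hD => //; apply: hM.
Qed.

(** * Ideals of the local ring at the origin *)

(* The ideals generated by [a, b] (resp. [a, b, c]) in the local ring at the origin,
   contracted to the polynomial ring. *)
Definition loc2 (F : fieldType) (a b x : {poly {poly F}}) : Prop :=
  exists s p q, at0 s != 0 /\ s * x = p * a + q * b.

Definition loc3 (F : fieldType) (a b c x : {poly {poly F}}) : Prop :=
  exists s p q r, at0 s != 0 /\ s * x = p * a + q * b + r * c.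

Definition saturated (F : fieldType) (J : {poly {poly F}} -> Prop) : Prop :=
  forall s x, at0 s != 0 -> J (s * x) -> J x.

Lemma at01 (F : fieldType) : at0 (1 : {poly {poly F}}) = 1.
Proof. by rewrite /at0 !hornerE. Qed.

Lemma at01_neq0 (F : fieldType) : at0 (1 : {poly {poly F}}) != 0.
Proof. by rewrite at01 oner_neq0. Qed.

Lemma loc2_ideal (F : fieldType) (a b : {poly {poly F}}) : isideal (loc2 a b).
Proof.
split.
- by exists 1, 0, 0; rewrite at01_neq0; split=> //; ring.
- move=> x y [s [p [q [s0 E]]]] [s' [p' [q' [s0' E']]]].
  exists (s * s'), (s' * p + s * p'), (s' * q + s * q'); rewrite at0M mulf_neq0 //; split=> //.
  rewrite (_ : s * s' * (x + y) = s' * (s * x) + s * (s' * y)); last by ring.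
  by rewrite E E'; ring.
- move=> c x [s [p [q [s0 E]]]]; exists s, (c * p), (c * q); split=> //.
  by rewrite mulrCA E; ring.
Qed.

Lemma loc3_ideal (F : fieldType) (a b c : {poly {poly F}}) : isideal (loc3 a b c).
Proof.
split.
- by exists 1, 0, 0, 0; rewrite at01_neq0; split=> //; ring.
- move=> x y [s [p [q [r [s0 E]]]]] [s' [p' [q' [r' [s0' E']]]]].
  exists (s * s'), (s' * p + s * p'), (s' * q + s * q'), (s' * r + s * r').
  rewrite at0M mulf_neq0 //; split=> //.
  rewrite (_ : s * s' * (x + y) = s' * (s * x) + s * (s' * y)); last by ring.
  by rewrite E E'; ring.
- move=> d x [s [p [q [r [s0 E]]]]]; exists s, (d * p), (d * q), (d * r); split=> //.
  by rewrite mulrCA E; ring.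
Qed.

Lemma loc2_sat (F : fieldType) (a b : {poly {poly F}}) : saturated (loc2 a b).
Proof.
move=> s x s0 [s' [p [q [s0' E]]]]; exists (s' * s), p, q.
by rewrite at0M mulf_neq0 // -mulrA.
Qed.

Lemma loc3_sat (F : fieldType) (a b c : {poly {poly F}}) : saturated (loc3 a b c).
Proof.
move=> s x s0 [s' [p [q [r [s0' E]]]]]; exists (s' * s), p, q, r.
by rewrite at0M mulf_neq0 // -mulrA.
Qed.

Lemma loc2P (F : fieldType) (a b : {poly {poly F}}) (J : {poly {poly F}} -> Prop) :
  isideal J -> saturated J -> J a -> J b -> forall x, loc2 a b x -> J x.
Proof.
move=> [_ hD hM] hs ha hb x [s [p [q [s0 E]]]]; apply: (hs s) => //; rewrite E.
by apply: hD; apply: hM.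
Qed.

Lemma loc3P (F : fieldType) (a b c : {poly {poly F}}) (J : {poly {poly F}} -> Prop) :
  isideal J -> saturated J -> J a -> J b -> J c -> forall x, loc3 a b c x -> J x.
Proof.
move=> [_ hD hM] hs ha hb hc x [s [p [q [r [s0 E]]]]]; apply: (hs s) => //; rewrite E.
by apply: (hD); [apply: (hD)|]; apply: hM.
Qed.

Lemma loc2l (F : fieldType) (a b : {poly {poly F}}) : loc2 a b a.
Proof. by exists 1, 1, 0; rewrite at01_neq0; split=> //; ring. Qed.

Lemma loc2r (F : fieldType) (a b : {poly {poly F}}) : loc2 a b b.
Proof. by exists 1, 0, 1; rewrite at01_neq0; split=> //; ring. Qed.

Lemma loc31 (F : fieldType) (a b c : {poly {poly F}}) : loc3 a b c a.
Proof. by exists 1, 1, 0, 0; rewrite at01_neq0; split=> //; ring. Qed.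

Lemma loc32 (F : fieldType) (a b c : {poly {poly F}}) : loc3 a b c b.
Proof. by exists 1, 0, 1, 0; rewrite at01_neq0; split=> //; ring. Qed.

Lemma loc33 (F : fieldType) (a b c : {poly {poly F}}) : loc3 a b c c.
Proof. by exists 1, 0, 0, 1; rewrite at01_neq0; split=> //; ring. Qed.

Lemma primary_sub (F : fieldType) (J J' : {poly {poly F}} -> Prop) :
  (forall x, J x -> J' x) -> primary J -> primary J'.
Proof. by move=> h [K [h1 h2]]; exists K; split; apply: h. Qed.

Lemma codim_eq (F : fieldType) (J J' : {poly {poly F}} -> Prop) n :
  (forall x, J x <-> J' x) -> codim J n -> codim J' n.
Proof.
move=> h [T [ps [hT hi hs]]]; exists T, ps; split=> //.
  by move=> c /h; apply: hi.
by move=> x; have [c /h hc] := hs x; exists c.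
Qed.

(* The quotient of the polynomial ring by the prime [P] is a line with coordinate ring
   [{poly F}] through the origin, [ev] being the restriction to this line. *)
Definition line (F : fieldType) (P : {poly {poly F}}) (ev : {poly {poly F}} -> {poly F})
    (io : {poly F} -> {poly {poly F}}) : Prop :=
  [/\ P != 0 /\ (forall x y, ev (x + y) = ev x + ev y), (forall x y, ev (x * y) = ev x * ev y),
     (forall c, ev (cst c) = c%:P) /\ (forall x, ev x = 0 <-> exists y, x = P * y),
     (forall p, ev (io p) = p) & (forall x, (ev x).[0] = at0 x)].

Lemma line_sum (F : fieldType) (P : {poly {poly F}}) ev io (T : finType) (f : T -> {poly {poly F}}) :
  line P ev io -> ev (\sum_t f t) = \sum_t ev (f t).
Proof.
case=> [[_ hD] _ [hc _] _ _]; apply: big_morph => //.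
by have := hc 0; rewrite /cst !polyC0.
Qed.

Lemma line_sub (F : fieldType) (P : {poly {poly F}}) ev io x y :
  line P ev io -> ev (x - y) = ev x - ev y.
Proof.
case=> [[_ hD] hM [hc _] _ _]; rewrite hD -mulN1r hM.
have -> : (-1 : {poly {poly F}}) = cst (-1) by rewrite /cst !polyCN !polyC1.
by rewrite hc polyCN polyC1 mulN1r.
Qed.

Lemma codim_line_order (F : fieldType) (P : {poly {poly F}}) ev io r :
  line P ev io -> codim (fun x => exists k, ev x = 'X^r * k) r.
Proof.
move=> hl; case: (hl) => [[P0 hD] hM [hc hk] hio _].
have sumE (c : 'I_r -> F) : ev (\sum_t cst (c t) * io 'X^t) = \poly_(i < r) (if insub i is Some j then c j else 0).
  rewrite (line_sum _ hl) poly_def; apply: eq_bigr => i _.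
  by rewrite hM hc hio mul_polyC valK.
exists 'I_r, (fun i : 'I_r => io 'X^i); split; first by rewrite card_ord.
- move=> c [k]; rewrite sumE => /polyP E t; have := E t.
  by rewrite coef_poly ltn_ord valK coefXnM ltn_ord.
- move=> x; exists (fun i : 'I_r => (ev x)`_i), (\poly_(i < size (ev x)) (ev x)`_(i + r)).
  apply/polyP => i; rewrite (line_sub _ _ hl) sumE coefB coef_poly coefXnM coef_poly.
  case: ltnP => hi; first by rewrite insubT subrr.
  rewrite subr0 subnK //; case: ltnP => // h; rewrite nth_default //.
  by apply: leq_trans h _; rewrite leq_subr.
Qed.

Lemma poly_cancel_unit (F : fieldType) (s x k : {poly F}) r :
  s.[0] != 0 -> s * x = 'X^r * k -> exists k', x = 'X^r * k'.
Proof.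
move=> s0 E; have : 'X^r %| s * x by rewrite E dvdp_mulr.
rewrite Gauss_dvdpr; first by case/dvdpP => k' ->; exists k'; rewrite mulrC.
apply: coprimep_expl; rewrite coprimep_sym -[X in coprimep _ X]subr0 -polyC0 coprimep_XsubC.
by rewrite /root.
Qed.

(** Additivity of intersection numbers: adding [P] to the ideal leaves F[t]/(t^r), where r is the
    order of [b] on the line, and the colon ideal by [P] is [loc2 Q b] because [b] is not divisible
    by [P]. *)
Lemma codim_loc2_mul (F : fieldType) (P Q b : {poly {poly F}}) ev io r h n :
  line P ev io -> ev b = 'X^r * h -> h.[0] != 0 -> primary (loc2 (P * Q) b) ->
  codim (loc2 Q b) n -> codim (loc2 (P * Q) b) (r + n).
Proof.
move=> hl eb h0 hp hn; case: (hl) => [[P0 hD] hM [hc hk] hio hz].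
have hJ := loc2_ideal (P * Q) b.
have evP : ev P = 0 by apply/hk; exists 1; rewrite mulr1.
apply: (codim_exact (P := P) hJ _ _ _ hn (J1 := fun x => exists k, ev x = 'X^r * k)).
- move=> x; split=> [[k Ek]|[y [z [[s [p [q [s0 E]]]] ->]]]].
    (* On the line [h x] and [k b] agree, so their difference is a multiple of [P]; since [h] is a
       unit at the origin it can be inverted modulo the ideal. *)
    have /hk [z Ez] : ev (io h * x - io k * b) = 0.
      by rewrite (line_sub _ _ hl) !hM !hio Ek eb; ring.
    have /(unit_mod_primary hJ hp) [s' hs'] : at0 (io h) != 0 by rewrite -hz hio.
    exists ((1 - s' * io h) * x + s' * io k * b), (s' * z); split; last first.
      by rewrite mulrCA -Ez; ring.
    case: (hJ) => _ hD' hM'; apply: (hD'); first exact: idealMr.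
    by apply: (hM'); apply: loc2r.
  have [||k Ek] := @poly_cancel_unit _ (ev s) (ev y) (ev q * h) r; first by rewrite hz.
    by rewrite -hM E hD !hM evP eb; ring.
  by exists k; rewrite hD hM evP mul0r addr0.
- move=> x; split=> [[s [p [q [s0 E]]]]|[s [p [q [s0 E]]]]].
    by exists s, p, (P * q); split=> //; rewrite mulrCA E; ring.
  (* As [b] does not vanish identically on the line, [q] does, so [P] divides [q] and can be
     cancelled from the relation. *)
  have : ev q * ev b = 0.
    rewrite -hM (_ : q * b = P * (s * x - p * Q)) ?hM ?evP ?mul0r //.
    by rewrite mulrBr [P * (s * x)]mulrCA E; ring.
  move/eqP; rewrite mulf_eq0 eb mulf_eq0 expf_eq0 polyX_eq0 andbF /=.
  case/orP => [/eqP /hk [q' Eq]|/eqP h00]; last by rewrite h00 horner0 eqxx in h0.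
  exists s, p, q'; split=> //; apply: (mulfI P0); rewrite mulrCA E Eq; ring.
- exact: (codim_line_order r hl).
Qed.

Lemma line_w (F : fieldType) :
  line (\w : {poly {poly F}}) (map_poly (horner_eval 0)) (map_poly polyC).
Proof.
split.
- by split=> [|x y]; rewrite ?polyC_eq0 ?polyX_eq0 ?rmorphD.
- by move=> x y; rewrite rmorphM.
- split=> [c|x]; first by rewrite /cst map_polyC /= horner_evalE hornerC.
  split=> [E|[y ->]]; last first.
    by rewrite rmorphM /= map_polyC /= horner_evalE hornerX mul0r.
  exists (\poly_(i < size x) (x`_i %/ 'X)); apply/polyP => i.
  rewrite coefCM coef_poly; case: ltnP => hi; last by rewrite nth_default // mulr0.
  have : (map_poly (horner_eval 0) x)`_i = 0 by rewrite E coef0.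
  rewrite coef_map /= horner_evalE => h.
  rewrite mulrC divpK // -[X in X %| _]subr0 -polyC0 dvdp_XsubCl; exact/eqP.
- by move=> p; apply/polyP => i; rewrite !coef_map /= horner_evalE hornerC.
- move=> x; rewrite /at0 !horner_coef0 coef_map /= horner_evalE.
  by rewrite horner_coef0.
Qed.

Lemma line_branch (F : fieldType) (U : {poly F}) :
  U.[0] = 0 -> line ('X - U%:P) (fun x => x.[U]) polyC.
Proof.
move=> U0; split.
- by split=> [|x y]; rewrite ?polyXsubC_eq0 ?hornerD.
- by move=> x y; rewrite hornerM.
- split=> [c|x]; first by rewrite hornerC.
  split=> [/eqP /factor_theorem [y ->]|[y ->]]; first by exists y; rewrite mulrC.
  by rewrite hornerM hornerXsubC subrr mul0r.
- by move=> p; rewrite hornerC.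
- move=> x; rewrite /at0.
  have /factor_theorem [y Hy] : root (x - x.[0]%:P) 0 by rewrite /root !hornerE subrr.
  by rewrite -[in LHS](subrK x.[0]%:P x) Hy subr0 hornerD hornerM hornerX !hornerE /= U0 mulr0 add0r.
Qed.

(** Modulo [b], the element u^r times a unit is a multiple of w; a power of w in [J] therefore
    forces a power of u. *)
Lemma primary_of_order (F : fieldType) (J : {poly {poly F}} -> Prop) b r h K :
  isideal J -> saturated J -> J b -> map_poly (horner_eval 0) b = 'X^r * h -> h.[0] != 0 ->
  J (\w ^+ K) -> primary J.
Proof.
move=> hJ hs hb eb h0 hw; case: (line_w F) => [[P0 hD] hM [hc hk] hio hz].
have /hk [y Ey] : map_poly (horner_eval 0) ('X^r * map_poly polyC h - b) = 0.
  by rewrite rmorphB rmorphM /= map_polyXn hio eb subrr.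
case: (hJ) => h0' hD' hM'; exists (r * (1 + K) + K)%N; split; last first.
  by rewrite exprD; apply: hM'.
rewrite exprD mulrC; apply: hM'; rewrite exprM.
apply: (hs ((map_poly polyC h) ^+ (1 + K))).
  by rewrite at0X expf_neq0 // -hz hio.
rewrite -exprMn mulrC -[_ * _](subrK b) Ey addrC; apply: ideal_exprD => //.
by rewrite exprMn; apply: idealMr.
Qed.

Lemma codim_loc2_w (F : fieldType) (Q b : {poly {poly F}}) r h n :
  map_poly (horner_eval 0) b = 'X^r * h -> h.[0] != 0 -> primary (loc2 (\w * Q) b) ->
  codim (loc2 Q b) n -> codim (loc2 (\w * Q) b) (r + n).
Proof. exact: (codim_loc2_mul (line_w F)). Qed.

Lemma codim_unit (F : fieldType) (J : {poly {poly F}} -> Prop) : isideal J -> J 1 -> codim J 0.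
Proof.
move=> [h0 hD hM] h1; exists 'I_0, (fun=> 0); split; first by rewrite card_ord.
  by move=> c _ [].
by move=> x; exists (fun=> 0); rewrite big_ord0 subr0 -[x]mulr1; apply: hM.
Qed.

Lemma spanned_loc2_wX (F : fieldType) (b : {poly {poly F}}) r h K :
  map_poly (horner_eval 0) b = 'X^r * h -> h.[0] != 0 ->
  codim (loc2 (\w ^+ K) b) (r * K).
Proof.
move=> eb h0; elim: K => [|K IH].
  by rewrite muln0; apply: codim_unit; [apply: loc2_ideal | rewrite expr0; apply: loc2l].
rewrite exprS mulnS; apply: (codim_loc2_w eb) => //.
rewrite -exprS; apply: (primary_of_order (loc2_ideal _ _) (@loc2_sat _ _ _) (loc2r _ _) eb h0).
exact: loc2l.
Qed.

Lemma spanned_sub (F : fieldType) (J J' : {poly {poly F}} -> Prop) n :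
  (forall x, J x -> J' x) -> spanned_by J n -> spanned_by J' n.
Proof.
by move=> h [T [ps [hT hs]]]; exists T, ps; split=> // x; have [c /h hc] := hs x; exists c.
Qed.

(** The ideal contains [loc2 (\w ^+ K) b], whose quotient has dimension [r * K]. *)
Lemma codim_exists (F : fieldType) (J : {poly {poly F}} -> Prop) b r h K :
  isideal J -> saturated J -> J b -> map_poly (horner_eval 0) b = 'X^r * h -> h.[0] != 0 ->
  J (\w ^+ K) -> exists n, codim J n.
Proof.
move=> hJ hs hb eb h0 hw; apply: (@spanned_codim _ _ (r * K)) => //.
by apply: spanned_sub (codim_spanned (spanned_loc2_wX K eb h0)); apply: loc2P.
Qed.

(** * Ramified base change *)

(* the base change w = t^e *)
Definition ram (F : fieldType) (e : nat) (x : {poly {poly F}}) : {poly {poly F}} :=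
  map_poly (comp_poly 'X^e) x.

Lemma ramD (F : fieldType) e (x y : {poly {poly F}}) : ram e (x + y) = ram e x + ram e y.
Proof. exact: rmorphD. Qed.

Lemma ramM (F : fieldType) e (x y : {poly {poly F}}) : ram e (x * y) = ram e x * ram e y.
Proof. exact: rmorphM. Qed.

Lemma ramXn (F : fieldType) e (x : {poly {poly F}}) n : ram e (x ^+ n) = ram e x ^+ n.
Proof. exact: rmorphXn. Qed.

Lemma ram_sum (F : fieldType) e (T : finType) (f : T -> {poly {poly F}}) :
  ram e (\sum_t f t) = \sum_t ram e (f t).
Proof. exact: rmorph_sum. Qed.

Lemma ramX (F : fieldType) e : ram e ('X : {poly {poly F}}) = 'X.
Proof. exact: map_polyX. Qed.

Lemma ramw (F : fieldType) e : ram e (\w : {poly {poly F}}) = \w ^+ e.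
Proof. by rewrite /ram map_polyC /= comp_polyX polyC_exp. Qed.

Lemma ram_cst (F : fieldType) e (c : F) : ram e (cst c) = cst c.
Proof. by rewrite /ram /cst map_polyC /= comp_polyC. Qed.

Lemma ram_at0 (F : fieldType) e (x : {poly {poly F}}) : (0 < e)%N -> at0 (ram e x) = at0 x.
Proof.
move=> e0; rewrite /at0 !horner_coef0 coef_map /=.
by rewrite coef_comp_poly_Xn // dvdn0 div0n.
Qed.

(** The extension of [J] along w = t^e, written in the basis 1, t, ..., t^(e-1) of F[t] over F[w].
    Upstairs [\w] stands for t. *)
Definition ext (F : fieldType) e (J : {poly {poly F}} -> Prop) x : Prop :=
  exists y : 'I_e -> {poly {poly F}}, (forall k, J (y k)) /\ x = \sum_(k < e) \w ^+ k * ram e (y k).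

Lemma ext_ideal (F : fieldType) e (J : {poly {poly F}} -> Prop) :
  (0 < e)%N -> isideal J -> isideal (ext e J).
Proof.
move=> e0 hJ; have [h0 hD hM] := hJ.
have eD x y : ext e J x -> ext e J y -> ext e J (x + y).
  move=> [f [hf ->]] [g [hg ->]]; exists (fun k => f k + g k); split=> [k|]; first exact: hD.
  by rewrite -big_split; apply: eq_bigr => k _; rewrite /= ramD mulrDr.
have e0' : ext e J 0.
  exists (fun=> 0); split=> //; rewrite big1 // => k _.
  by rewrite /ram rmorph0 mulr0.
have eram z x : ext e J x -> ext e J (ram e z * x).
  move=> [f [hf ->]]; exists (fun k => z * f k); split=> [k|]; first exact: hM.
  by rewrite mulr_sumr; apply: eq_bigr => k _; rewrite /= ramM mulrCA.
have ew x : ext e J x -> ext e J (\w * x).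
  case: e e0 {eD e0' eram} => // e _ [f [hf ->]].
  (* Multiplication by t shifts the components cyclically; the last one returns to position 0 with
     the factor t^e = w. *)
  exists (fun k => if unlift ord0 k is Some j then f (widen_ord (leqnSn e) j) else \w * f ord_max).
  split=> [k|]; first by case: unliftP => [j _|_]; [exact: hf | exact: hM].
  rewrite big_ord_recr [RHS]big_ord_recl /= unlift_none mulrDr addrC; congr (_ + _).
    by rewrite ramM ramw expr0 mul1r exprS mulrA.
  by rewrite mulr_sumr; apply: eq_bigr => k _; rewrite liftK /= exprS mulrA.
have eC (c : {poly F}) x : ext e J x -> ext e J (c%:P * x).
  move=> hx; elim/poly_ind: c => [|c d IHc]; first by rewrite polyC0 mul0r.
  rewrite polyCD polyCM mulrDl; apply: (eD); first by rewrite -mulrA mulrCA; apply: ew.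
  by rewrite -/(cst d) -(ram_cst e d); apply: eram.
split=> [||a x hx]; [exact: e0'|exact: eD|].
elim/poly_ind: a => [|a c IH]; first by rewrite mul0r.
rewrite mulrDl; apply: eD; last exact: eC.
by rewrite -mulrA mulrCA -[X in X * _](ramX F e); apply: eram.
Qed.

Lemma ext_ram (F : fieldType) e (J : {poly {poly F}} -> Prop) x :
  (0 < e)%N -> J 0 -> J x -> ext e J (ram e x).
Proof.
case: e => // e _ h0 hx; exists (fun k => if k == ord0 then x else 0).
split=> [k|]; first by case: eqP.
rewrite big_ord_recl /= expr0 mul1r big1 ?addr0 // => k _.
by rewrite /ram rmorph0 mulr0.
Qed.

Lemma ext_all (F : fieldType) e (x : {poly {poly F}}) : (0 < e)%N -> ext e (fun=> True) x.
Proof.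
move=> e0; have [|_ _ hM] := @ext_ideal F e (fun=> True) e0; first by split.
rewrite -[x]mulr1; apply: hM.
have -> : 1 = ram e (1 : {poly {poly F}}) by rewrite /ram rmorph1.
exact: ext_ram.
Qed.

(** The exponents of t in the k-th summand are exactly those congruent to k modulo e, so the
    components can be read off from the coefficients. *)
Lemma ext_unique (F : fieldType) e (y z : 'I_e -> {poly {poly F}}) : (0 < e)%N ->
  \sum_(k < e) \w ^+ k * ram e (y k) = \sum_(k < e) \w ^+ k * ram e (z k) -> y =1 z.
Proof.
move=> e0; have H (f : 'I_e -> {poly {poly F}}) (k : 'I_e) a j :
    (\sum_(k < e) \w ^+ k * ram e (f k))`_a`_(e * j + k) = (f k)`_a`_j.
  rewrite !coef_sum (bigD1 k) //= -polyC_exp coefCM coef_map /= coefXnM.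
  rewrite ltnNge leq_addl /= addnK coef_comp_poly_Xn // dvdn_mulr // mulKn //.
  rewrite big1 ?addr0 // => k' nk.
  rewrite -polyC_exp coefCM coef_map /= coefXnM; case: ltnP => // hk.
  rewrite coef_comp_poly_Xn //; case: ifP => // dv.
  case/eqP: nk; apply/val_inj => /=.
  have : (e * j + k == k' %[mod e])%N by rewrite eqn_mod_dvd.
  by rewrite mulnC modnMDl !modn_small // => /eqP.
move=> E k; apply/polyP => a; apply/polyP => j.
by rewrite -(H y) -(H z) E.
Qed.

Lemma codim_ext (F : fieldType) e (J : {poly {poly F}} -> Prop) n :
  (0 < e)%N -> isideal J -> codim J n -> codim (ext e J) (e * n).
Proof.
move=> e0 hJ [T [ps [hT hi hs]]].
exists ('I_e * T)%type, (fun kt : 'I_e * T => \w ^+ kt.1 * ram e (ps kt.2)).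
have sumE (c : 'I_e * T -> F) : \sum_kt cst (c kt) * (\w ^+ kt.1 * ram e (ps kt.2)) =
   \sum_(k < e) \w ^+ k * ram e (\sum_t cst (c (k, t)) * ps t).
  transitivity (\sum_(k < e) \sum_t cst (c (k, t)) * (\w ^+ k * ram e (ps t))).
    by rewrite pair_bigA; apply: eq_bigr => -[].
  apply: eq_bigr => k _; rewrite ram_sum mulr_sumr; apply: eq_bigr => t _.
    by rewrite ramM ram_cst mulrCA.
split; first by rewrite card_prod card_ord hT.
- move=> c; rewrite sumE => -[y [hy Ey]] [k t].
  have E := ext_unique e0 Ey.
  have : J (\sum_t cst (c (k, t)) * ps t) by rewrite (E k).
  by move/hi/(_ t).
- move=> x; have [y [_ Ey]] := ext_all x e0.
  have /fin_all_exists [c hc] : forall k, exists c : T -> F,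
    J (y k - \sum_t cst (c t) * ps t) by move=> k; apply: hs.
  exists (fun kt => c kt.1 kt.2); rewrite sumE /=.
  exists (fun k => y k - \sum_t cst (c k t) * ps t); split=> //.
  rewrite Ey -sumrB; apply: eq_bigr => k _.
  by rewrite /ram rmorphB mulrBr.
Qed.

(** A denominator upstairs need not come from downstairs; since the extended ideal is again primary,
    such a denominator is invertible modulo it and may be cleared. *)
Lemma ext_loc2 (F : fieldType) e (a b : {poly {poly F}}) x :
  (0 < e)%N -> primary (loc2 a b) ->
  (ext e (loc2 a b) x <-> loc2 (ram e a) (ram e b) x).
Proof.
move=> e0 [K [hu hw]]; have hJ := loc2_ideal a b; have hE := ext_ideal e0 hJ.
have pE : primary (ext e (loc2 a b)).
  exists (e * K)%N; case: (hE) => _ _ hM; split.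
    rewrite -[X in X ^+ _](ramX F e) -ramXn; apply: ext_ram => //; first by case: hJ.
    by case: (e) e0 => // e' _; rewrite mulSn exprD; apply: idealMr.
  by rewrite exprM -ramw -ramXn; apply: ext_ram => //; case: hJ.
split=> [[y [hy ->]]|].
  apply: ideal_sum => [|k _]; first exact: loc2_ideal.
  case: (loc2_ideal (ram e a) (ram e b)) => _ _; apply.
  have [s [p [q [s0 E]]]] := hy k; exists (ram e s), (ram e p), (ram e q).
  by rewrite ram_at0 // -ramM E ramD !ramM.
apply: loc2P => //.
- by move=> s z; apply: primary_sat.
- by apply: ext_ram => //; [case: hJ | exact: loc2l].
- by apply: ext_ram => //; [case: hJ | exact: loc2r].
Qed.

Lemma codim_ram (F : fieldType) e (a b : {poly {poly F}}) n :
  (0 < e)%N -> primary (loc2 a b) -> codim (loc2 a b) n ->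
  codim (loc2 (ram e a) (ram e b)) (e * n).
Proof.
move=> e0 hp /(codim_ext e0 (loc2_ideal _ _)); apply: codim_eq => x; exact: ext_loc2.
Qed.

(** Descent: the component at t^0 of a membership relation upstairs is one downstairs. The
    denominator stays a unit because its other components carry a factor t. *)
Lemma ram_loc2_inv (F : fieldType) e (a b x : {poly {poly F}}) :
  (0 < e)%N -> loc2 (ram e a) (ram e b) (ram e x) -> loc2 a b x.
Proof.
case: e => // e _ [s [p [q [s0 E]]]].
have [y [_ Ey]] := ext_all s (ltn0Sn e).
have [p' [_ Ep]] := ext_all p (ltn0Sn e).
have [q' [_ Eq]] := ext_all q (ltn0Sn e).
exists (y ord0), (p' ord0), (q' ord0); split.
  move: s0; rewrite Ey big_ord_recl /= expr0 mul1r at0D ram_at0 //.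
  rewrite [X in _ + X](_ : _ = 0) ?addr0 // /at0 !horner_sum big1 // => k _.
  by rewrite -/(at0 _) at0M exprS at0M at0_w !mul0r.
have := @ext_unique F e.+1 (fun k => y k * x) (fun k => p' k * a + q' k * b) (ltn0Sn e).
move/(_ _ ord0); apply; move: E; rewrite Ey Ep Eq !mulr_suml -big_split /=.
under eq_bigr => k _ do rewrite -mulrA -ramM.
by under [in RHS]eq_bigr => k _ do rewrite -!mulrA -!ramM -mulrDr -ramD.
Qed.

(** * Hensel lifting and Puiseux expansions *)

Notation map0 := (map_poly (horner_eval 0)).

Lemma map0_eq0 (F : fieldType) (x : {poly {poly F}}) : map0 x = 0 -> exists y, x = \w * y.
Proof. by case: (line_w F) => _ _ [_ hk] _ _ /hk. Qed.

Lemma map0_w (F : fieldType) : map0 (\w : {poly {poly F}}) = 0.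
Proof. by rewrite map_polyC /= horner_evalE hornerX. Qed.

Lemma map0_lift (F : fieldType) (p : {poly F}) : map0 (map_poly polyC p) = p.
Proof. by case: (line_w F) => _ _ _ hio _; apply: hio. Qed.

(** Linear Hensel lifting. The cofactor [H] is not normalised, since [x] need not be monic; only the
    degree of [G] is controlled. *)
Lemma hensel (F : fieldType) (x : {poly {poly F}}) (G0 H0 : {poly F}) N :
  map0 x = G0 * H0 -> G0 \is monic -> coprimep G0 H0 ->
  exists G H z, [/\ G \is monic, size G = size G0, map0 G = G0, map0 H = H0 &
                    x = G * H + \w ^+ N.+1 * z].
Proof.
move=> ex mG /Bezout_eq1_coprimepP [[u v] /= uv].
have mapl (p : {poly F}) : map0 (map_poly polyC p) = p := map0_lift p.
elim: N => [|N [G [H [z [mG' sG eG eH Ex]]]]].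
  have [z Ez] : exists z, x - map_poly polyC G0 * map_poly polyC H0 = \w * z.
    by apply: map0_eq0; rewrite rmorphB rmorphM /= !mapl ex subrr.
  exists (map_poly polyC G0), (map_poly polyC H0), z; split=> //.
  - by rewrite monic_map.
  - by rewrite size_map_polyC.
  - by rewrite expr1 -Ez addrC subrK.
(* The corrections solve [E = al * H0 + be * G0]. Reducing modulo [G0] makes [al] of smaller degree
   than [G0], so that [G] stays monic of the same degree. *)
pose E := map0 z; pose al := (E * v) %% G0; pose be := E * u + (E * v) %/ G0 * H0.
have EE : E = al * H0 + be * G0.
  transitivity (E * (u * G0 + v * H0)); first by rewrite uv mulr1.
  rewrite mulrDr [E * (v * _)]mulrA [in LHS](divp_eq (E * v) G0) /be -/al; ring.
have [z' Ez'] : exists z', z - map_poly polyC al * H - map_poly polyC be * G = \w * z'.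
  by apply: map0_eq0; rewrite !rmorphB !rmorphM /= !mapl eG eH -/E {1}EE; ring.
have sal : (size (\w ^+ N.+1 * map_poly polyC al)%R < size G)%N.
  rewrite -polyC_exp mul_polyC; apply: leq_ltn_trans (size_scale_leq _ _) _.
  by rewrite size_map_polyC sG ltn_modp monic_neq0.
have m0 y : map0 (\w ^+ N.+1 * y) = 0 :> {poly F}.
  by rewrite rmorphM rmorphXn /= map0_w exprS !mul0r.
exists (G + \w ^+ N.+1 * map_poly polyC al), (H + \w ^+ N.+1 * map_poly polyC be).
exists (z' - \w ^+ N * map_poly polyC al * map_poly polyC be); split.
- by rewrite monicE lead_coefDl // -monicE.
- by rewrite size_polyDl.
- by rewrite rmorphD /= m0 addr0.
- by rewrite rmorphD /= m0 addr0.
- have Ez : z = \w * z' + map_poly polyC al * H + map_poly polyC be * G by rewrite -Ez'; ring.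
  by rewrite Ex Ez !exprS; ring.
Qed.

(** The cofactor is replaced by the quotient of [x] by the monic [G]. By uniqueness of Euclidean
    division the remainder is [\w ^+ N] times the remainder of [z], hence small. *)
Lemma monic_cofactor (F : fieldType) (x G H z : {poly {poly F}}) N :
  x \is monic -> G \is monic -> (size G <= size x)%N -> x = G * H + \w ^+ N * z ->
  exists H' z', [/\ H' \is monic, (size G + size H' = (size x).+1)%N & x = G * H' + \w ^+ N * z'].
Proof.
move=> mx mG sGx Ex.
have G0 : G != 0 by rewrite monic_neq0.
pose H' := Pdiv.Ring.rdivp x G; pose rho := Pdiv.Ring.rmodp x G.
have Ex' : x = H' * G + rho := Pdiv.RingMonic.rdivp_eq mG x.
pose Y1 := Pdiv.Ring.rdivp z G; pose Y2 := Pdiv.Ring.rmodp z G.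
have Ez : z = Y1 * G + Y2 := Pdiv.RingMonic.rdivp_eq mG z.
have srho : (size rho < size G)%N by rewrite Pdiv.Ring.ltn_rmodpN0.
have sY : (size (\w ^+ N * Y2)%R < size G)%N.
  rewrite -polyC_exp mul_polyC; apply: leq_ltn_trans (size_scale_leq _ _) _.
  by rewrite Pdiv.Ring.ltn_rmodpN0.
have E : rho - \w ^+ N * Y2 = G * (H - H' + \w ^+ N * Y1).
  have -> : rho = x - H' * G by rewrite Ex' addrC addKr.
  by rewrite Ex Ez; ring.
have Erho : rho = \w ^+ N * Y2.
  apply/eqP; rewrite -subr_eq0 E mulf_eq0 (negPf G0) /=.
  apply/negPn/negP => nz.
  have : (size (rho - \w ^+ N * Y2)%R < size G)%N.
    by apply: leq_ltn_trans (size_polyD _ _) _; rewrite size_polyN gtn_max srho sY.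
  rewrite E size_monicM // ltnNge => /negP; apply.
  by rewrite -ltnS prednK ?addn_gt0 ?size_poly_gt0 ?G0 // -addn1 leq_add2l size_poly_gt0.
have H'0 : H' != 0.
  by apply: contraTneq sGx => h; rewrite Ex' h mul0r add0r -ltnNge.
have sHG : (size rho < size (H' * G)%R)%N.
  rewrite size_Mmonic //; apply: leq_trans srho _.
  by rewrite -ltnS prednK ?addn_gt0 ?size_poly_gt0 ?H'0 // addnC -addn1 leq_add2l size_poly_gt0.
have sx : size x = size (H' * G) by rewrite Ex' size_polyDl.
exists H', Y2; split.
- rewrite monicE -[lead_coef H'](_ : lead_coef x = _) -?monicE //.
  by rewrite Ex' lead_coefDl // lead_coef_Mmonic.
- by rewrite sx size_Mmonic // prednK ?addn_gt0 ?size_poly_gt0 ?H'0 // addnC.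
- by rewrite -Erho mulrC -Ex'.
Qed.

Lemma coef_XaddC_exp (A : comNzRingType) (c : A) r :
  (('X + c%:P) ^+ r.+1)`_r = c *+ r.+1.
Proof.
have mon k : (('X + c%:P) ^+ k)`_k = 1.
  rewrite -[c]opprK polyCN; have := monicXsubC (- c) => /(monic_exp k).
  by rewrite monicE lead_coefE size_exp_XsubC => /eqP.
elim: r => [|r IH]; first by rewrite expr1 coefD coefX coefC add0r.
by rewrite exprSr mulrDr coefD coefMX /= IH coefMC mon mul1r [in RHS]mulrSr.
Qed.

Lemma ram_ram (F : fieldType) p q (x : {poly {poly F}}) : ram q (ram p x) = ram (p * q) x.
Proof.
apply/polyP => i; rewrite !coef_map /= -comp_polyA; congr (_ \Po _).
by rewrite comp_Xn_poly -exprM mulnC.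
Qed.

Lemma ram_prod (F : fieldType) q (us : seq {poly F}) :
  ram q (\prod_(U <- us) ('X - U%:P)) = \prod_(U <- map (comp_poly 'X^q) us) ('X - U%:P).
Proof.
rewrite /ram rmorph_prod big_map /=; apply: eq_bigr => U _.
by rewrite rmorphB /= map_polyX map_polyC.
Qed.

Lemma ram_wX (F : fieldType) q n : ram q (\w ^+ n : {poly {poly F}}) = \w ^+ (q * n).
Proof. by rewrite ramXn ramw exprM. Qed.

(** Scaling all roots by c multiplies the j-th coefficient by c to the power [size us - j]; the
    factor [c ^+ j] on the left avoids the subtraction. *)
Lemma coef_prod_scale (A : comNzRingType) (c : A) (us : seq A) j :
  (\prod_(U <- us) ('X - (c * U)%:P))`_j * c ^+ j =
  c ^+ size us * (\prod_(U <- us) ('X - U%:P))`_j.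
Proof.
elim: us j => [|U us IH] j.
  by rewrite !big_nil coef1 expr0 mul1r; case: j => [|j]; rewrite ?expr0 ?mulr1 // mul0r.
rewrite !big_cons !mulrBl !coefB !coefCM !coefXM exprS; case: j => [|j] /=.
  by have := IH 0%N; rewrite expr0 !mulr1 => ->; ring.
have h1 := IH j; have h2 := IH j.+1; rewrite mulrBr mulrBl; congr (_ - _).
  by rewrite exprS mulrCA h1; ring.
by rewrite -[LHS]mulrA h2; ring.
Qed.

Lemma coef_wX_dvd (F : fieldType) (D : {poly {poly F}}) M :
  (forall j, exists z, D`_j = 'X^M * z) -> exists z, D = \w ^+ M * z.
Proof.
move=> h; exists (\poly_(j < size D) (D`_j %/ 'X^M)); apply/polyP => j.
rewrite -polyC_exp coefCM coef_poly; case: ltnP => hj; last by rewrite nth_default // mulr0.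
have [z ->] := h j; rewrite [in X in X %/ _]mulrC mulpK //.
by rewrite expf_neq0 // polyX_eq0.
Qed.

Lemma comp_prod_XsubC (A : comNzRingType) (us : seq A) (c : A) :
  (\prod_(U <- us) ('X - U%:P)) \Po ('X - c%:P) = \prod_(U <- [seq c + U | U <- us]) ('X - U%:P).
Proof.
rewrite rmorph_prod big_map; apply: eq_bigr => U _.
by rewrite /= rmorphB /= comp_polyX comp_polyC polyCD; ring.
Qed.

Lemma coef_shift_subleading (A : comNzRingType) (x : {poly A}) (c : A) r :
  x \is monic -> size x = r.+2 -> (x \Po ('X + c%:P))`_r = c *+ r.+1 + x`_r.
Proof.
move=> mx sx; pose L : {poly A} := (x - 'X^(r.+1) - x`_r *: 'X^r)%R.
have sL : (size L <= r)%N.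
  apply/leq_sizeP => j hj; rewrite !coefB coefZ !coefXn.
  have [->|jr] := eqVneq j r; first by rewrite (ltn_eqF (ltnSn r)) subr0 mulr1 subrr.
  have [->|jr1] := eqVneq j r.+1.
    by move: mx; rewrite monicE lead_coefE sx /= => /eqP ->; rewrite mulr0 subr0 subrr.
  rewrite mulr0 !subr0 nth_default // sx ltn_neqAle eq_sym jr1 /=.
  by rewrite ltn_neqAle eq_sym jr hj.
have Ex : x = 'X^(r.+1) + x`_r *: 'X^r + L by rewrite /L; ring.
rewrite {1}Ex; clearbody L; move: (x`_r) => a.
rewrite !comp_polyD comp_polyZ !comp_Xn_poly !coefD coefZ coef_XaddC_exp.
have -> : (L \Po ('X + c%:P))`_r = 0.
  have [->|L0] := eqVneq L 0; first by rewrite comp_poly0 coef0.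
  rewrite nth_default //; apply: leq_trans (size_comp_poly_leq _ _) _.
  by rewrite size_XaddC /= muln1 prednK // size_poly_gt0.
have -> : (('X + c%:P) ^+ r)`_r = 1.
  rewrite -[c]opprK polyCN; have := monicXsubC (- c) => /(monic_exp r).
  by rewrite monicE lead_coefE size_exp_XsubC => /eqP.
by rewrite mulr1 addr0.
Qed.

(** The edge of the Newton polygon with least slope [v j / (r - j)], with denominators cleared. *)
Lemma arg_min_slope (r : nat) (P : pred 'I_r) (v : 'I_r -> nat) :
  (exists j, P j) ->
  exists2 j0, P j0 & forall j, P j -> (v j0 * (r - j) <= v j * (r - j0))%N.
Proof.
case=> j1 hj1; pose s (j : 'I_r) : rat := (v j)%:R / (r - j)%:R.
have [j0 h0 hmin] := Order.TotalTheory.arg_minP s hj1; exists j0 => // j hj.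
have pos (i : 'I_r) : 0 < (r - i)%:R :> rat by rewrite ltr0n subn_gt0.
have := hmin j hj; rewrite /s ler_pdivrMr // mulrAC ler_pdivlMr // -!natrM ler_nat.
done.
Qed.

(** Truncated Puiseux expansions in t with t^q = w. The error t^(q K) is w^K, so the precision [K]
    does not depend on the ramification. *)
Definition splits_mod (F : fieldType) (x : {poly {poly F}}) (K : nat) : Prop :=
  exists q (us : seq {poly F}) z, [/\ (0 < q)%N, size us = (size x).-1 &
     ram q x = \prod_(U <- us) ('X - U%:P) + \w ^+ (q * K) * z].

Lemma order_at0 (F : fieldType) (p : {poly F}) :
  p != 0 -> exists m h, p = 'X^m * h /\ h.[0] != 0.
Proof.
move=> p0; have [m [q]] := multiplicity_XsubC p 0.
rewrite p0 /= subr0 => q0 E; exists m, q; split; first by rewrite mulrC.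
by rewrite -[_ == _]/(root q 0).
Qed.

Lemma splits_shift (F : fieldType) (x : {poly {poly F}}) (c : {poly F}) K :
  splits_mod (x \Po ('X + c%:P)) K -> splits_mod x K.
Proof.
move=> [q [us [z [q0 sus E]]]].
pose cq := c \Po 'X^q.
exists q, [seq cq + U | U <- us], (z \Po ('X - cq%:P)); split=> //.
  by rewrite size_map sus size_comp_poly2 // size_XaddC.
rewrite -comp_prod_XsubC.
have -> : ram q x = ram q (x \Po ('X + c%:P)) \Po ('X - cq%:P).
  rewrite /ram map_comp_poly rmorphD /= map_polyX map_polyC /= -/cq -comp_polyA.
  by rewrite comp_polyD comp_polyX comp_polyC subrK comp_polyXr.
by rewrite E comp_polyD comp_polyM -polyC_exp comp_polyC.
Qed.

Lemma splits_mul (F : fieldType) (x G H z : {poly {poly F}}) K :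
  x \is monic -> G \is monic -> H \is monic -> (size G + size H = (size x).+1)%N ->
  x = G * H + \w ^+ K * z -> splits_mod G K -> splits_mod H K -> splits_mod x K.
Proof.
move=> mx mG mH sGH Ex [q1 [us1 [z1 [q10 s1 E1]]]] [q2 [us2 [z2 [q20 s2 E2]]]].
pose v1 := map (comp_poly 'X^q2) us1; pose v2 := map (comp_poly 'X^q1) us2.
have E1' : ram (q1 * q2) G = \prod_(U <- v1) ('X - U%:P) + \w ^+ (q1 * q2 * K) * ram q2 z1.
  by rewrite -ram_ram E1 ramD ram_prod ramM ram_wX; congr (_ + \w ^+ _ * _); clear; lia.
have E2' : ram (q1 * q2) H = \prod_(U <- v2) ('X - U%:P) + \w ^+ (q1 * q2 * K) * ram q1 z2.
  by rewrite mulnC -ram_ram E2 ramD ram_prod ramM ram_wX; congr (_ + \w ^+ _ * _); clear; lia.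
have := monic_neq0 mG; have := monic_neq0 mH; rewrite -!size_poly_gt0 => sH sG.
exists (q1 * q2)%N, (v1 ++ v2), (ram q2 z1 * ram (q1 * q2) H +
  \prod_(U <- v1) ('X - U%:P) * ram q1 z2 + ram (q1 * q2) z); split; first by rewrite muln_gt0 q10.
  by rewrite size_cat !size_map s1 s2; clear -sH sG sGH; lia.
rewrite Ex ramD !ramM ram_wX E1' E2' big_cat /=.
by ring.
Qed.

(** The substitution u = t^m u' with t^k = w: the roots of [x] are t^m times those of [y]. The
    precision asked of [y] is [k * K] because its base variable is t. *)
Lemma splits_scale (F : fieldType) (x y : {poly {poly F}}) r k m K :
  (0 < k)%N -> size x = r.+1 -> size y = r.+1 -> y \is monic ->
  (forall j, (j <= r)%N -> (ram k x)`_j = 'X^(m * (r - j)) * y`_j) ->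
  splits_mod y (k * K) -> splits_mod x K.
Proof.
move=> k0 sx sy my Exy [q [us [z [q0 sus E]]]].
rewrite sy /= in sus.
pose c : {poly F} := 'X^(q * m).
have c0 : c != 0 by rewrite expf_neq0 // polyX_eq0.
have cram (n : nat) : 'X^(m * n) \Po 'X^q = c ^+ n :> {poly F}.
  by rewrite comp_Xn_poly -!exprM; congr (_ ^+ _); clear; lia.
have [w Ew] : exists w, ram (k * q) x - \prod_(U <- [seq c * U | U <- us]) ('X - U%:P)
    = \w ^+ (k * q * K) * w.
  apply: coef_wX_dvd => j; rewrite -ram_ram.
  have [jr|rj] := leqP j r; last first.
    exists 0; rewrite mulr0 nth_default //; apply: leq_trans (size_polyD _ _) _.
    rewrite size_polyN geq_max size_prod_XsubC size_map sus rj andbT.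
    by do 2!apply: leq_trans (size_poly _ _) _; rewrite sx.
  exists (c ^+ (r - j) * z`_j).
  rewrite coefB [in X in X - _]coef_map /= Exy // comp_polyM cram big_map.
  have -> : y`_j \Po 'X^q = (ram q y)`_j by rewrite coef_map.
  apply: (mulIf (expf_neq0 j c0)).
  rewrite mulrBl coef_prod_scale sus E coefD -polyC_exp coefCM.
  have -> : c ^+ r = c ^+ (r - j) * c ^+ j by rewrite -exprD subnK.
  have -> : (q * (k * K) = k * q * K)%N by clear; lia.
  ring.
exists (k * q)%N, [seq c * U | U <- us], w; split; first by rewrite muln_gt0 k0.
  by rewrite size_map sus sx.
by rewrite -Ew addrC subrK.
Qed.

(** Newton-Puiseux by induction on the degree. Once the subleading coefficient is zero, rescaling
    along the least slope makes another lower coefficient a unit, so the reduction at w = 0 has two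
    distinct roots and Hensel lifting splits off a proper factor. *)
Lemma puiseux_monic (F : numClosedFieldType) r (x : {poly {poly F}}) K :
  x \is monic -> size x = r.+1 -> splits_mod x K.
Proof.
elim/ltn_ind: r x K => r IH x K mx sx.
case: r => [|r] in IH sx *.
  have -> : x = 1.
    have /size_poly1P [c _ Ec] : size x == 1%N by rewrite sx.
    by move: mx; rewrite Ec monicE lead_coefC => /eqP ->.
  exists 1%N, [::], 0; split=> //; first by rewrite size_poly1.
  by rewrite /ram rmorph1 big_nil mulr0 addr0.
(* the Tschirnhaus shift making the subleading coefficient vanish *)
pose c : {poly F} := (- (r.+1%:R)^-1) *: x`_r.
apply: (@splits_shift _ _ c).
have mx1 : x \Po ('X + c%:P) \is monic.
  rewrite -[c]opprK polyCN.
  by rewrite monicE lead_coef_comp ?size_XsubC // lead_coefXsubC expr1n mulr1 -monicE.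
have sx1 : size (x \Po ('X + c%:P)) = r.+2 by rewrite size_comp_poly2 // size_XaddC.
have x1r : (x \Po ('X + c%:P))`_r = 0.
  rewrite coef_shift_subleading // /c -scaler_nat scalerA mulrN mulfV ?pnatr_eq0 //.
  by rewrite scaleN1r addNr.
move: (x \Po _) mx1 sx1 x1r => {mx sx c}x mx sx xr.
have [/existsP [j1 hj1]|/existsPn h] := boolP [exists j : 'I_r.+1, x`_j != 0]; last first.
  have -> : x = 'X^(r.+1).
    apply/polyP => j; rewrite coefXn; case: (ltngtP j r.+1) => hj.
    - by have := h (Ordinal hj); rewrite negbK /= => /eqP.
    - by rewrite nth_default // sx.
    - by move: mx; rewrite monicE lead_coefE sx /= hj => /eqP.
  exists 1%N, (nseq r.+1 0), 0; split=> //; first by rewrite size_nseq size_polyXn.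
  by rewrite mulr0 addr0 ramXn ramX big_nseq polyC0 subr0 iter_mulr_1.
pose v (j : 'I_r.+1) := mup 0 x`_j.
have vE j : x`_(nat_of_ord j) != 0 ->
   exists2 h : {poly F}, x`_j = 'X^(v j) * h & h.[0] != 0.
  move=> xj; have [m [h [E h0]]] := order_at0 xj; exists h => //.
  rewrite {1}E; congr ('X^_ * h); rewrite /v E mupMl; last by rewrite /root.
  have -> : 'X = 'X - 0%:P :> {poly F} by rewrite subr0.
  by rewrite mup_XsubCX eqxx.
have [|j0 hj0 hmin] := @arg_min_slope r.+1 (fun j : 'I_r.+1 => x`_j != 0) v.
  by exists j1.
(* The slope is [m / k]; with t^k = w it becomes the integer [m], and minimality makes the divisions
   in [y] exact. *)
pose k := (r.+1 - j0)%N; pose m := v j0.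
have k0 : (0 < k)%N by rewrite subn_gt0.
have xrr : x`_r.+1 = 1 by move: mx; rewrite monicE lead_coefE sx /= => /eqP.
pose y : {poly {poly F}} := \poly_(j < r.+2) ((x`_j \Po 'X^k) %/ 'X^(m * (r.+1 - j))).
have Ey j : (j <= r.+1)%N -> (ram k x)`_j = 'X^(m * (r.+1 - j)) * y`_j.
  move=> hj; rewrite coef_map /= coef_poly ltnS hj mulrC divpK //.
  case: (ltngtP j r.+1) hj => // [hj _|-> _]; last first.
    by rewrite subnn muln0 dvd1p.
  have [->|xj] := eqVneq x`_j 0; first by rewrite comp_poly0 dvdp0.
  have [h -> _] := vE (Ordinal hj) xj; rewrite comp_polyM comp_Xn_poly -exprM.
  rewrite dvdp_mulr // dvdp_exp2l //=.
  by have := hmin (Ordinal hj) xj; rewrite /= mulnC [in X in _ -> (_ <= X)%N]mulnC mulnC.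
have yrr : y`_r.+1 = 1.
  by rewrite coef_poly ltnSn xrr subnn muln0 expr0 divp1 comp_polyC.
have sy : size y = r.+2.
  by apply/eqP; rewrite eqn_leq size_poly /= ltnNge; apply/negP => /leq_sizeP /(_ _ (leqnn _)) /eqP;
     rewrite yrr oner_eq0.
have my : y \is monic by rewrite monicE lead_coefE sy /= yrr.
apply: (splits_scale k0 sx sy my Ey).
have yr : y`_r = 0 by rewrite coef_poly ltnS leqnSn xr comp_poly0 div0p.
have yj0 : (y`_j0).[0] != 0.
  have [h E h0] := vE j0 hj0.
  rewrite coef_poly ltnS ltnW // E comp_polyM comp_Xn_poly -exprM mulnC -/m -/k.
  rewrite mulrC mulpK ?expf_neq0 ?polyX_eq0 //.
  by rewrite horner_comp hornerXn expr0n (gtn_eqF k0).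
pose f := map0 y.
have fr : f`_r = 0 by rewrite coef_map /= yr horner_evalE horner0.
have mf : f \is monic by rewrite monic_map.
have sf : size f = r.+2 by rewrite size_map_poly_id0 // (monicP my) /= horner_evalE hornerC oner_neq0.
have fj0 : f`_j0 != 0 by rewrite coef_map.
have [z hz] : exists z, root f z by apply/closed_rootP; rewrite sf.
have [n [h]] := multiplicity_XsubC f z; rewrite monic_neq0 //= => hh Ef.
have h0 : h != 0 by apply: contraNneq hh => ->; rewrite root0.
have mh : h \is monic by move: mf; rewrite Ef monicMr // monic_exp // monicXsubC.
have sh : (size h + n = r.+2)%N.
  by rewrite -sf Ef size_Mmonic ?monic_exp ?monicXsubC // size_exp_XsubC addnS.
have n0 : (0 < n)%N.
  rewrite lt0n; apply: contraNneq hh => n0; move: hz; rewrite Ef n0 expr0 mulr1 //.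
(* If the reduction were a full power of ['X - z], its zero subleading coefficient would force
   [z = 0] in characteristic 0, against [fj0]. *)
have hr : (n < r.+1)%N.
  have hs : (0 < size h)%N by rewrite size_poly_gt0.
  rewrite ltnNge; apply/negP => hn.
  have sh1 : size h = 1%N by clear -sh hs hn; lia.
  have nr : n = r.+1 by clear -sh hs hn; lia.
  have h1 : h = 1.
    have /size_poly1P [d _ Ed] : size h == 1%N by rewrite sh1.
    by move: mh; rewrite Ed monicE lead_coefC => /eqP ->.
  have z0 : z = 0.
    have := fr; rewrite Ef h1 mul1r nr -polyCN coef_XaddC_exp => /eqP.
    by rewrite -mulr_natr mulf_eq0 pnatr_eq0 orbF oppr_eq0 => /eqP.
  move: fj0; rewrite Ef h1 mul1r nr z0 subr0 coefXn.
  by rewrite ltn_eqF // eqxx.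
have [|||G [H [w [mG sG _ _ Ew]]]] := @hensel F y (('X - z%:P) ^+ n) h (k * K).
- by rewrite mulrC -Ef.
- by rewrite monic_exp // monicXsubC.
- by rewrite coprimep_expl // coprimep_sym coprimep_XsubC.
rewrite size_exp_XsubC in sG.
rewrite exprSr -mulrA in Ew.
have [|H' [w' [mH' sH' Ew']]] := monic_cofactor my mG _ Ew.
  by rewrite sG sy; clear -hr; lia.
apply: (splits_mul my mG mH' sH' Ew').
  by apply: (IH n).
apply: (IH (r.+1 - n)%N) => //; first by clear -n0 hr; lia.
apply/eqP; rewrite -(eqn_add2l n.+1) -sG sH' sy sG.
by rewrite addSn addnS subnKC // ltnW.
Qed.

(** Weierstrass preparation up to precision [K]: Hensel lifting of ['X^r * h] separates a monic
    factor of degree r, carrying the branches through the origin, from a unit. *)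
Lemma puiseux (F : numClosedFieldType) (a : {poly {poly F}}) r h K :
  map0 a = 'X^r * h -> h.[0] != 0 -> (0 < K)%N ->
  exists q (us : seq {poly F}) H z,
    [/\ (0 < q)%N /\ size us = r, (forall U, U \in us -> U.[0] = 0), at0 H != 0 &
     ram q a = (\prod_(U <- us) ('X - U%:P)) * H + \w ^+ (q * K) * z].
Proof.
move=> ea h0 K0.
have [||G [H [w [mG sG eG eH Ew]]]] := hensel K ea; first exact: monicXn.
  by rewrite coprimep_expl // coprimep_sym -[X in coprimep _ X]subr0 -polyC0 coprimep_XsubC.
rewrite size_polyXn in sG.
have [q [us [z [q0 sus E]]]] := puiseux_monic K mG sG.
exists q, us, (ram q H), (z * ram q H + \w ^+ q * ram q w); split.
- by split=> //; rewrite sus sG.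
- move=> U Us.
  have EG : map0 (ram q G) = 'X^r.
    rewrite -eG; apply/polyP => i; rewrite !coef_map /= !horner_evalE.
    by rewrite horner_comp hornerXn expr0n (gtn_eqF q0).
  move: EG; rewrite E rmorphD rmorphM rmorphXn /= map0_w expr0n.
  rewrite muln_eq0 (gtn_eqF q0) (gtn_eqF K0) /= mul0r addr0.
  rewrite rmorph_prod /= => /(congr1 (fun p => p.[U.[0]])).
  rewrite hornerXn horner_prod (big_rem U) //= rmorphB /= map_polyX map_polyC /=.
  rewrite horner_evalE hornerXsubC subrr mul0r => /esym/eqP.
  by rewrite expf_eq0 => /andP [_ /eqP].
- by rewrite ram_at0 //; have [_ _ _ _ hz] := line_w F; rewrite -hz eH.
- by rewrite Ew ramD !ramM ram_wX E mulnS exprD; ring.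
Qed.

(** * The polar curve *)

Definition dw (F : fieldType) (g : {poly {poly F}}) : {poly {poly F}} := map_poly (@deriv F) g.

Lemma coef_dw (F : fieldType) (g : {poly {poly F}}) i : (dw g)`_i = (g`_i)^`().
Proof. by rewrite coef_map_id0 // deriv0. Qed.

Lemma dwD (F : fieldType) (x y : {poly {poly F}}) : dw (x + y) = dw x + dw y.
Proof. by apply/polyP => i; rewrite coefD !coef_dw coefD derivD. Qed.

Lemma dwC (F : fieldType) (c : {poly F}) : dw c%:P = (c^`())%:P.
Proof. by apply/polyP => i; rewrite coef_dw !coefC; case: eqP => // _; rewrite deriv0. Qed.

Lemma dwM (F : fieldType) (x y : {poly {poly F}}) : dw (x * y) = dw x * y + x * dw y.
Proof.
apply/polyP => i; rewrite coefD coef_dw !coefM raddf_sum -big_split /=.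
by apply: eq_bigr => j _; rewrite !coef_dw derivM.
Qed.

Lemma dwX (F : fieldType) : dw ('X : {poly {poly F}}) = 0.
Proof.
apply/polyP => i; rewrite coef_dw coefX coef0.
by case: eqP => _; rewrite ?derivC // -polyC1 derivC.
Qed.

Lemma deriv_on_branch (F : fieldType) (x : {poly {poly F}}) (U : {poly F}) :
  (x.[U])^`() = (x^`()).[U] * U^`() + (dw x).[U].
Proof.
elim/poly_ind: x => [|x c IH].
  by rewrite deriv0 !horner0 deriv0 /dw map_poly0 horner0 mul0r addr0.
rewrite !(derivD, derivM, derivX, derivC, hornerD, hornerM, hornerX, hornerC, dwD, dwM, dwX, dwC).
rewrite IH; ring.
Qed.

(** The logarithmic operator w d/dw, unlike d/dw itself, commutes with ramification up to the factor
    e. *)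
Lemma dw_ram (F : fieldType) e (x : {poly {poly F}}) : (0 < e)%N ->
  \w * dw (ram e x) = ram e (\w * dw x) *+ e.
Proof.
case: e => // e _; apply/polyP => i; rewrite coefMn coefCM coef_dw !coef_map /= coefCM coef_dw.
rewrite deriv_comp derivXn rmorphM /= comp_polyX exprS; move: (_ \Po _) => D.
by rewrite mulrnAr mulrnAr; congr (_ *+ _); ring.
Qed.

Lemma unit_order_le (F : fieldType) (s p h y : {poly F}) m M N :
  s.[0] != 0 -> s * 'X^M = p * ('X^m * h) + 'X^N * y -> (M < N)%N -> (m <= M)%N.
Proof.
move=> s0 E MN; rewrite leqNgt; apply/negP => Mm.
have := congr1 (fun q : {poly F} => q`_M) E.
rewrite mulrC coefXnM ltnn subnn coefD coefXnM MN addr0.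
rewrite mulrCA coefXnM Mm => h'; case/eqP: s0.
by rewrite horner_coef0.
Qed.

(** Logarithmic differentiation multiplies the leading coefficient by m, so those of [b] and [c + b]
    are m/e and (e + m)/e times that of [c]: both nonzero in characteristic 0. *)
Lemma branch_order (F : numClosedFieldType) (c b y h : {poly F}) m e N :
  c = 'X^m * h -> h.[0] != 0 -> (0 < m)%N -> (0 < e)%N -> (m < N)%N ->
  'X * c^`() = b *+ e + 'X^N * y ->
  (exists k, b = 'X^m * k /\ k.[0] != 0) /\ (exists k, c + b = 'X^m * k /\ k.[0] != 0).
Proof.
move=> Ec h0 m0 e0 mN E.
have eN0 : e%:R != 0 :> F by rewrite pnatr_eq0 -lt0n.
pose k := (e%:R^-1)%:P * (h *+ m + 'X * h^`() - 'X^(N - m) * y).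
have Eb : b = 'X^m * k.
  have Ebe : b *+ e = 'X^m * (h *+ m + 'X * h^`() - 'X^(N - m) * y).
    have -> : b *+ e = 'X * c^`() - 'X^N * y by rewrite E addrK.
    rewrite Ec derivM derivXn -[in 'X^N](subnKC (ltnW mN)) exprD.
    by case: m m0 {mN Ec k} => // m _; rewrite /= exprS mulrnAl; ring.
  rewrite /k mulrCA -Ebe -[b *+ e]mulr_natl mulrA -polyC_natr -polyCM mulVf //.
  by rewrite polyC1 mul1r.
have Nm : (0 < N - m)%N by rewrite subn_gt0.
have k0 : k.[0] = m%:R / e%:R * h.[0].
  rewrite /k !(hornerM, hornerD, hornerN, hornerC, hornerX, hornerMn, hornerXn) expr0n (gtn_eqF Nm).
  by rewrite -mulr_natl /=; ring.
split; [exists k | exists (h + k)]; split=> //.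
- by rewrite k0 !mulf_neq0 // ?invr_eq0 // pnatr_eq0 -lt0n.
- by rewrite Ec Eb mulrDr.
- have -> : (h + k).[0] = (e + m)%:R / e%:R * h.[0].
    by rewrite hornerD k0 natrD; field.
  by rewrite !mulf_neq0 ?invr_eq0 // pnatr_eq0 -lt0n addn_gt0 e0.
Qed.

Lemma loc2C (F : fieldType) (a b x : {poly {poly F}}) : loc2 a b x -> loc2 b a x.
Proof. by move=> [s [p [q [s0 E]]]]; exists s, q, p; rewrite addrC. Qed.

Lemma map0_prod_branches (F : fieldType) (us : seq {poly F}) :
  (forall U, U \in us -> U.[0] = 0) ->
  map0 (\prod_(U <- us) ('X - U%:P)) = 'X^(size us).
Proof.
move=> h; rewrite rmorph_prod big_seq (eq_bigr (fun=> 'X)).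
  by rewrite -big_seq big_const_seq count_predT iter_mulr_1.
by move=> U /h h0; rewrite rmorphB /= map_polyX map_polyC /= horner_evalE h0 polyC0 subr0.
Qed.

Lemma wX_loc2_branches (F : fieldType) (us : seq {poly F}) (b : {poly {poly F}}) (m : {poly F} -> nat) :
  (forall U, U \in us -> U.[0] = 0) ->
  (forall U, U \in us -> exists h, b.[U] = 'X^(m U) * h /\ h.[0] != 0) ->
  loc2 (\prod_(U <- us) ('X - U%:P)) b (\w ^+ (\sum_(U <- us) m U)).
Proof.
elim: us => [|U us IH] U0 Ub.
  by rewrite !big_nil expr0; apply: loc2l.
have {IH} [||s [p [q [s0 E]]]] := IH; try by move=> V hV; auto; apply: U0; rewrite inE hV orbT.
  by move=> V hV; apply: Ub; rewrite inE hV orbT.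
have [h [Eb h0]] := Ub U (mem_head _ _).
have [y Ey] : exists y, h%:P * \w ^+ (m U) - b = ('X - U%:P) * y.
  have [_ _ [_ hk] _ _] := line_branch (U0 U (mem_head _ _)).
  by apply/hk; rewrite -polyC_exp !hornerE Eb; ring.
rewrite !big_cons; set A := \prod_(_ <- _) _ in E *.
exists (h%:P * s), (y * p), (('X - U%:P) * y * q + p * A + q * b).
rewrite at0M mulf_neq0 //; last by rewrite /at0 hornerC.
split=> //; rewrite exprD.
have -> : h%:P * s * (\w ^+ m U * \w ^+ (\sum_(j <- us) m j))
  = (h%:P * \w ^+ m U) * (s * \w ^+ (\sum_(j <- us) m j)) by ring.
have -> : h%:P * \w ^+ m U = ('X - U%:P) * y + b by rewrite -Ey subrK.
by rewrite E; ring.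
Qed.

Lemma codim_branches (F : fieldType) (us : seq {poly F}) (b : {poly {poly F}}) (m : {poly F} -> nat) :
  (forall U, U \in us -> U.[0] = 0) ->
  (forall U, U \in us -> exists h, b.[U] = 'X^(m U) * h /\ h.[0] != 0) ->
  codim (loc2 (\prod_(U <- us) ('X - U%:P)) b) (\sum_(U <- us) m U).
Proof.
elim: us => [|U us IH] U0 Ub.
  by rewrite !big_nil; apply: codim_unit; [apply: loc2_ideal | apply: loc2l].
have h1 V : V \in us -> V.[0] = 0 by move=> hV; apply: U0; rewrite inE hV orbT.
have h2 V : V \in us -> exists h, b.[V] = 'X^(m V) * h /\ h.[0] != 0.
  by move=> hV; apply: Ub; rewrite inE hV orbT.
have [h [Eb h0]] := Ub U (mem_head _ _).
rewrite !big_cons; apply: (codim_loc2_mul (line_branch (U0 U (mem_head _ _))) Eb h0 _ (IH h1 h2)).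
have := wX_loc2_branches U0 Ub; rewrite big_cons => hw.
apply: (primary_of_order (loc2_ideal _ _) (@loc2_sat _ _ _) (loc2l _ _) (h := 1) _ _ hw).
  by have := map0_prod_branches U0; rewrite big_cons mulr1 => ->.
by rewrite hornerC oner_neq0.
Qed.

Lemma loc2_sub (F : fieldType) (a b c d : {poly {poly F}}) :
  loc2 c d a -> loc2 c d b -> forall x, loc2 a b x -> loc2 c d x.
Proof. by move=> ha hb; apply: loc2P => //; [apply: loc2_ideal | apply: loc2_sat]. Qed.

(** The intersection number of [a] and [b] is read off from approximate branches of [a]: when the
    precision exceeds the total order, the truncation error lies in both ideals and may be ignored.
    The base change multiplies the number by q. *)
Lemma codim_by_orders (F : fieldType) (a b H z : {poly {poly F}}) r h q us K (m : {poly F} -> nat) :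
  map0 a = 'X^r * h -> h.[0] != 0 -> (0 < q)%N ->
  (forall U, U \in us -> U.[0] = 0) -> at0 H != 0 ->
  ram q a = (\prod_(U <- us) ('X - U%:P)) * H + \w ^+ (q * K) * z ->
  (forall U, U \in us -> exists h, (ram q b).[U] = 'X^(m U) * h /\ h.[0] != 0) ->
  (\sum_(U <- us) m U < q * K)%N ->
  (exists N, loc2 a b (\w ^+ N)) /\ exists2 n, codim (loc2 a b) n & (q * n = \sum_(U <- us) m U)%N.
Proof.
move=> ea h0 q0 U0 H0 Ea Ub.
have := wX_loc2_branches U0 Ub; have := codim_branches U0 Ub.
move: Ea; set A := \prod_(U <- us) _; set M := (\sum_(U <- us) m U)%N; set b' := ram q b.
move=> Ea cA wA MK.
have wa : loc2 (ram q a) b' (\w ^+ M).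
  have [s [x [y [s0 E]]]] := wA.
  (* The truncation error is absorbed into the denominator, which remains a unit because [q * K - M]
     is positive. *)
  exists (H * s + \w ^+ (q * K - M) * x * z), x, (y * H); split.
    rewrite at0D !at0M at0X at0_w expr0n subn_eq0 leqNgt MK /= !mul0r addr0.
    exact: mulf_neq0.
  have Ea' : A * H = ram q a - \w ^+ (q * K - M) * \w ^+ M * z.
    by rewrite -exprD subnK 1?ltnW // Ea addrK.
  rewrite mulrDl -mulrA E mulrDr [H * (x * A)]mulrCA [H * A]mulrC Ea'; ring.
have hD := loc2_ideal (ram q a) b'; have hA := loc2_ideal A b'.
have wqK (J : {poly {poly F}} -> Prop) y : isideal J -> J (\w ^+ M) -> J (\w ^+ (q * K) * y).
  by move=> hJ hM; rewrite -(subnK (ltnW MK)) exprD mulrAC; case: hJ => _ _; apply.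
have eqv x : loc2 (ram q a) b' x <-> loc2 A b' x.
  split; apply: loc2_sub; try exact: loc2r.
    rewrite Ea; case: (hA) => _ hAD _; apply: hAD; last exact: wqK.
    by apply: idealMr => //; apply: loc2l.
  apply: (loc2_sat H0); rewrite mulrC.
  have -> : A * H = ram q a - \w ^+ (q * K) * z by rewrite Ea addrK.
  by apply: idealB => //; [apply: loc2l | apply: wqK].
have wM : loc2 a b (\w ^+ M).
  apply: (ram_loc2_inv q0); rewrite ram_wX; case: (hD) => _ _ hM.
  have -> : (q * M = q.-1 * M + M)%N by rewrite -mulSnr prednK.
  by rewrite exprD; apply: hM.
split; first by exists M.
have pab := primary_of_order (loc2_ideal a b) (@loc2_sat _ a b) (loc2l a b) ea h0 wM.
have [n hn] := codim_exists (loc2_ideal a b) (@loc2_sat _ a b) (loc2l a b) ea h0 wM.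
exists n => //; apply: (codim_unique hD (codim_ram q0 pab hn)).
by apply: codim_eq cA => x; apply: iff_sym; apply: eqv.
Qed.

Lemma map0_deriv_order (F : numClosedFieldType) (g : {poly {poly F}}) r h :
  map0 g = 'X^(r.+1) * h -> h.[0] != 0 -> exists h2, map0 g^`() = 'X^r * h2 /\ h2.[0] != 0.
Proof.
move=> eg h0; exists (h *+ r.+1 + 'X * h^`()).
rewrite -deriv_map eg derivM derivXn /= exprS; split; first by ring.
by rewrite !(hornerD, hornerM, hornerX, hornerMn) mul0r addr0 -mulr_natl mulf_neq0 // pnatr_eq0.
Qed.

(** On a branch of the polar curve the chain rule loses its u-term up to the truncation error, so
    [branch_order] gives [\w * dw g] and [g + \w * dw g] the order of [g]; equal orders on all
    branches give equal intersection numbers. *)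
Lemma polar_codim (F : numClosedFieldType) (g : {poly {poly F}}) i h M0 :
  map0 g = 'X^i * h -> h.[0] != 0 -> (0 < i)%N -> loc2 g g^`() (\w ^+ M0) ->
  exists n N, [/\ codim (loc2 g^`() (\w * dw g)) n, codim (loc2 g^`() (g + \w * dw g)) n,
     loc2 g^`() (\w * dw g) (\w ^+ N) & loc2 g^`() (g + \w * dw g) (\w ^+ N)].
Proof.
case: i => // r eg h0 _ hM0.
have [h2 [ea h20]] := map0_deriv_order eg h0.
have [q [us [H [z [[q0 sus] U0 H0 Ea]]]]] := puiseux ea h20 (ltn0Sn (r * M0 + M0)).
(* The polar curve has r branches, and [hM0] bounds the order of [g] on each by [q * M0]. So [q * K]
   exceeds both each order and their sum. *)
set K := (r * M0 + M0).+1 in Ea.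
have aE U : U \in us -> (ram q g^`()).[U] = 'X^(q * K) * z.[U].
  move=> Us; have PU : (\prod_(V <- us) ('X - V%:P)).[U] = 0.
    by rewrite (big_rem U) //= hornerM hornerXsubC subrr mul0r.
  by rewrite Ea hornerD !hornerM PU mul0r add0r -polyC_exp hornerC.
have ord U : U \in us -> exists m h, [/\ (ram q g).[U] = 'X^m * h, h.[0] != 0, (0 < m)%N & (m <= q * M0)%N].
  move=> Us; have aU := aE U Us.
  have [s [p [p' [s0 E]]]] := hM0.
  have EU : (ram q s).[U] * 'X^(q * M0) = (ram q p).[U] * (ram q g).[U] + 'X^(q * K) * ((ram q p').[U] * z.[U]).
    have /(congr1 (fun y => (ram q y).[U])) := E.
    by rewrite ramD !ramM ram_wX hornerD !hornerM -polyC_exp hornerC aU => ->; rewrite mulrCA.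
  have [_ _ _ _ hz] := line_branch (U0 U Us).
  have sU : ((ram q s).[U]).[0] != 0 by rewrite hz ram_at0.
  have lt : (q * M0 < q * K)%N by rewrite ltn_pmul2l // /K ltnS leq_addl.
  have c0 : (ram q g).[U] != 0.
    apply/eqP => c0; rewrite c0 mulr0 add0r in EU.
    have := @unit_order_le _ _ 0 0 ((ram q p').[U] * z.[U]) (q * M0).+1 (q * M0) (q * K) sU.
    by rewrite mulr0 mul0r add0r ltnn => /(_ EU lt).
  have [m [k [Ec k0]]] := order_at0 c0; exists m, k; split=> //.
    rewrite lt0n; apply: contraNneq k0 => m0.
    have := hz (ram q g); rewrite Ec m0 expr0 mul1r => ->.
    rewrite ram_at0 //; have [_ _ _ _ hz'] := line_w F; rewrite -hz' eg.
    by rewrite hornerM hornerXn expr0n mul0r.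
  by rewrite Ec in EU; apply: unit_order_le EU lt.
pose m U := mup 0 (ram q g).[U].
have ordm U : U \in us -> exists h, [/\ (ram q g).[U] = 'X^(m U) * h, h.[0] != 0, (0 < m U)%N & (m U <= q * M0)%N].
  move=> /ord [m' [k [Ec k0 hm1 hm2]]]; exists k.
  have -> // : m U = m'.
  rewrite /m Ec mupMl; last by rewrite /root.
  have -> : 'X = 'X - 0%:P :> {poly F} by rewrite subr0.
  by rewrite mup_XsubCX eqxx.
have mK : (\sum_(U <- us) m U < q * K)%N.
  apply: (@leq_ltn_trans (\sum_(U <- us) q * M0)%N).
    by rewrite big_seq [X in (_ <= X)%N]big_seq; apply: leq_sum => U /ordm [k []].
  rewrite big_const_seq count_predT iter_addn_0 sus /K.
  by rewrite -mulnA ltn_pmul2l // ltnS [(M0 * r)%N]mulnC leq_addr.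
have bord U : U \in us ->
    (exists k, (ram q (\w * dw g)).[U] = 'X^(m U) * k /\ k.[0] != 0) /\
    (exists k, (ram q (g + \w * dw g)).[U] = 'X^(m U) * k /\ k.[0] != 0).
  move=> Us; have [k [Ec k0 m0 mM]] := ordm U Us.
  have aU := aE U Us.
  rewrite ramD hornerD; apply: (branch_order (N := q * K) (y := 'X * z.[U] * U^`()) Ec k0 m0 q0).
    by apply: leq_ltn_trans mM _; rewrite ltn_pmul2l // /K ltnS leq_addl.
  rewrite deriv_on_branch -/(ram q g) deriv_map -/(ram q _) aU mulrDr.
  have -> : 'X * (dw (ram q g)).[U] = (\w * dw (ram q g)).[U] by rewrite hornerM hornerC.
  by rewrite dw_ram // hornerMn; ring.
have [[N1 w1] [n1 c1 e1]] := codim_by_orders ea h20 q0 U0 H0 Ea (fun U Us => (bord U Us).1) mK.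
have [[N2 w2] [n2 c2 e2]] := codim_by_orders ea h20 q0 U0 H0 Ea (fun U Us => (bord U Us).2) mK.
have n12 : n1 = n2 by apply/eqP; rewrite -(eqn_pmul2l q0) e1 e2.
exists n1, (N1 + N2)%N; split=> //; first by rewrite n12.
  by rewrite exprD; apply: idealMr => //; apply: loc2_ideal.
by rewrite exprD; case: (loc2_ideal g^`() (g + \w * dw g)) => _ _; apply.
Qed.

(** * Milnor and Tjurina numbers of the union with a line *)

Lemma loc2_w_deriv (F : fieldType) (g : {poly {poly F}}) :
  (\w * g)^`() = \w * g^`() /\ dw (\w * g) = g + \w * dw g.
Proof.
split; first by rewrite derivM derivC mul0r add0r.
by rewrite dwM dwC derivX polyC1 mul1r.
Qed.

Lemma map0_add_w (F : fieldType) (g y : {poly {poly F}}) : map0 (g + \w * y) = map0 g.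
Proof. by rewrite rmorphD rmorphM /= map0_w mul0r addr0. Qed.

Lemma local_milnor (F : numClosedFieldType) (g : {poly {poly F}}) i h M0 :
  map0 g = 'X^i * h -> h.[0] != 0 -> (0 < i)%N -> loc2 g g^`() (\w ^+ M0) ->
  exists mu N, [/\ codim (loc2 g^`() (dw g)) mu,
    codim (loc2 (\w * g)^`() (dw (\w * g))) (mu + i.*2.-1),
    loc2 g^`() (dw g) (\w ^+ N) & loc2 (\w * g)^`() (dw (\w * g)) (\w ^+ N)].
Proof.
move=> eg h0 i0 hM0; have [n [N [c1 c2 w1 w2]]] := polar_codim eg h0 i0 hM0.
have [-> ->] := loc2_w_deriv g.
have [r Ei] : exists r, i = r.+1 by exists i.-1; rewrite prednK.
have [h2 [ea h20]] : exists h2, map0 g^`() = 'X^r * h2 /\ h2.[0] != 0.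
  by apply: map0_deriv_order h0; rewrite eg Ei.
have w1' : loc2 g^`() (dw g) (\w ^+ N).
  apply: loc2_sub w1; first exact: loc2l.
  by case: (loc2_ideal g^`() (dw g)) => _ _; apply; apply: loc2r.
have [mu hmu] := codim_exists (loc2_ideal _ _) (@loc2_sat _ _ _) (loc2l _ _) ea h20 w1'.
have nE : n = (r + mu)%N.
  apply: (codim_unique (loc2_ideal (\w * dw g) g^`())).
    by apply: codim_eq c1 => x; split; apply: loc2C.
  apply: (codim_loc2_w ea h20).
    exact: (primary_of_order (loc2_ideal _ _) (@loc2_sat _ _ _) (loc2r _ _) ea h20 (loc2C w1)).
  by apply: codim_eq hmu => x; split; apply: loc2C.
have w2' : loc2 (\w * g^`()) (g + \w * dw g) (\w ^+ N.+1).
  have [s [p [q [s0 E]]]] := w2; exists s, p, (\w * q); split=> //.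
  by rewrite exprS mulrCA E; ring.
have eb : map0 (g + \w * dw g) = 'X^i * h by rewrite map0_add_w.
exists mu, N.+1; split=> //.
- have -> : (mu + i.*2.-1 = i + n)%N by rewrite nE Ei; clear; lia.
  apply: (codim_loc2_w eb h0) => //.
  exact: (primary_of_order (loc2_ideal _ _) (@loc2_sat _ _ _) (loc2r _ _) eb h0 w2').
- by rewrite exprS; case: (loc2_ideal g^`() (dw g)) => _ _; apply.
Qed.

Lemma ideal_addP (F : fieldType) (J : {poly {poly F}} -> Prop) P :
  isideal J -> primary J ->
  isideal (fun x => exists y z, J y /\ x = y + P * z) /\
  saturated (fun x => exists y z, J y /\ x = y + P * z).
Proof.
move=> hJ pJ; have [h0 hD hM] := hJ.
have hI : isideal (fun x => exists y z, J y /\ x = y + P * z).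
  split.
  - by exists 0, 0; rewrite mulr0 addr0.
  - move=> _ _ [y [z [hy ->]]] [y' [z' [hy' ->]]]; exists (y + y'), (z + z').
    by split; [apply: hD | ring].
  - move=> a _ [y [z [hy ->]]]; exists (a * y), (a * z).
    by split; [apply: hM | ring].
split=> // s x s0; apply: (primary_sat hI) => //.
by apply: primary_sub pJ => y hy; exists y, 0; rewrite mulr0 addr0.
Qed.

Lemma spanned_order (F : fieldType) (J : {poly {poly F}} -> Prop) b r k :
  isideal J -> saturated J -> J \w -> J b -> map0 b = 'X^r * k -> k.[0] != 0 -> spanned_by J r.
Proof.
move=> hJ hs hw hb eb k0; rewrite -[r]muln1.
apply: spanned_sub (codim_spanned (spanned_loc2_wX 1 eb k0)).
by apply: loc2P => //; rewrite expr1.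
Qed.

(** The summands i, tau and o bound three successive quotients: that by [J' + (w)], that by
    [J2 + (dw g) = J], and that by the colon ideal of [J2] by [dw g]. The last contains w, and also
    [x], by the relation [Exy], whose order on w = 0 is o. *)
Lemma local_tjurina (F : numClosedFieldType) (g x y z : {poly {poly F}}) i h M0 o k :
  map0 g = 'X^i * h -> h.[0] != 0 -> (0 < i)%N -> loc2 g g^`() (\w ^+ M0) ->
  y * g^`() + x * dw g = z * g -> map0 x = 'X^o * k -> k.[0] != 0 ->
  exists tau tau' N, [/\ codim (loc3 g g^`() (dw g)) tau,
    codim (loc3 (\w * g) (\w * g)^`() (dw (\w * g))) tau', (tau' <= tau + i + o)%N,
    loc3 g g^`() (dw g) (\w ^+ N) & loc3 (\w * g) (\w * g)^`() (dw (\w * g)) (\w ^+ N)].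
Proof.
move=> eg h0 i0 hM0 Exy ex k0.
have [mu [N [_ _ _ w2]]] := local_milnor eg h0 i0 hM0.
have [Eu Ew] := loc2_w_deriv g; rewrite Eu Ew in w2 *.
have eb : map0 (g + \w * dw g) = 'X^i * h by rewrite map0_add_w.
set J' := loc3 (\w * g) _ _; set J := loc3 g g^`() (dw g).
have hJ' : isideal J' := loc3_ideal _ _ _; have hJ : isideal J := loc3_ideal _ _ _.
have wJ' : J' (\w ^+ N).
  by apply: loc2P w2; [exact: hJ'|exact: loc3_sat|exact: loc32|exact: loc33].
have wJ : J (\w ^+ M0).
  by apply: loc2P hM0; [exact: hJ|exact: loc3_sat|exact: loc31|exact: loc32].
have pJ' := primary_of_order hJ' (@loc3_sat _ _ _ _) (loc33 _ _ _) eb h0 wJ'.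
have [tau htau] := codim_exists hJ (@loc3_sat _ _ _ _) (loc31 _ _ _) eg h0 wJ.
have [tau' htau'] := codim_exists hJ' (@loc3_sat _ _ _ _) (loc33 _ _ _) eb h0 wJ'.
exists tau, tau', (N + M0)%N; split=> //; last first.
- by rewrite exprD; apply: idealMr.
- by rewrite exprD; case: hJ => _ _; apply.
apply: (codim_le_spanned hJ' htau').
have -> : (tau + i + o = i + (tau + o))%N by clear; lia.
pose J2 := loc3 g g^`() (\w * dw g).
have hJ2 : isideal J2 := loc3_ideal _ _ _.
have wJ2 : J2 (\w ^+ M0).
  by apply: loc2P hM0; [exact: hJ2|exact: loc3_sat|exact: loc31|exact: loc32].
have pJ2 := primary_of_order hJ2 (@loc3_sat _ _ _ _) (loc31 _ _ _) eg h0 wJ2.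
(* Multiplication by w sends [J2] into [J'], since [\w * (\w * dw g)] equals [\w * (g + \w * dw g)]
   minus [\w * g]. *)
apply: (spanned_exact (P := \w) hJ' (J1 := fun x => exists y z, J' y /\ x = y + \w * z) (J2 := J2)) => //.
- move=> v [s [p [q [r [s0 E]]]]]; exists s, (p - r), q, (\w * r); split=> //.
  by rewrite mulrCA E; ring.
- have [hI hs] := ideal_addP \w hJ' pJ'.
  apply: (spanned_order hI hs _ _ eb h0).
    by exists 0, 1; split; [case: hJ' | rewrite mulr1 add0r].
  by exists (g + \w * dw g), 0; split; [exact: loc33 | rewrite mulr0 addr0].
apply: (spanned_exact (P := dw g) hJ2 (J1 := J) (J2 := fun v => J2 (dw g * v))) => //.
- have [hI hs] := ideal_addP (dw g) hJ2 pJ2.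
  have emb v : J2 v -> exists y z, J2 y /\ v = y + dw g * z.
    by move=> hv; exists v, 0; rewrite mulr0 addr0.
  apply: loc3P => //; [apply: emb; exact: loc31 | apply: emb; exact: loc32 |].
  by exists 0, 1; split; [case: hJ2 | rewrite mulr1 add0r].
- exact: codim_spanned.
- have [h20 h2D h2M] := hJ2.
  apply: (@spanned_order _ _ x o k) => //.
  + split; first by rewrite mulr0.
      by move=> a b ha hb; rewrite mulrDr; apply: h2D.
    by move=> a b hb; rewrite mulrCA; apply: h2M.
  + by move=> s v s0; rewrite mulrCA; apply: loc3_sat.
  + by rewrite mulrC; apply: loc33.
  + have -> : dw g * x = z * g - y * g^`() by rewrite -Exy; ring.
    by apply: idealB => //; apply: h2M; [apply: loc31|apply: loc32].
Qed.

(** * Polynomials in three variables *)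

Notation poly3 F := {mpoly F[3]}.

Lemma mpoly3_ind (F : numClosedFieldType) (P : poly3 F -> Prop) :
  (forall c, P c%:MP) -> (forall i, P 'X_i) -> (forall p q, P p -> P q -> P (p + q)) ->
  (forall p q, P p -> P q -> P (p * q)) -> forall p, P p.
Proof.
move=> hC hX hD hM p; elim/mpolyind: p => [|c m p _ _ IH]; first by rewrite -mpolyC0.
apply: hD IH; rewrite -mul_mpolyC; apply: (hM) => //.
rewrite mpolyXE_id; apply: (big_ind P) => //; first exact: (hC 1).
move=> i _; elim: (m i) => [|k IH]; first exact: (hC 1).
by rewrite exprS; apply: hM.
Qed.

(** Kronecker substitution: with [D] above all exponents, sending the variables to x, x^D, x^(D^2)
    separates monomials by base-D digits and reduces to one variable over an infinite field. *)
Lemma mpoly3_eq0 (F : numClosedFieldType) (p : poly3 F) : (forall v : 'I_3 -> F, p.@[v] = 0) -> p = 0.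
Proof.
move=> h; pose D := (msize p).+1.
pose code (m : 'X_{1..3}) := (m ord0 + D * (m (lift ord0 ord0) + D * m (lift ord0 (lift ord0 ord0))))%N.
pose q : {poly F} := \sum_(m <- msupp p) p@_m *: 'X^(code m).
have q0 : q = 0.
  apply/eqP/negPn/negP => nz.
  have : forall n, (n < size q)%N.
    move=> n; have := @max_poly_roots _ q [seq (i%:R : F) | i <- iota 0 n] nz.
    rewrite size_map size_iota; apply.
      apply/allP => x _; apply/eqP; rewrite horner_sum.
      pose v : 'I_3 -> F := fun i => x ^+ (D ^ i).
      rewrite -[RHS](h v) mevalE; apply: eq_bigr => m _.
      rewrite hornerZ hornerXn; congr (_ * _); rewrite !big_ord_recl big_ord0 mulr1 /v -!exprM -!exprD.
      by congr (_ ^+ _); rewrite /code /bump /= !expnS expn0; clear; nia.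
    rewrite map_inj_uniq ?iota_uniq // => i j /eqP; rewrite eqr_nat => /eqP //.
  by move=> /(_ (size q)); rewrite ltnn.
have lt m : m \in msupp p -> forall i, (m i < D)%N.
  move=> hm i; have := msize_mdeg_lt hm; rewrite /D ltnS => hd; apply: leq_trans (ltnW hd).
  by rewrite mdegE (bigD1 i) //= leq_addr.
have inj m m' : m \in msupp p -> m' \in msupp p -> code m = code m' -> m = m'.
  move=> hm hm'; rewrite /code => E.
  have dig a b c d : (a < D -> b < D -> a + D * c = b + D * d -> a = b /\ c = d)%N.
    move=> ha hb E'; have ab : a = b.
      have := congr1 (fun t => t %% D)%N E'.
      by rewrite (addnC a) (addnC b) ![(D * _)%N]mulnC !modnMDl !modn_small.
    by split=> //; move: E'; rewrite ab => /addnI /eqP; rewrite eqn_pmul2l // => /eqP.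
  have [e0 /dig e'] := dig _ _ _ _ (lt _ hm ord0) (lt _ hm' ord0) E.
  have [e1 e2] := e' (lt _ hm _) (lt _ hm' _).
  apply/mnmP => i; case: (unliftP ord0 i) => [j ->|-> //].
  case: (unliftP ord0 j) => [k ->|-> //].
  by case: (unliftP ord0 k) => [[]|-> //].
apply/mpolyP => m; rewrite mcoeff0; apply/eqP/negPn/negP => nz.
have hm : m \in msupp p by rewrite mcoeff_msupp.
have := congr1 (fun q : {poly F} => q`_(code m)) q0; rewrite coef0 /q coef_sum (bigD1_seq m) //=.
rewrite coefZ coefXn eqxx mulr1 big_seq_cond big1 ?addr0 => [/eqP|m' /andP [hm' nm]].
  by rewrite (negPf nz).
rewrite coefZ coefXn; case: eqP => [/(inj _ _ hm hm') E|_]; last by rewrite mulr0.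
by rewrite E eqxx in nm.
Qed.

Lemma mderivXU (F : numClosedFieldType) (i k : 'I_3) : mderiv k ('X_i : poly3 F) = (i == k)%:R.
Proof.
rewrite mderivX mnm1E; have [->|_] := eqVneq i k; last by rewrite scale0r.
rewrite scale1r (_ : (U_(k) - U_(k) = 0)%MM) ?mpolyX0 //.
by apply/mnmP => j; rewrite mnmBE subnn mnm0E.
Qed.

Lemma mmap_derivation (F : numClosedFieldType) (A : comNzRingType) (f : {rmorphism F -> A}) (h : 'I_3 -> A) (d : A -> A) (p : poly3 F) :
  (forall x y, d (x + y) = d x + d y) -> (forall x y, d (x * y) = d x * y + x * d y) ->
  (forall c, d (f c) = 0) ->
  d (mmap f h p) = \sum_(k < 3) mmap f h (mderiv k p) * d (h k).
Proof.
move=> dD dM dC; elim/mpoly3_ind: p.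
- by move=> c; rewrite mmapC dC big1 // => k _; rewrite mderivC mmap0 mul0r.
- move=> i; rewrite mmapX mmap1U (bigD1 i) //= big1 ?addr0 => [|k ki].
    by rewrite mderivXU eqxx rmorph1 mul1r.
  by rewrite mderivXU eq_sym (negPf ki) mmap0 mul0r.
- move=> p q IHp IHq; rewrite mmapD dD IHp IHq -big_split; apply: eq_bigr => k _.
  by rewrite mderivD mmapD mulrDl.
- move=> p q IHp IHq; rewrite rmorphM dM IHp IHq mulr_suml mulr_sumr -big_split.
  by apply: eq_bigr => k _; rewrite mderivM rmorphD !rmorphM /=; ring.
Qed.

Definition lcoef (F : numClosedFieldType) (l : poly3 F) (i : 'I_3) : F := l@_U_(i).

Lemma linformE (F : numClosedFieldType) (l : poly3 F) : l \is 1.-homog -> l = \sum_i (lcoef l i)%:MP * 'X_i.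
Proof.
move=> hl; apply/mpolyP => m; rewrite raddf_sum /=.
have [hm|hm] := eqVneq (mdeg m) 1%N; last first.
  rewrite (dhomog_nemf_coeff hl hm) big1 // => i _.
  rewrite mcoeffCM mcoeffX; case: eqP => [E|_]; last by rewrite mulr0.
  by rewrite -E mdeg1 eqxx in hm.
have /mdeg1P [j /eqP ->] : mdeg m == 1%N by apply/eqP.
rewrite (bigD1 j) //= mcoeffCM mcoeffX eqxx mulr1 big1 ?addr0 // => i ij.
rewrite mcoeffCM mcoeffX; case: eqP => [/mnmP /(_ i)|_]; last by rewrite mulr0.
by rewrite !mnm1E eqxx eq_sym (negPf ij).
Qed.

Lemma linform_eval (F : numClosedFieldType) (l : poly3 F) (v : 'I_3 -> F) : l \is 1.-homog -> l.@[v] = \sum_i lcoef l i * v i.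
Proof.
move=> hl; rewrite {1}(linformE hl) raddf_sum /=; apply: eq_bigr => i _.
by rewrite mevalM mevalC mevalXU.
Qed.

Lemma linform_deriv (F : numClosedFieldType) (l : poly3 F) i : l \is 1.-homog -> mderiv i l = (lcoef l i)%:MP.
Proof.
move=> hl; rewrite {1}(linformE hl) raddf_sum /= (bigD1 i) //= big1 ?addr0 => [|j ji].
  by rewrite mderiv_mulC mderivXU eqxx mulr1.
by rewrite mderiv_mulC mderivXU (negPf ji) mulr0.
Qed.

Lemma linform_neq0 (F : numClosedFieldType) (l : poly3 F) : l \is 1.-homog -> l != 0 -> exists i, lcoef l i != 0.
Proof.
move=> hl l0; apply/existsP; apply: contraNT l0 => /existsPn h.
rewrite (linformE hl) big1 // => i _; have := h i; rewrite negbK => /eqP ->.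
by rewrite mpolyC0 mul0r.
Qed.

Lemma homog_eval (F : numClosedFieldType) (p : poly3 F) k (c : F) (v : 'I_3 -> F) :
  p \is k.-homog -> p.@[fun i => c * v i] = c ^+ k * p.@[v].
Proof.
move=> /dhomogP hp; rewrite !mevalE mulr_sumr !big_seq; apply: eq_bigr => m hm.
have <- : mdeg m = k by apply: hp.
rewrite mulrCA; congr (_ * _); rewrite mdegE -prodrXr -big_split.
by apply: eq_bigr => i _; rewrite /= exprMn.
Qed.

Lemma euler_homog (F : numClosedFieldType) (p : poly3 F) k : p \is k.-homog -> \sum_i 'X_i * mderiv i p = k%:R * p.
Proof.
move=> /dhomogP hp; rewrite {2}[p]mpolyE mulr_sumr.
rewrite [in LHS](mpolyE p); under eq_bigr => i _ do rewrite raddf_sum mulr_sumr /=.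
rewrite exchange_big /= !big_seq; apply: eq_bigr => m hm.
have <- : mdeg m = k by apply: hp.
rewrite mdegE natr_sum mulr_suml; apply: eq_bigr => i _; rewrite mderivZ mderivX.
have [->|mi] := eqVneq (m i) 0%N; first by rewrite scale0r scaler0 mulr0 mul0r.
rewrite -!scalerAr -mpolyXD addmC submK ?lep1mP // scalerA mulrC -scalerA.
by rewrite scaler_nat mulr_natl scalerMnr.
Qed.

Definition ldvd (F : numClosedFieldType) (l p : poly3 F) : Prop := exists h, p = l * h.

Lemma ldvdD (F : numClosedFieldType) (l p q : poly3 F) : ldvd l p -> ldvd l q -> ldvd l (p + q).
Proof. by move=> [a ->] [b ->]; exists (a + b); rewrite mulrDr. Qed.

Lemma ldvdM (F : numClosedFieldType) (l p q : poly3 F) : ldvd l q -> ldvd l (p * q).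
Proof. by move=> [b ->]; exists (p * b); rewrite mulrCA. Qed.

Lemma ldvd_sum (F : numClosedFieldType) (l : poly3 F) (I : finType) (f : I -> poly3 F) :
  (forall i, ldvd l (f i)) -> ldvd l (\sum_i f i).
Proof.
move=> h; apply: (big_ind (ldvd l)) => //; first by exists 0; rewrite mulr0.
exact: ldvdD.
Qed.

Lemma meval_mmap (F : numClosedFieldType) (r : 'I_3 -> poly3 F) (p : poly3 F) (v : 'I_3 -> F) :
  (mmap (@mpolyC 3 F) r p).@[v] = p.@[fun i => (r i).@[v]].
Proof.
elim/mpoly3_ind: p.
- by move=> c; rewrite mmapC !mevalC.
- by move=> i; rewrite mmapX mmap1U mevalXU.
- by move=> a b ha hb; rewrite mmapD; etransitivity; [exact: mevalD | rewrite ha hb; apply/esym; exact: mevalD].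
- by move=> a b ha hb; rewrite rmorphM; etransitivity; [exact: mevalM | rewrite ha hb; apply/esym; exact: mevalM].
Qed.

(* the projection of the space onto the plane [l = 0] along a coordinate axis *)
Lemma linear_proj (F : numClosedFieldType) (l : poly3 F) : l \is 1.-homog -> l != 0 ->
  exists r : 'I_3 -> poly3 F, [/\ (forall v, l.@[fun i => (r i).@[v]] = 0),
     mmap (@mpolyC 3 F) r l = 0 & forall p, ldvd l (p - mmap (@mpolyC 3 F) r p)].
Proof.
move=> hl l0; have [i0 li0] := linform_neq0 hl l0.
pose r i : poly3 F := 'X_i - (if i == i0 then (lcoef l i0)^-1%:MP * l else 0).
have rl : mmap (@mpolyC 3 F) r l = 0.
  rewrite [X in mmap _ _ X](linformE hl) raddf_sum /=.
  under eq_bigr => i _ do rewrite rmorphM /= mmapC mmapX mmap1U /r mulrBr.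
  rewrite sumrB -(linformE hl) (bigD1 i0) //= eqxx big1 ?addr0 => [|i /negPf ->]; last by rewrite mulr0.
  by rewrite mulrA -mpolyCM mulfV // mul1r subrr.
exists r; split=> //.
- by move=> v; rewrite -meval_mmap rl meval0.
- elim/mpoly3_ind.
  + by move=> c; rewrite mmapC subrr; exists 0; rewrite mulr0.
  + move=> i; rewrite mmapX mmap1U /r opprB addrC subrK; case: ifP => _; last by exists 0; rewrite mulr0.
    by exists ((lcoef l i0)^-1%:MP); rewrite mulrC.
  + move=> p q hp hq; rewrite mmapD opprD addrACA; exact: ldvdD.
  + move=> p q hp hq; rewrite rmorphM /=.
    set p' := mmap _ _ p in hp *; set q' := mmap _ _ q in hq *.
    have -> : p * q - p' * q' = q * (p - p') + p' * (q - q') by ring.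
    by apply: ldvdD; apply: ldvdM.
Qed.

(** The projection onto the plane is a ring morphism to a domain that kills [l], and anything it
    kills is a multiple of [l]. *)
Lemma linear_prime (F : numClosedFieldType) (l p q : poly3 F) : l \is 1.-homog -> l != 0 ->
  ldvd l (p * q) -> ldvd l p \/ ldvd l q.
Proof.
move=> hl l0 [h E]; have [r [_ rl rp]] := linear_proj hl l0.
have : mmap (@mpolyC 3 F) r p * mmap (@mpolyC 3 F) r q = 0.
  by rewrite -rmorphM /= E rmorphM /= rl mul0r.
by move/eqP; rewrite mulf_eq0 => /orP [] /eqP e0; [left; have := rp p|right; have := rp q];
  rewrite e0 subr0.
Qed.

Lemma ldvd_vanish (F : numClosedFieldType) (l p : poly3 F) : l \is 1.-homog -> l != 0 ->
  (forall v : 'I_3 -> F, l.@[v] = 0 -> p.@[v] = 0) -> ldvd l p.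
Proof.
move=> hl l0 h; have [r [rv rl rp]] := linear_proj hl l0.
suff e0 : mmap (@mpolyC 3 F) r p = 0 by have := rp p; rewrite e0 subr0.
by apply: mpoly3_eq0 => v; rewrite meval_mmap; apply: h; apply: rv.
Qed.

Lemma pihomogM (F : numClosedFieldType) (g f : poly3 F) n k : f \is n.-homog ->
  pihomog mdeg (k + n) (g * f) = pihomog mdeg k g * f.
Proof.
move=> hf; pose K := maxn (msize g) k.+1.
have -> : g * f = \sum_(d < K) pihomog mdeg d g * f.
  by rewrite -mulr_suml -pihomog_partitionE // leq_maxl.
have hk : (k < K)%N by rewrite leq_maxr.
rewrite raddf_sum /= (bigD1 (Ordinal hk)) //= big1 ?addr0 => [|d dk].
  by rewrite pihomog_dE // dhomogM // pihomogP.
apply: (@pihomog_ne0 _ _ _ (d + n)%N); last by rewrite dhomogM // pihomogP.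
by rewrite eqn_add2r; apply: contra dk => /eqP e; apply/eqP/val_inj.
Qed.

Lemma homog_quot (F : numClosedFieldType) (g f : poly3 F) n k : f \is n.-homog -> f != 0 -> g * f \is (k + n).-homog ->
  g \is k.-homog.
Proof.
move=> hf f0 /pihomog_dE E; have E2 := pihomogM g k hf; rewrite E in E2.
by rewrite (mulIf f0 E2) pihomogP.
Qed.

Lemma homog_quot_lt (F : numClosedFieldType) (g f : poly3 F) n k : f \is n.-homog -> f != 0 -> g * f \is k.-homog -> (k < n)%N ->
  g = 0.
Proof.
move=> hf f0 h kn; rewrite (pihomog_partitionE (leqnn (msize g))).
apply: big1 => d _; apply: (mulIf f0); rewrite mul0r -(pihomogM g d hf).
apply: (@pihomog_ne0 _ _ _ k) => //; rewrite ltn_eqF //.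
by apply: leq_trans kn _; rewrite leq_addl.
Qed.

(** * Affine charts *)

(* [vh + u b + w e] are affine coordinates of the plane [x_i = 1] at [vh]; [be] and [ga] are the
   linear forms extending the coordinates [u] and [w]. *)
Definition affine_chart (F : numClosedFieldType) (i : 'I_3) (vh b e be ga : 'I_3 -> F) : Prop :=
  [/\ [/\ vh i = 1, b i = 0 & e i = 0],
      (forall j k, (j == k)%:R = (k == i)%:R * vh j + be k * b j + ga k * e j),
      [/\ \sum_k be k * vh k = 0, \sum_k be k * b k = 1 & \sum_k be k * e k = 0] &
      [/\ \sum_k ga k * vh k = 0, \sum_k ga k * b k = 0 & \sum_k ga k * e k = 1]].

(** The u-axis is L itself, with direction towards [B], and the coordinate w is exactly [l]; hence
    [f * l] becomes [\w * g] in this chart. *)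
Lemma affine_chart_exists (F : numClosedFieldType) (l : poly3 F) (i : 'I_3) (vh B : 'I_3 -> F) :
  l \is 1.-homog -> l != 0 -> vh i = 1 -> l.@[vh] = 0 -> l.@[B] = 0 ->
  (exists j, B j != B i * vh j) ->
  exists e be, affine_chart i vh (fun j => B j - B i * vh j) e be (lcoef l).
Proof.
move=> hl l0 vi lv lB [jB hB].
have lE (x : 'I_3 -> F) : l.@[x] = \sum_k lcoef l k * x k := linform_eval x hl.
(* A linear form involving only the i-th variable would not vanish at [vh]. The coordinate [p]
   serves as w-axis inside the chart. *)
have [p [pi lp]] : exists p, p != i /\ lcoef l p != 0.
  apply: NNPP => h.
  have hh p : p != i -> lcoef l p = 0.
    by move=> pi; apply/eqP/negPn/negP => lp; apply: h; exists p.
  have li : lcoef l i = 0.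
    by move: lv; rewrite lE (bigD1 i) //= vi mulr1 big1 ?addr0 // => p /hh ->; rewrite mul0r.
  have [q lq] := linform_neq0 hl l0; case/eqP: lq.
  by have [->|/hh] := eqVneq q i.
pose b : 'I_3 -> F := fun j => B j - B i * vh j.
pose e : 'I_3 -> F := fun j => if j == p then (lcoef l p)^-1 else 0.
have bi : b i = 0 by rewrite /b vi mulr1 subrr.
have ei : e i = 0 by rewrite /e eq_sym (negPf pi).
have lb : \sum_k lcoef l k * b k = 0.
  under eq_bigr => k _ do rewrite /b mulrBr mulrCA.
  by rewrite sumrB -mulr_sumr -!lE lv lB mulr0 subr0.
have le : \sum_k lcoef l k * e k = 1.
  rewrite (bigD1 p) //= /e eqxx mulfV // big1 ?addr0 // => k /negPf ->.
  by rewrite mulr0.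
have lvh : \sum_k lcoef l k * vh k = 0 by rewrite -lE.
have bjB : b jB != 0 by rewrite subr_eq0.
change (exists e be, affine_chart i vh b e be (lcoef l)).
clearbody b e.
pose M : 'M[F]_3 := \matrix_(r, j) (if val r == 0%N then vh j else if val r == 1%N then b j else e j).
have rowE (x : 'rV[F]_3) j : (x *m M) 0 j = x 0 ord0 * vh j + x 0 (lift ord0 ord0) * b j + x 0 (lift ord0 (lift ord0 ord0)) * e j.
  by rewrite mxE !big_ord_recl big_ord0 addr0 !mxE /= addrA.
(* Two of the three coordinates in the basis vh, b, e are known explicitly, as the i-th entry and
   the value of [l]; only the u-coordinate requires the inverse matrix. *)
have coords (x : 'rV[F]_3) : x 0 ord0 = (x *m M) 0 i /\ x 0 (lift ord0 (lift ord0 ord0)) = \sum_k lcoef l k * (x *m M) 0 k.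
  split; first by rewrite rowE vi bi ei mulr1 !mulr0 !addr0.
  under eq_bigr => k _ do rewrite rowE !mulrDr !(mulrCA (lcoef l k)).
  by rewrite !big_split /= -!mulr_sumr lvh lb le !mulr0 !add0r mulr1.
have inj (x : 'rV[F]_3) : x *m M = 0 -> x = 0.
  move=> xM; have [x0 x2] := coords x.
  rewrite xM mxE in x0.
  rewrite big1 in x2; last by move=> k _; rewrite xM mxE mulr0.
  have x1 : x 0 (lift ord0 ord0) = 0.
    have := rowE x jB; rewrite xM mxE x0 x2 !mul0r add0r addr0 => /esym/eqP.
    by rewrite mulf_eq0 (negPf bjB) orbF => /eqP.
  apply/rowP => j; rewrite [RHS]mxE; case: (unliftP ord0 j) => [j1 ->|-> //].
  case: (unliftP ord0 j1) => [j2 ->|-> //].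
  by case: (unliftP ord0 j2) => [[]|-> //].
have uM : M \in unitmx.
  rewrite -row_free_unit -kermx_eq0; apply/eqP/row_matrixP => r.
  by rewrite row0; apply: inj; apply/sub_kermxP; rewrite row_sub.
pose N := invmx M; pose be : 'I_3 -> F := fun k => N k (lift ord0 ord0).
have key j k : (j == k)%:R = (k == i)%:R * vh j + be k * b j + lcoef l k * e j.
  pose x := delta_mx 0 k *m N : 'rV[F]_3.
  have xM : x *m M = delta_mx 0 k by rewrite mulmxKV.
  have xN r : x 0 r = N k r by rewrite /x -matrix.rowE mxE.
  have := rowE x j; have [-> ->] := coords x; rewrite xM xN -/(be k) => E.
  have dE r : (delta_mx 0 k : 'rV[F]_3) 0 r = (r == k)%:R by rewrite mxE eqxx.
  rewrite -dE E dE eq_sym; congr (_ + _ * _).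
  rewrite (bigD1 k) //= big1 ?addr0 => [|r rk]; first by rewrite dE eqxx mulr1.
  by rewrite dE (negPf rk) mulr0.
have beE (y : 'I_3 -> F) (j : 'I_3) : y j = y i * vh j + (\sum_k be k * y k) * b j + (\sum_k lcoef l k * y k) * e j.
  transitivity (\sum_k (j == k)%:R * y k).
    rewrite (bigD1 j) //= eqxx mul1r big1 ?addr0 // => k kj.
    by rewrite eq_sym (negPf kj) mul0r.
  under eq_bigr => k _ do rewrite key !mulrDl.
  rewrite !big_split /= !mulr_suml; congr (_ + _ + _); try by apply: eq_bigr => k _; rewrite mulrAC.
  rewrite (bigD1 i) //= eqxx mul1r big1 ?addr0 => [|k /negPf ->]; first by rewrite mulrC.
  by rewrite !mul0r.
exists e, be; split=> //; split.
- have := beE vh jB; rewrite vi mul1r lvh mul0r addr0 => /eqP; rewrite addrC -subr_eq subrr eq_sym.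
  by rewrite mulf_eq0 (negPf bjB) orbF => /eqP.
- have := beE b jB; rewrite bi lb !mul0r add0r addr0 -{1}[b jB]mul1r.
  by move/(mulIf bjB).
- have := beE e jB; rewrite ei le mul0r add0r mul1r => /eqP; rewrite -subr_eq subrr eq_sym.
  by rewrite mulf_eq0 (negPf bjB) orbF => /eqP.
Qed.

Definition chart_map (F : numClosedFieldType) (vh b e : 'I_3 -> F) (p : poly3 F) : {poly {poly F}} :=
  mmap (@polyC {poly F} \o @polyC F) (fun j => cst (vh j) + cst (b j) * 'X + cst (e j) * \w) p.

Lemma chart_mapD (F : numClosedFieldType) (vh b e : 'I_3 -> F) (p q : poly3 F) :
  chart_map vh b e (p + q) = chart_map vh b e p + chart_map vh b e q.
Proof. exact: mmapD. Qed.

Lemma chart_mapM (F : numClosedFieldType) (vh b e : 'I_3 -> F) (p q : poly3 F) :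
  chart_map vh b e (p * q) = chart_map vh b e p * chart_map vh b e q.
Proof. exact: rmorphM. Qed.

Lemma chart_mapB (F : numClosedFieldType) (vh b e : 'I_3 -> F) (p q : poly3 F) :
  chart_map vh b e (p - q) = chart_map vh b e p - chart_map vh b e q.
Proof. exact: mmapB. Qed.

Lemma chart_mapC (F : numClosedFieldType) (vh b e : 'I_3 -> F) (c : F) :
  chart_map vh b e c%:MP = cst c.
Proof. exact: mmapC. Qed.

Lemma chart_mapX (F : numClosedFieldType) (vh b e : 'I_3 -> F) j :
  chart_map vh b e 'X_j = cst (vh j) + cst (b j) * 'X + cst (e j) * \w.
Proof. by rewrite /chart_map mmapX mmap1U. Qed.

Lemma chart_map_sum (F : numClosedFieldType) (vh b e : 'I_3 -> F) (I : Type) (r : seq I) (P : pred I)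
  (f : I -> poly3 F) :
  chart_map vh b e (\sum_(i <- r | P i) f i) = \sum_(i <- r | P i) chart_map vh b e (f i).
Proof. exact: rmorph_sum. Qed.

Lemma cstD (F : fieldType) (a b : F) : cst (a + b) = cst a + cst b.
Proof. by rewrite /cst !polyCD. Qed.

Lemma cst0 (F : fieldType) : cst (0 : F) = 0.
Proof. by rewrite /cst !polyC0. Qed.

Lemma cst1 (F : fieldType) : cst (1 : F) = 1.
Proof. by rewrite /cst !polyC1. Qed.

Definition linform (F : numClosedFieldType) (a : 'I_3 -> F) : poly3 F := \sum_k (a k)%:MP * 'X_k.

Lemma chart_map_linform (F : numClosedFieldType) (vh b e a : 'I_3 -> F) :
  chart_map vh b e (linform a) =
  cst (\sum_k a k * vh k) + cst (\sum_k a k * b k) * 'X + cst (\sum_k a k * e k) * \w.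
Proof.
rewrite /linform chart_map_sum !cst_sum !mulr_suml -!big_split /=; apply: eq_bigr => k _.
by rewrite chart_mapM chart_mapC chart_mapX !cstM; ring.
Qed.

Lemma chart_map_u (F : numClosedFieldType) i (vh b e be ga : 'I_3 -> F) :
  affine_chart i vh b e be ga -> chart_map vh b e (linform be) = 'X.
Proof. by case=> _ _ [h1 h2 h3] _; rewrite chart_map_linform h1 h2 h3 cst0 cst1 mul0r mul1r add0r addr0. Qed.

Lemma chart_map_w (F : numClosedFieldType) i (vh b e be ga : 'I_3 -> F) :
  affine_chart i vh b e be ga -> chart_map vh b e (linform ga) = \w.
Proof. by case=> _ _ _ [h1 h2 h3]; rewrite chart_map_linform h1 h2 h3 cst0 cst1 !mul0r mul1r !add0r. Qed.

(** A section of [chart_map], substituting the linear forms [be] and [ga] for u and w; it is also an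
    inverse modulo ['X_i - 1]. *)
Definition chart_lift (F : numClosedFieldType) (be ga : 'I_3 -> F) (x : {poly {poly F}}) : poly3 F :=
  (map_poly (fun c : {poly F} => (map_poly (@mpolyC 3 F) c).[linform ga]) x).[linform be].

Lemma chart_lift_morph (F : numClosedFieldType) (be ga : 'I_3 -> F) :
  [/\ forall x y, chart_lift be ga (x + y) = chart_lift be ga x + chart_lift be ga y,
      forall x y, chart_lift be ga (x * y) = chart_lift be ga x * chart_lift be ga y,
      forall c, chart_lift be ga (cst c) = c%:MP &
      chart_lift be ga 'X = linform be /\ chart_lift be ga \w = linform ga].
Proof.
pose inner : {poly F} -> poly3 F := horner_eval (linform ga) \o map_poly (@mpolyC 3 F).
have E x : chart_lift be ga x = horner_eval (linform be) (map_poly (inner : {rmorphism {poly F} -> poly3 F}) x).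
  by [].
split.
- by move=> x y; rewrite !E !rmorphD.
- by move=> x y; rewrite !E !rmorphM.
- by move=> c; rewrite E /cst map_polyC /= map_polyC /= /horner_eval !hornerC.
- by split; rewrite E ?map_polyX ?map_polyC /= ?map_polyX /horner_eval ?hornerC hornerX.
Qed.

Lemma poly2_ind (F : fieldType) (P : {poly {poly F}} -> Prop) :
  (forall c, P (cst c)) -> P 'X -> P \w -> (forall x y, P x -> P y -> P (x + y)) ->
  (forall x y, P x -> P y -> P (x * y)) -> forall x, P x.
Proof.
move=> hc hX hw hD hM; elim/poly_ind => [|x c IH]; first by rewrite -(cst0 F).
apply: (hD); first exact: hM.
elim/poly_ind: c => [|c d IHc]; first by rewrite polyC0 -(cst0 F).
by rewrite polyCD polyCM; apply: (hD); [apply: hM | apply: hc].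
Qed.

Lemma chart_liftK (F : numClosedFieldType) i (vh b e be ga : 'I_3 -> F) :
  affine_chart i vh b e be ga -> forall x, chart_map vh b e (chart_lift be ga x) = x.
Proof.
move=> hc; have [hD hM hC [hX hw]] := chart_lift_morph be ga; apply: poly2_ind.
- by move=> c; rewrite hC chart_mapC.
- by rewrite hX (chart_map_u hc).
- by rewrite hw (chart_map_w hc).
- by move=> x y IHx IHy; rewrite hD chart_mapD IHx IHy.
- by move=> x y IHx IHy; rewrite hM chart_mapM IHx IHy.
Qed.

Lemma chart_mapK (F : numClosedFieldType) i (vh b e be ga : 'I_3 -> F) :
  affine_chart i vh b e be ga ->
  forall p, exists c, p = chart_lift be ga (chart_map vh b e p) + c * ('X_i - 1).
Proof.
move=> hc; have [hD hM hC [hX hw]] := chart_lift_morph be ga; apply: mpoly3_ind.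
- by move=> c; exists 0; rewrite chart_mapC hC mul0r addr0.
- move=> j; exists (vh j)%:MP; rewrite chart_mapX !hD !hM !hC hX hw.
  have : 'X_j = (vh j)%:MP * 'X_i + (b j)%:MP * linform be + (e j)%:MP * linform ga :> poly3 F.
    case: hc => _ key _ _.
    transitivity (\sum_k (j == k)%:R%:MP * 'X_k : poly3 F).
      rewrite (bigD1 j) //= eqxx mul1r big1 ?addr0 // => k kj.
      by rewrite eq_sym (negPf kj) mul0r.
    under eq_bigr => k _ do rewrite key !mpolyCD !mpolyCM !mulrDl.
    rewrite !big_split /= !mulr_sumr; congr (_ + _ + _); try by apply: eq_bigr => k _; ring.
    rewrite (bigD1 i) //= eqxx mul1r big1 ?addr0 // => k /negPf ->.
    by rewrite mpolyC0 !mul0r.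
  by move=> {1}->; ring.
- move=> p q [c {1}->] [d {1}->]; exists (c + d); rewrite chart_mapD hD; ring.
- move=> p q [c Ep] [d Eq].
  exists (c * q + chart_lift be ga (chart_map vh b e p) * d).
  by rewrite {1}Ep chart_mapM hM mulrDl {1}Eq; ring.
Qed.

(** * Local lengths *)

Definition chart_index (F : numClosedFieldType) (v : 'I_3 -> F) : 'I_3 := odflt ord0 [pick i | v i != 0].

Definition chart_monomial (F : numClosedFieldType) (v : 'I_3 -> F) (e : 'X_{1..3}) : poly3 F :=
  \prod_(j < 3) ('X_j - (v j / v (chart_index v))%:MP) ^+ (e j).

Definition in_jet_ideal (F : numClosedFieldType) (k : nat) (gens : 'I_k -> poly3 F) (v : 'I_3 -> F)
    (N : nat) (p : poly3 F) : Prop :=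
  exists (c : 'I_k -> poly3 F) (c0 : poly3 F) (m : 'X_{1..3 < N.+1} -> poly3 F),
    p = \sum_(j < k) c j * gens j + c0 * ('X_(chart_index v) - 1)
        + \sum_(e : 'X_{1..3 < N.+1} | mdeg e == N) m e * chart_monomial v e.

Definition jet_dim_ge (F : numClosedFieldType) (k : nat) (gens : 'I_k -> poly3 F) (v : 'I_3 -> F)
    (N r : nat) : Prop :=
  exists ps : 'I_r -> poly3 F, forall c : 'I_r -> F,
    in_jet_ideal gens v N (\sum_(t < r) (c t)%:MP * ps t) -> forall t, c t = 0.

Definition is_length (F : numClosedFieldType) (k : nat) (gens : 'I_k -> poly3 F) (v : 'I_3 -> F)
    (n : nat) : Prop :=
  (forall N, ~ jet_dim_ge gens v N n.+1) /\ exists N, jet_dim_ge gens v N n.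

Definition in_mpow (F : numClosedFieldType) (v : 'I_3 -> F) (N : nat) (p : poly3 F) : Prop :=
  exists m : 'X_{1..3 < N.+1} -> poly3 F,
    p = \sum_(e : 'X_{1..3 < N.+1} | mdeg e == N) m e * chart_monomial v e.

Lemma in_mpow_ideal (F : numClosedFieldType) (v : 'I_3 -> F) N : isideal (in_mpow v N).
Proof.
split.
- by exists (fun=> 0); rewrite big1 // => e _; rewrite mul0r.
- move=> _ _ [m ->] [m' ->]; exists (fun e => m e + m' e).
  by rewrite -big_split; apply: eq_bigr => e _; rewrite mulrDl.
- move=> a _ [m ->]; exists (fun e => a * m e).
  by rewrite mulr_sumr; apply: eq_bigr => e _; rewrite mulrA.
Qed.

Lemma in_mpow_mon (F : numClosedFieldType) (v : 'I_3 -> F) N (e : 'X_{1..3}) :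
  mdeg e = N -> in_mpow v N (chart_monomial v e).
Proof.
move=> he; have lt : (mdeg e < N.+1)%N by rewrite he.
exists (fun e' => if e' == BMultinom lt then 1 else 0).
rewrite (bigD1 (BMultinom lt)) /= ?he ?eqxx // mul1r big1 ?addr0 // => e' /andP [_ /negPf ->].
by rewrite mul0r.
Qed.

Lemma in_mpow_step (F : numClosedFieldType) (v : 'I_3 -> F) N j (p : poly3 F) :
  in_mpow v N p -> in_mpow v N.+1 (('X_j - (v j / v (chart_index v))%:MP) * p).
Proof.
move=> [m ->]; rewrite mulr_sumr; apply: ideal_sum => [|e /eqP he]; first exact: in_mpow_ideal.
rewrite mulrCA; case: (in_mpow_ideal v N.+1) => _ _; apply.
have -> : ('X_j - (v j / v (chart_index v))%:MP) * chart_monomial v e = chart_monomial v (e + U_(j))%MM.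
  rewrite /chart_monomial (bigD1 j) //= [RHS](bigD1 j) //= mulrA -exprS mnmDE mnm1E eqxx addn1.
  congr (_ * _); apply: eq_bigr => k kj; rewrite mnmDE mnm1E eq_sym (negPf kj) addn0 //.
by apply: in_mpow_mon; rewrite mdegD mdeg1 he addn1.
Qed.

Lemma in_mpow_linform (F : numClosedFieldType) (v a : 'I_3 -> F) N (p : poly3 F) :
  \sum_k a k * (v k / v (chart_index v)) = 0 ->
  in_mpow v N p -> in_mpow v N.+1 (linform a * p).
Proof.
move=> ha hp.
have -> : linform a = \sum_k (a k)%:MP * ('X_k - (v k / v (chart_index v))%:MP).
  under [RHS]eq_bigr => k _ do rewrite mulrBr -mpolyCM.
  by rewrite sumrB -rmorph_sum /= ha mpolyC0 subr0.
rewrite mulr_suml; apply: ideal_sum => [|k _]; first exact: in_mpow_ideal.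
by rewrite -mulrA; case: (in_mpow_ideal v N.+1) => _ _; apply; apply: in_mpow_step.
Qed.

Lemma chart_lift_mpow (F : numClosedFieldType) i (v b e be ga : 'I_3 -> F) nu N :
  affine_chart i (fun k => v k / v (chart_index v)) b e be ga -> at0 nu = 0 ->
  in_mpow v N (chart_lift be ga nu ^+ N).
Proof.
move=> [_ _ [hb _ _] [hg _ _]] /at0_eq0 [y [z Enu]].
have [hD hM hC [hX hw]] := chart_lift_morph be ga.
elim: N => [|N IH].
  have -> : chart_lift be ga nu ^+ 0 = chart_monomial v 0%MM.
    by rewrite expr0 /chart_monomial big1 // => j _; rewrite mnm0E expr0.
  by apply: in_mpow_mon; rewrite mdeg0.
rewrite exprS {1}Enu hD !hM hX hw mulrDl -!mulrA.
have [_ hiD hiM] := in_mpow_ideal v N; case: (in_mpow_ideal v N.+1) => _ hjD _.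
by apply: hjD; apply: in_mpow_linform => //; apply: hiM.
Qed.

(** By pigeonhole one of three exponents is at least 2K, and the corresponding factor is a power of
    a linear form in u and w, which lies in [J] from exponent 2K on. *)
Lemma chart_map_mon (F : numClosedFieldType) i (v b e be ga : 'I_3 -> F)
    (J : {poly {poly F}} -> Prop) K (m : 'X_{1..3}) :
  affine_chart i (fun k => v k / v (chart_index v)) b e be ga -> isideal J ->
  J ('X ^+ K) -> J (\w ^+ K) -> (3 * (K + K) <= mdeg m)%N ->
  J (chart_map (fun k => v k / v (chart_index v)) b e (chart_monomial v m)).
Proof.
move=> hc hJ hu hw hm.
have [j hj] : exists j, (K + K <= m j)%N.
  apply: NNPP => h; have hlt j : (m j < K + K)%N by rewrite ltnNge; apply/negP => hj; apply: h; exists j.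
  move: hm; rewrite mdegE !big_ord_recl big_ord0.
  have := hlt ord0; have := hlt (lift ord0 ord0); have := hlt (lift ord0 (lift ord0 ord0)).
  by move: (m _) (m _) (m _) => a c d; clear; lia.
rewrite /chart_monomial (bigD1 j) //= chart_mapM; apply: idealMr => //.
rewrite -(subnK hj) exprD chart_mapM; case: (hJ) => _ _ hM; apply: hM.
have hX n p : chart_map (fun k => v k / v (chart_index v)) b e (p ^+ n) =
   chart_map (fun k => v k / v (chart_index v)) b e p ^+ n.
  by rewrite /chart_map rmorphXn.
rewrite hX chart_mapB chart_mapC chart_mapX.
have -> : cst (v j / v (chart_index v)) + cst (b j) * 'X + cst (e j) * \w - cst (v j / v (chart_index v))
  = cst (b j) * 'X + cst (e j) * \w by ring.
by case: (hJ) => _ _ hM; apply: ideal_exprD => //; rewrite exprMn; apply: hM.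
Qed.

(** The link between stable jet dimensions and contracted local ideals. For every [N] an element of
    [J] lifts into the jet ideal, its denominator being a unit modulo the N-th power of the maximal
    ideal; for large [N] the jet ideal conversely maps into [J]. *)
Lemma length_codim (F : numClosedFieldType) (v b e be ga : 'I_3 -> F) k (gens : 'I_k -> poly3 F)
    (J : {poly {poly F}} -> Prop) n :
  let vh := fun k => v k / v (chart_index v) in
  affine_chart (chart_index v) vh b e be ga -> isideal J -> primary J ->
  (forall j, J (chart_map vh b e (gens j))) ->
  (forall x, J x -> exists s p, at0 s != 0 /\ s * x = \sum_j p j * chart_map vh b e (gens j)) ->
  codim J n -> is_length gens v n.
Proof.
move=> vh hc hJ [K [hu hw]] hg hJx [T [ps [hT hi hs]]]; split.
- move=> N [qs hqs].
  have : ~ indep J (fun t => chart_map vh b e (qs t)).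
    by move=> hi'; have := indep_spans_le hJ hi' hs; rewrite card_ord hT ltnn.
  apply=> c; have -> : \sum_t cst (c t) * chart_map vh b e (qs t) = chart_map vh b e (\sum_t (c t)%:MP * qs t).
    by rewrite chart_map_sum; apply: eq_bigr => t _; rewrite chart_mapM chart_mapC.
  move: (\sum_t (c t)%:MP * qs t) (hqs c) => x hx Jx; apply: hx.
  have [s [p [s0 Es]]] := hJx _ Jx.
  have [hD hM hC [hX hw']] := chart_lift_morph be ga.
  pose s' := cst (at0 s)^-1 * s; pose nu := 1 - s'.
  have nu0 : at0 nu = 0.
    have -> : nu = cst 1 + cst (-1) * s' by rewrite /nu /cst !polyCN !polyC1; ring.
    by rewrite at0D at0M !at0_cst /s' at0M at0_cst mulVf // mulr1 subrr.
  have [c0 Ec0] := chart_mapK hc x; set y := chart_map vh b e x in Jx Es Ec0.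
  have [m Em] : in_mpow v N (chart_lift be ga y * chart_lift be ga nu ^+ N).
    by case: (in_mpow_ideal v N) => _ _; apply; apply: chart_lift_mpow hc nu0.
  pose G := (\sum_(i < N) nu ^+ i) * cst (at0 s)^-1.
  have Ey : y = \sum_j (G * p j) * chart_map vh b e (gens j) + y * nu ^+ N.
    under eq_bigr => j _ do rewrite -mulrA.
    rewrite -mulr_sumr -Es /G mulrA -[_ * cst _ * s]mulrA -/s'.
    have -> : s' = 1 - nu by rewrite /nu; ring.
    have : nu ^+ N - 1 = (nu - 1) * \sum_(i < N) nu ^+ i by exact: subrX1.
    set Sg := \sum_(i < N) _ => EN.
    have -> : nu ^+ N = 1 + (nu - 1) * Sg by rewrite -EN; ring.
    by ring.
  have hXn z M : chart_lift be ga (z ^+ M) = chart_lift be ga z ^+ M.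
    by elim: M => [|M IH]; rewrite ?expr0 -?(cst1 F) ?hC // !exprS hM IH.
  have /fin_all_exists [cg hcg] j : exists cg, chart_lift be ga (chart_map vh b e (gens j)) = gens j - cg * ('X_(chart_index v) - 1).
    by have [cg Ecg] := chart_mapK hc (gens j); exists cg; rewrite {2}Ecg addrK.
  have hsum (f : 'I_k -> {poly {poly F}}) : chart_lift be ga (\sum_j f j) = \sum_j chart_lift be ga (f j).
    by apply: (big_morph _ hD); rewrite -(cst0 F) hC.
  exists (fun j => chart_lift be ga (G * p j)), (c0 - \sum_j chart_lift be ga (G * p j) * cg j), m.
  rewrite -Em Ec0 {1}Ey hD hsum [chart_lift _ _ (y * _)]hM hXn.
  rewrite (eq_bigr (fun j => chart_lift be ga (G * p j) * gens j
     - chart_lift be ga (G * p j) * cg j * ('X_(chart_index v) - 1))); last first.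
    by move=> j _; rewrite hM hcg mulrBr mulrA.
  by rewrite sumrB -mulr_suml; ring.
(* This is the degree from which [chart_map_mon] puts all monomials into [J], so a basis modulo [J]
   stays independent modulo the jet ideal. *)
- exists (3 * (K + K))%N, (fun t => chart_lift be ga (ps (enum_val (cast_ord (esym hT) t)))).
  move=> c [cc [c0 [m /(congr1 (chart_map vh b e)) E]]] t.
  have Ji : J (\sum_(t : T) cst (c (cast_ord hT (enum_rank t))) * ps t).
    have -> : \sum_(t : T) cst (c (cast_ord hT (enum_rank t))) * ps t =
      chart_map vh b e (\sum_(t < n) (c t)%:MP * chart_lift be ga (ps (enum_val (cast_ord (esym hT) t)))).
      rewrite chart_map_sum (reindex (fun t : 'I_n => enum_val (cast_ord (esym hT) t))) /=.
        by apply: eq_bigr => s _; rewrite chart_mapM chart_mapC (chart_liftK hc) enum_valK cast_ordKV.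
      by exists (fun t => cast_ord hT (enum_rank t)) => s _; rewrite ?enum_valK ?cast_ordKV // cast_ordK enum_rankK.
    rewrite E !chart_mapD !chart_map_sum chart_mapM.
    have -> : chart_map vh b e ('X_(chart_index v) - 1) = 0.
      case: hc => [[h1 h2 h3] _ _ _]; rewrite chart_mapB chart_mapX h1 h2 h3 !cst0 !mul0r !addr0.
      by rewrite -mpolyC1 chart_mapC subrr.
    case: (hJ) => _ hD hM; rewrite mulr0 addr0; apply: hD; apply: ideal_sum => // j.
      by move=> _; rewrite chart_mapM; apply: hM.
    move=> /eqP hj; rewrite chart_mapM; apply: hM; apply: (chart_map_mon hc hJ hu hw).
    by rewrite hj.
  have := hi _ Ji (enum_val (cast_ord (esym hT) t)).
  by rewrite enum_valK cast_ordKV.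
Qed.

Lemma is_length_unique (F : numClosedFieldType) k (gens : 'I_k -> poly3 F) (v : 'I_3 -> F) n m :
  is_length gens v n -> is_length gens v m -> n = m.
Proof.
have H a c : is_length gens v a -> is_length gens v c -> (a <= c)%N.
  move=> [_ [N [ps hps]]] [h _]; rewrite leqNgt; apply/negP => ca; apply: (h N).
  have [r Ea] : exists r, a = (c.+1 + r)%N by exists (a - c.+1)%N; rewrite subnKC.
  subst a; exists (fun t => ps (lshift r t)) => d hd t.
  pose d' (s : 'I_(c.+1 + r)) := if split s is inl s' then d s' else 0.
  have d'l s : d' (lshift r s) = d s by rewrite /d' -[lshift r s]/(unsplit (inl s)) unsplitK.
  have d'r s : d' (rshift c.+1 s) = 0 by rewrite /d' -[rshift _ s]/(unsplit (inr s)) unsplitK.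
  rewrite -d'l; apply: hps; rewrite big_split_ord /= [X in _ + X]big1 ?addr0 => [|s _].
    by under eq_bigr => s _ do rewrite d'l.
  by rewrite d'r mpolyC0 mul0r.
by move=> h1 h2; apply/eqP; rewrite eqn_leq !H.
Qed.

Lemma chart_map_deriv (F : numClosedFieldType) (vh b e : 'I_3 -> F) (p : poly3 F) :
  (chart_map vh b e p)^`() = \sum_k chart_map vh b e (mderiv k p) * cst (b k) /\
  dw (chart_map vh b e p) = \sum_k chart_map vh b e (mderiv k p) * cst (e k).
Proof.
split; rewrite /chart_map.
- rewrite (@mmap_derivation _ _ _ _ (@deriv {poly F})).
  + apply: eq_bigr => k _; congr (_ * _).
    by rewrite /cst !(derivD, derivM, derivX, derivC) mul0r add0r mulr1 mul0r mulr0 !addr0 add0r.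
  + exact: derivD.
  + exact: derivM.
  + by move=> c; rewrite /= derivC.
- rewrite (@mmap_derivation _ _ _ _ (@dw F)).
  + apply: eq_bigr => k _; congr (_ * _).
    rewrite /cst !(dwD, dwM, dwX, dwC, derivC, derivX) !polyC0 polyC1.
    by rewrite mul0r add0r mulr0 mul0r mulr1 !add0r.
  + exact: dwD.
  + exact: dwM.
  + by move=> c; rewrite /= dwC derivC polyC0.
Qed.

(** With [chart_map_deriv] this shows that the two partials used in the definitions and the
    derivatives along u and w generate the same ideal. *)
Lemma chart_map_partial (F : numClosedFieldType) i (vh b e be ga : 'I_3 -> F) (p : poly3 F) k :
  affine_chart i vh b e be ga -> k != i ->
  chart_map vh b e (mderiv k p) =
  cst (be k) * (chart_map vh b e p)^`() + cst (ga k) * dw (chart_map vh b e p).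
Proof.
move=> [_ key _ _] ki; have [-> ->] := chart_map_deriv vh b e p.
transitivity (\sum_j chart_map vh b e (mderiv j p) * cst (j == k)%:R).
  rewrite (bigD1 k) //= eqxx cst1 mulr1 big1 ?addr0 // => j /negPf ->.
  by rewrite cst0 mulr0.
rewrite !mulr_sumr -big_split /=; apply: eq_bigr => j _.
by rewrite key (negPf ki) mul0r add0r cstD !cstM; ring.
Qed.

Definition milnor_gens (F : numClosedFieldType) (f : poly3 F) (v : 'I_3 -> F) (k : 'I_2) : poly3 F :=
  mderiv (lift (chart_index v) k) f.

Definition tjurina_gens (F : numClosedFieldType) (f : poly3 F) (v : 'I_3 -> F) (k : 'I_3) : poly3 F :=
  if val k is j.+1 then mderiv (lift (chart_index v) (inord j : 'I_2)) f else f.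

Lemma milnor_length (F : numClosedFieldType) (v b e be ga : 'I_3 -> F) (f : poly3 F) n :
  let vh := fun k => v k / v (chart_index v) in
  let g := chart_map vh b e f in
  affine_chart (chart_index v) vh b e be ga -> primary (loc2 g^`() (dw g)) ->
  codim (loc2 g^`() (dw g)) n -> is_length (milnor_gens f v) v n.
Proof.
move=> vh g hc hp; apply: (length_codim hc (loc2_ideal _ _) hp).
- move=> k; rewrite /milnor_gens (chart_map_partial f hc) -/vh -/g; last by rewrite eq_sym neq_lift.
  have [_ hD hM] := loc2_ideal g^`() (dw g).
  by apply: hD; apply: hM; [apply: loc2l | apply: loc2r].
- move=> x [s [p [q [s0 Es]]]].
  exists s, (fun k : 'I_2 => p * cst (b (lift (chart_index v) k)) + q * cst (e (lift (chart_index v) k))).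
  split=> //; rewrite Es; have [-> ->] := chart_map_deriv vh b e f.
  case: hc => [[h1 h2 h3] _ _ _].
  rewrite !(bigD1_ord (chart_index v)) //= h2 h3 cst0 !mulr0 !add0r !mulr_sumr -big_split.
  by apply: eq_bigr => k _; rewrite /milnor_gens /=; ring.
Qed.

Lemma tjurina_length (F : numClosedFieldType) (v b e be ga : 'I_3 -> F) (f : poly3 F) n :
  let vh := fun k => v k / v (chart_index v) in
  let g := chart_map vh b e f in
  affine_chart (chart_index v) vh b e be ga -> primary (loc3 g g^`() (dw g)) ->
  codim (loc3 g g^`() (dw g)) n -> is_length (tjurina_gens f v) v n.
Proof.
move=> vh g hc hp; apply: (length_codim hc (loc3_ideal _ _ _) hp).
- move=> k; rewrite /tjurina_gens; case: (val k) => [|j]; first exact: loc31.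
  rewrite (chart_map_partial f hc) -/vh -/g; last by rewrite eq_sym neq_lift.
  have [_ hD hM] := loc3_ideal g g^`() (dw g).
  by apply: hD; apply: hM; [apply: loc32 | apply: loc33].
- move=> x [s [p [q [r [s0 Es]]]]].
  pose c (k : 'I_2) := q * cst (b (lift (chart_index v) k)) + r * cst (e (lift (chart_index v) k)).
  exists s, (fun k : 'I_3 => if val k is j.+1 then c (inord j) else p).
  split=> //; rewrite Es; have [-> ->] := chart_map_deriv vh b e f.
  case: hc => [[h1 h2 h3] _ _ _].
  rewrite [RHS]big_ord_recl /= !(bigD1_ord (chart_index v)) //= h2 h3 cst0 !mulr0 !add0r.
  rewrite -addrA; congr (_ + _); rewrite !mulr_sumr -big_split.
  by apply: eq_bigr => k _; rewrite /tjurina_gens /= inord_val /c; ring.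
Qed.

(** * Finiteness for reduced curves *)

Lemma chart_map_eval (F : numClosedFieldType) (vh b e : 'I_3 -> F) (p : poly3 F) (u w : F) :
  (chart_map vh b e p).[u%:P].[w] = p.@[fun j => vh j + b j * u + e j * w].
Proof.
elim/mpoly3_ind: p.
- by move=> c; rewrite chart_mapC /cst !hornerC mevalC.
- by move=> j; rewrite chart_mapX mevalXU /cst !hornerE.
- by move=> p q IHp IHq; rewrite chart_mapD mevalD !hornerD IHp IHq.
- by move=> p q IHp IHq; rewrite chart_mapM mevalM !hornerM IHp IHq.
Qed.

Lemma linform_homog (F : numClosedFieldType) (a : 'I_3 -> F) : linform a \is 1.-homog.
Proof.
apply: rpred_sum => k _; rewrite mul_mpolyC; apply: dhomogZ.
by rewrite dhomogX; apply/eqP/mdeg1.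
Qed.

Lemma X_homog (F : numClosedFieldType) i : ('X_i : poly3 F) \is 1.-homog.
Proof. by rewrite dhomogX; apply/eqP/mdeg1. Qed.

Lemma X_neq0 (F : numClosedFieldType) i : ('X_i : poly3 F) != 0.
Proof.
apply/eqP => h; have := mevalXU (fun=> 1 : F) i; rewrite h meval0 => /esym/eqP.
by rewrite oner_eq0.
Qed.

Lemma chart_map_Xi (F : numClosedFieldType) i (vh b e be ga : 'I_3 -> F) :
  affine_chart i vh b e be ga -> chart_map vh b e 'X_i = 1.
Proof.
by case=> [[h1 h2 h3] _ _ _]; rewrite chart_mapX h1 h2 h3 cst1 cst0 !mul0r !addr0.
Qed.

Lemma chart_mapXn (F : numClosedFieldType) (vh b e : 'I_3 -> F) (p : poly3 F) n :
  chart_map vh b e (p ^+ n) = chart_map vh b e p ^+ n.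
Proof. exact: rmorphXn. Qed.

(** All large degrees are provided because an identity in the chart lifts to one between forms only
    if both sides have the same degree; powers of ['X_i] fill the gap. *)
Lemma homogenize (F : numClosedFieldType) i (vh b e be ga : 'I_3 -> F) :
  affine_chart i vh b e be ga ->
  forall x, exists N0, forall N, (N0 <= N)%N -> exists2 Q, Q \is N.-homog & chart_map vh b e Q = x.
Proof.
move=> hc; have hXN N : ('X_i ^+ N : poly3 F) \is N.-homog.
  by have := dhomogMn N (X_homog F i); rewrite mul1n.
apply: poly2_ind.
- move=> c; exists 0%N => N _; exists (c%:MP * 'X_i ^+ N).
    by rewrite mul_mpolyC; apply: dhomogZ.
  by rewrite chart_mapM chart_mapC chart_mapXn (chart_map_Xi hc) expr1n mulr1.
- exists 1%N => -[//|N] _; exists (linform be * 'X_i ^+ N).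
    by have := dhomogM (linform_homog be) (hXN N); rewrite add1n.
  by rewrite chart_mapM (chart_map_u hc) chart_mapXn (chart_map_Xi hc) expr1n mulr1.
- exists 1%N => -[//|N] _; exists (linform ga * 'X_i ^+ N).
    by have := dhomogM (linform_homog ga) (hXN N); rewrite add1n.
  by rewrite chart_mapM (chart_map_w hc) chart_mapXn (chart_map_Xi hc) expr1n mulr1.
- move=> x y [N1 h1] [N2 h2]; exists (maxn N1 N2) => N; rewrite geq_max => /andP [/h1 [Q hQ <-] /h2 [P hP <-]].
  by exists (Q + P); [apply: dhomogD | rewrite chart_mapD].
- move=> x y [N1 h1] [N2 h2]; exists (N1 + N2)%N => N hN.
  have [Q hQ <-] := h1 N1 (leqnn _); have [|P hP <-] := h2 (N - N1)%N.
    by rewrite leq_subRL // (leq_trans _ hN) // leq_addr.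
  exists (Q * P); last by rewrite chart_mapM.
  by rewrite -(subnKC (leq_trans (leq_addr N2 N1) hN)); apply: dhomogM.
Qed.

Lemma chart_map_inj (F : numClosedFieldType) i (vh b e be ga : 'I_3 -> F) N (Q : poly3 F) :
  affine_chart i vh b e be ga -> Q \is N.-homog -> chart_map vh b e Q = 0 -> Q = 0.
Proof.
move=> hc hQ Q0; have : 'X_i * Q = 0.
  apply: mpoly3_eq0 => x; rewrite mevalM mevalXU.
  have [->|xi] := eqVneq (x i) 0; first by rewrite mul0r.
  have E : x =1 (fun j => x i * (x j / x i)) by move=> j; rewrite mulrC divfK.
  rewrite (meval_eq _ E) (homog_eval _ _ hQ).
  pose y j := x j / x i; have yi : y i = 1 by rewrite /y divff.
  have Ey : y =1 (fun j => vh j + b j * (\sum_k be k * y k) + e j * (\sum_k ga k * y k)).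
    move=> j; have [_ key _ _] := hc.
    transitivity (\sum_k (j == k)%:R * y k).
      rewrite (bigD1 j) //= eqxx mul1r big1 ?addr0 // => k kj.
      by rewrite eq_sym (negPf kj) mul0r.
    under eq_bigr => k _ do rewrite key !mulrDl.
    rewrite !big_split /= !mulr_sumr; congr (_ + _ + _); try by apply: eq_bigr => k _; ring.
    rewrite (bigD1 i) //= eqxx mul1r yi mulr1 big1 ?addr0 // => k /negPf ->.
    by rewrite !mul0r.
  by rewrite (meval_eq _ Ey) -chart_map_eval Q0 !horner0 !mulr0.
by move/eqP; rewrite mulf_eq0 (negPf (X_neq0 F i)) /= => /eqP.
Qed.

(** Each linear form is prime, so it divides [Q] or [H]. If it divides [Q], one of its two copies
    cancels and the other moves to [H]. The removed factor [P] is constant in u, so [Q'] keeps the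
    u-degree of [Q]. *)
Lemma cancel_linforms (F : numClosedFieldType) (vh b e : 'I_3 -> F) (ls : seq (poly3 F)) (f Q H : poly3 F) :
  (forall l, l \in ls -> [/\ l \is 1.-homog, l != 0 & (size (chart_map vh b e l) <= 1)%N]) ->
  (\prod_(l <- ls) l) * f = Q * Q * H ->
  exists Q' H' P, [/\ f = Q' * Q' * H', Q = P * Q' & (size (chart_map vh b e P) <= 1)%N].
Proof.
elim: ls Q H => [|l ls IH] Q H hls.
  rewrite big_nil mul1r => ->; exists Q, H, 1; split=> //; first by rewrite mul1r.
  by rewrite -mpolyC1 chart_mapC size_polyC; case: eqP.
have [hl l0 sl] := hls l (mem_head _ _).
have {}IH := IH _ _ (fun l' (h : l' \in ls) => hls l' (mem_behead (s := l :: ls) h)).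
rewrite big_cons -mulrA => E.
have [] : ldvd l Q \/ ldvd l H.
  have [h|h] : ldvd l (Q * Q) \/ ldvd l H by apply: linear_prime => //; exists ((\prod_(l <- ls) l) * f).
    by left; have [] := linear_prime hl l0 h.
  by right.
- move=> [Q1 EQ]; have [|Q' [H' [P [h1 h2 h3]]]] := IH Q1 (l * H).
    by apply: (mulfI l0); rewrite E EQ; ring.
  exists Q', H', (l * P); split=> //; first by rewrite EQ h2 mulrA.
  rewrite chart_mapM; apply: leq_trans (size_polyMleq _ _) _.
  by rewrite -subn1 leq_subLR; apply: leq_add.
- by case=> H1 EH; apply: (IH Q H1); apply: (mulfI l0); rewrite E EH; ring.
Qed.

Definition square_free (F : numClosedFieldType) (f : poly3 F) : Prop :=
  f != 0 /\ forall g h : poly3 F, f = g * g * h -> (msize g <= 1)%N.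

Lemma deriv_neq0 (F : numClosedFieldType) (p : {poly {poly F}}) : (1 < size p)%N -> p^`() != 0.
Proof.
move=> sp; apply/eqP => /polyP /(_ (size p).-2); rewrite coef_deriv coef0.
have -> : (size p).-2.+1 = (size p).-1 by case: (size p) sp => [|[|]].
rewrite -lead_coefE => /eqP; rewrite -mulr_natr mulf_eq0 lead_coef_eq0 -size_poly_eq0.
by rewrite -polyC_natr polyC_eq0 pnatr_eq0; case: (size p) sp => [|[|]].
Qed.

(** Divisibility here is pseudo-divisibility, that is, division over F(w). The square divides [g]
    only after multiplication by a polynomial in w, which splits into factors [\w - a]. *)
Lemma not_separable_square (F : numClosedFieldType) (g : {poly {poly F}}) :
  g != 0 -> ~~ coprimep g g^`() ->
  exists (d k : {poly {poly F}}) (rs : seq F),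
    (1 < size d)%N /\ (\prod_(a <- rs) (\w - cst a)) * g = d * d * k.
Proof.
move=> g0 ncop.
have [d [sd dg]] : exists d : {poly {poly F}}, (1 < size d)%N /\ d * d %| g.
  apply: NNPP => h; case/negP: ncop.
  have : separable_poly g.
    apply/separable_polyP; split; last by move=> u _; apply: deriv_neq0.
    move=> u v uv; apply/negPn/negP => nc; apply: h; exists (gcdp u v).
    have dd : gcdp u v * gcdp u v %| g.
      by apply: dvdp_trans uv; apply: dvdp_mul; rewrite ?dvdp_gcdl ?dvdp_gcdr.
    split=> //; rewrite ltn_neqAle eq_sym [_ == _](negPf nc) size_poly_gt0.
    by apply: contraNneq g0 => d0; rewrite d0 mul0r dvd0p in dd.
  by rewrite unlock.
have /Pdiv.Idomain.dvdpP [[c k] /= c0 E] := dg.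
have [rs Ec] := closed_field_poly_normal c.
have lc : lead_coef c != 0 by rewrite lead_coef_eq0.
exists d, (cst (lead_coef c)^-1 * k), rs; split=> //.
have Ecp : c%:P = cst (lead_coef c) * \prod_(a <- rs) (\w - cst a).
  rewrite {1}Ec -mul_polyC polyCM rmorph_prod /=; congr (_ * _).
  by apply: eq_bigr => a _; rewrite polyCB.
rewrite mulrCA [d * d * k]mulrC -E -mul_polyC Ecp !mulrA -cstM mulVf //.
by rewrite cst1 mul1r.
Qed.

(** If [g] is coprime to its u-derivative over F(w), a Bezout relation puts a nonzero polynomial in
    w, that is a power of w times a unit, into the ideal. Otherwise [g] has a square factor of
    positive u-degree, and homogenising it contradicts square-freeness. *)
Lemma reduced_finite (F : numClosedFieldType) i (vh b e be ga : 'I_3 -> F) n (f : poly3 F) :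
  affine_chart i vh b e be ga -> f \is n.-homog -> square_free f ->
  exists M, loc2 (chart_map vh b e f) (chart_map vh b e f)^`() (\w ^+ M).
Proof.
move=> hc hf [f0 sqf]; set g := chart_map vh b e f.
have g0 : g != 0 by apply: contraNneq f0 => h; apply/eqP/(chart_map_inj hc hf h).
have [|ncop] := boolP (coprimep g g^`()).
  case/Bezout_coprimepP => [[u v] /= uv].
  have /size_poly1P [c c0 Ec] : size (u * g + v * g^`()) == 1%N by rewrite (eqp_size uv) size_poly1.
  have [M [h [Eh h0]]] := order_at0 c0.
  exists M, (h%:P), u, v; rewrite /at0 hornerC; split=> //.
  by rewrite Ec Eh -polyC_exp -polyCM mulrC.
have [d [k [rs [sd E]]]] := not_separable_square g0 ncop; exfalso.
have [Nd /(_ _ (leqnn _)) [Qd hQd EQd]] := homogenize hc d.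
have [Nk hNk] := homogenize hc k.
have [Qk hQk EQk] := hNk (Nk + (size rs + n))%N (leq_addr _ _).
pose ls1 : seq (poly3 F) := [seq linform ga - a%:MP * 'X_i | a <- rs].
(* The power of ['X_i] on the left and the enlarged degree of [Qk] on the right bring both sides to
   the same degree. *)
pose m := (Nd + Nd + Nk)%N.
pose ls := nseq m ('X_i : poly3 F) ++ ls1.
have hls l : l \in ls -> [/\ l \is 1.-homog, l != 0 & (size (chart_map vh b e l) <= 1)%N].
  rewrite mem_cat => /orP [/nseqP [-> _]|/mapP [a _ ->]].
    by rewrite X_homog X_neq0 (chart_map_Xi hc) size_poly1.
  have Ea : chart_map vh b e (linform ga - a%:MP * 'X_i) = \w - cst a.
    by rewrite chart_mapB (chart_map_w hc) chart_mapM chart_mapC (chart_map_Xi hc) mulr1.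
  split.
  - apply: rpredB; first exact: linform_homog.
    by rewrite mul_mpolyC; apply: dhomogZ; apply: X_homog.
  - apply/eqP => h; move: Ea; rewrite h -mpolyC0 chart_mapC cst0 => /eqP.
    by rewrite eq_sym /cst -polyCB polyC_eq0 polyXsubC_eq0.
  - by rewrite Ea /cst -polyCB size_polyC; case: eqP.
have Els : \prod_(l <- ls) l = 'X_i ^+ m * \prod_(a <- rs) (linform ga - a%:MP * 'X_i).
  by rewrite big_cat /= big_nseq iter_mulr_1 big_map.
have hprod : \prod_(a <- rs) (linform ga - a%:MP * 'X_i) \is (size rs).-homog.
  elim: (rs) => [|a r IH]; first by rewrite big_nil dhomog1.
  rewrite big_cons /= -[(size r).+1]add1n; apply: dhomogM => //.
  apply: rpredB; first exact: linform_homog.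
  by rewrite mul_mpolyC; apply: dhomogZ; apply: X_homog.
have Ef : (\prod_(l <- ls) l) * f = Qd * Qd * Qk.
  apply/eqP; rewrite -subr_eq0; apply/eqP.
  apply: (@chart_map_inj _ _ _ _ _ _ _ (Nd + Nd + (Nk + (size rs + n))) _ hc).
    apply: rpredB; last by apply: dhomogM => //; apply: dhomogM.
    have -> : (Nd + Nd + (Nk + (size rs + n)) = (m + size rs) + n)%N by rewrite /m; clear; lia.
    apply: dhomogM => //; rewrite Els; apply: dhomogM => //.
    by have := dhomogMn m (X_homog F i); rewrite mul1n.
  rewrite chart_mapB !chart_mapM EQd EQk -E Els chart_mapM chart_mapXn (chart_map_Xi hc) expr1n mul1r.
  rewrite {1}/chart_map rmorph_prod /= -/g; apply/eqP; rewrite subr_eq0; apply/eqP.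
  congr (_ * _); apply: eq_bigr => a _.
  by rewrite -/(chart_map vh b e _) chart_mapB (chart_map_w hc) chart_mapM chart_mapC (chart_map_Xi hc) mulr1.
have [Q' [H' [P [h1 h2 h3]]]] := cancel_linforms hls Ef.
have Ec := msize1_polyC (sqf _ _ h1).
move: sd; rewrite -EQd h2 chart_mapM Ec chart_mapC ltnNge; case/negP.
apply: leq_trans (size_polyMleq _ _) _.
rewrite -subn1 leq_subLR; apply: (leq_add h3).
by rewrite /cst size_polyC; case: eqP.
Qed.

(** * Restriction to a line *)

Definition line_poly (F : numClosedFieldType) (x y : 'I_3 -> F) (p : poly3 F) : {poly F} :=
  mmap (@polyC F) (fun j => (x j)%:P + (y j)%:P * 'X) p.

Lemma line_poly_eval (F : numClosedFieldType) (x y : 'I_3 -> F) (p : poly3 F) s :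
  (line_poly x y p).[s] = p.@[fun j => x j + y j * s].
Proof.
rewrite /line_poly; elim/mpoly3_ind: p.
- by move=> c; rewrite mmapC hornerC mevalC.
- by move=> j; rewrite mmapX mmap1U mevalXU !hornerE.
- by move=> p q IHp IHq; rewrite mmapD mevalD hornerD IHp IHq.
- by move=> p q IHp IHq; rewrite rmorphM mevalM hornerM IHp IHq.
Qed.

Lemma poly_eq_eval (F : numClosedFieldType) (p q : {poly F}) : (forall s, p.[s] = q.[s]) -> p = q.
Proof.
move=> h; apply/eqP; rewrite -subr_eq0; apply/negPn/negP => nz.
have : forall n, (n < size (p - q)%R)%N.
  move=> n; have := @max_poly_roots _ (p - q) [seq (i%:R : F) | i <- iota 0 n] nz.
  rewrite size_map size_iota; apply.
    by apply/allP => x _; rewrite /root !hornerE h subrr.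
  by rewrite map_inj_uniq ?iota_uniq // => i j /eqP; rewrite eqr_nat => /eqP.
by move=> /(_ (size (p - q)%R)); rewrite ltnn.
Qed.

Lemma size_line_poly (F : numClosedFieldType) (x y : 'I_3 -> F) (p : poly3 F) k :
  p \is k.-homog -> (size (line_poly x y p) <= k.+1)%N.
Proof.
move=> /dhomogP hp; rewrite /line_poly /mmap big_seq.
apply: (big_ind (fun q : {poly F} => size q <= k.+1)%N).
- by rewrite size_poly0.
- by move=> q r hq hr; apply: leq_trans (size_polyD _ _) _; rewrite geq_max hq.
- move=> m hm; have <- : mdeg m = k by apply: hp.
  rewrite mul_polyC; apply: leq_trans (size_scale_leq _ _) _.
  rewrite /mmap1 mdegE; apply: (big_ind2 (fun (q : {poly F}) (d : nat) => size q <= d.+1)%N).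
  + by rewrite size_poly1.
  + move=> q d r c hq hr; apply: leq_trans (size_polyMleq _ _) _.
    by rewrite -subn1 leq_subLR (leq_trans (leq_add hq hr)) // addSn addnS add1n.
  + move=> j _; elim: (m j) => [|a IH]; first by rewrite expr0 size_poly1.
    rewrite exprS; apply: leq_trans (size_polyMleq _ _) _.
    rewrite -subn1 leq_subLR; apply: leq_trans (leq_add (n1 := 2) _ IH) _; last by rewrite add1n addSn add1n.
    apply: leq_trans (size_polyD _ _) _; rewrite geq_max (leq_trans (size_polyC_leq1 _)) //=.
    by rewrite mul_polyC; apply: leq_trans (size_scale_leq _ _) _; rewrite size_polyX.
Qed.

Lemma line_poly_homog (F : numClosedFieldType) (x y : 'I_3 -> F) (p : poly3 F) k (c t : F) :
  p \is k.-homog ->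
  p.@[fun j => c * x j + t * y j] = \sum_(j < k.+1) (line_poly x y p)`_j * c ^+ (k - j) * t ^+ j.
Proof.
move=> hp.
pose A := line_poly (fun j => t * y j) x p.
pose A' : {poly F} := \sum_(j < k.+1) ((line_poly x y p)`_j * t ^+ j) *: 'X^(k - j).
have E : A = A'.
  (* The factor ['X] takes care of s = 0, where homogeneity cannot be used by dividing by s. *)
  have : 'X * (A - A') = 0.
    apply: poly_eq_eval => s; rewrite hornerM hornerX horner0.
    have [->|s0] := eqVneq s 0; first by rewrite mul0r.
    rewrite hornerD hornerN /A line_poly_eval.
    have E : (fun j => t * y j + x j * s) =1 (fun j => s * (x j + y j * (t / s))).
      by move=> j; field.
    rewrite (meval_eq _ E) (homog_eval _ _ hp) -line_poly_eval.
    rewrite (horner_coef_wide _ (size_line_poly x y hp)) mulr_sumr /A' horner_sum -sumrB big1 ?mulr0 // => j _.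
    have jk : (j <= k)%N by rewrite -ltnS.
    rewrite hornerZ hornerXn -{1}(subnK jk) exprD expr_div_n; field.
    by rewrite expf_neq0.
  by move/eqP; rewrite mulf_eq0 polyX_eq0 subr_eq0 => /eqP.
have E2 : (fun j => c * x j + t * y j) =1 (fun j => t * y j + x j * c) by move=> j; ring.
rewrite (meval_eq _ E2) -line_poly_eval -/A E /A' horner_sum; apply: eq_bigr => j _.
by rewrite hornerZ hornerXn mulrAC.
Qed.

Lemma line_poly_lead (F : numClosedFieldType) (x y : 'I_3 -> F) (p : poly3 F) k :
  p \is k.-homog -> (line_poly x y p)`_k = p.@[y].
Proof.
move=> hp; have := line_poly_homog x y 0 1 hp.
have E : (fun j => 0 * x j + 1 * y j) =1 y by move=> j; rewrite mul0r add0r mul1r.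
rewrite (meval_eq _ E) => ->; rewrite big_ord_recr /= subnn expr0 expr1n !mulr1 big1 ?add0r // => j _.
by rewrite expr0n subn_eq0 leqNgt ltn_ord /= mulr0 mul0r.
Qed.

Lemma line_poly_chart (F : numClosedFieldType) (x y : 'I_3 -> F) i (p : poly3 F) k a h :
  p \is k.-homog -> x i != 0 -> line_poly x y p = 'X^a * h -> h.[0] != 0 ->
  exists h', line_poly (fun j => x j / x i) (fun j => y j - y i * (x j / x i)) p = 'X^a * h' /\ h'.[0] != 0.
Proof.
move=> hp xi E h0.
have hn0 : h != 0 by apply: contraNneq h0 => ->; rewrite horner0.
have sz : (a + size h <= k.+1)%N.
  have := size_line_poly x y hp; by rewrite E size_monicM ?monicXn // size_polyXn.
have ak : (a <= k)%N.
  by rewrite -ltnS; apply: leq_trans sz; rewrite -addn1 leq_add2l size_poly_gt0.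
pose c : {poly F} := (x i)^-1%:P - (y i / x i)%:P * 'X.
pose h' : {poly F} := \sum_(j < (k - a).+1) h`_j *: (c ^+ (k - a - j) * 'X^j).
exists h'; split; last first.
  rewrite /h' big_ord_recl hornerD hornerZ /= expr0 mulr1 subn0 horner_exp horner_sum big1 ?addr0.
    rewrite mulf_neq0 //; first by rewrite -horner_coef0.
    by rewrite expf_neq0 // /c hornerD hornerN hornerM !hornerC hornerX mulr0 subr0 invr_eq0.
  by move=> j _; rewrite hornerZ hornerM hornerXn expr0n /= !mulr0.
apply: poly_eq_eval => u; rewrite line_poly_eval.
have E2 : (fun j => x j / x i + (y j - y i * (x j / x i)) * u) =1 (fun j => c.[u] * x j + u * y j).
  by move=> j; rewrite /c hornerD hornerN hornerM !hornerC hornerX; field.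
rewrite (meval_eq _ E2) (line_poly_homog _ _ _ _ hp) E hornerM hornerXn /h' horner_sum mulr_sumr.
have -> : k.+1 = (a + (k - a).+1)%N by rewrite addnS subnKC.
rewrite big_split_ord /= big1 ?add0r => [|j _]; last by rewrite coefXnM ltn_ord !mul0r.
apply: eq_bigr => j _; rewrite coefXnM ltnNge leq_addr /= addKn hornerZ hornerM hornerXn horner_exp.
by rewrite exprD subnDA; ring.
Qed.

Lemma map0_chart_map (F : numClosedFieldType) (vh b e : 'I_3 -> F) (p : poly3 F) :
  map0 (chart_map vh b e p) = line_poly vh b p.
Proof.
rewrite /line_poly; elim/mpoly3_ind: p.
- by move=> c; rewrite chart_mapC mmapC /cst map_polyC /= horner_evalE hornerC.
- move=> j; rewrite chart_mapX mmapX mmap1U !rmorphD !rmorphM /= map0_w mulr0 addr0 map_polyX.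
  by rewrite /cst !map_polyC /= !horner_evalE !hornerC.
- by move=> p q IHp IHq; rewrite chart_mapD mmapD rmorphD /= IHp IHq.
- by move=> p q IHp IHq; rewrite chart_mapM !rmorphM /= IHp IHq.
Qed.

(** Subtracting [th i] times the Euler field makes the derivation tangent to the plane x_i = 1. The
    Euler formula turns the subtracted term into the right-hand side. *)
Lemma chart_log_derivation (F : numClosedFieldType) i (vh b e be ga : 'I_3 -> F) n (f : poly3 F) (th : 'I_3 -> poly3 F) :
  affine_chart i vh b e be ga -> f \is n.-homog -> \sum_k th k * mderiv k f = 0 ->
  let phi := chart_map vh b e in
  (phi (\sum_k (be k)%:MP * th k) - phi (th i) * 'X) * (phi f)^`() +
  (phi (\sum_k (ga k)%:MP * th k) - phi (th i) * \w) * dw (phi f) = - (n%:R * phi (th i)) * phi f.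
Proof.
move=> hc hf hth phi; have [du dwE] := chart_map_deriv vh b e f.
have hphi a : phi (\sum_k (a k)%:MP * th k) = \sum_k cst (a k) * phi (th k).
  by rewrite /phi chart_map_sum; apply: eq_bigr => k _; rewrite chart_mapM chart_mapC.
have hu : 'X = \sum_k cst (be k) * phi 'X_k.
  by rewrite -(chart_map_u hc) /linform chart_map_sum; apply: eq_bigr => k _; rewrite chart_mapM chart_mapC.
have hw : \w = \sum_k cst (ga k) * phi 'X_k.
  by rewrite -(chart_map_w hc) /linform chart_map_sum; apply: eq_bigr => k _; rewrite chart_mapM chart_mapC.
pose V k := phi (th k) - phi 'X_k * phi (th i).
have Vi : V i = 0 by rewrite /V /phi (chart_map_Xi hc) mul1r subrr.
have VE a : phi (\sum_k (a k)%:MP * th k) - phi (th i) * (\sum_k cst (a k) * phi 'X_k) = \sum_k cst (a k) * V k.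
  by rewrite hphi mulr_sumr -sumrB; apply: eq_bigr => k _; rewrite /V; ring.
rewrite {1}hu {1}hw !VE -/phi /phi du dwE -/phi.
have key j : (\sum_k cst (be k) * V k) * cst (b j) + (\sum_k cst (ga k) * V k) * cst (e j) = V j.
  have [_ key _ _] := hc.
  transitivity (\sum_k (cst (j == k)%:R - cst ((k == i)%:R * vh j)) * V k).
    rewrite !mulr_suml -big_split /=; apply: eq_bigr => k _.
    by rewrite key !cstD !cstM; ring.
  under eq_bigr => k _ do rewrite mulrBl; rewrite sumrB.
  rewrite (bigD1 j) //= eqxx cst1 mul1r big1 ?addr0 => [|k /negPf kj]; last by rewrite eq_sym kj cst0 mul0r.
  rewrite big1 ?subr0 // => k _; have [->|_] := eqVneq k i; first by rewrite Vi mulr0.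
  by rewrite mul0r cst0 mul0r.
transitivity (\sum_j phi (mderiv j f) * V j).
  rewrite !mulr_sumr -big_split /=; apply: eq_bigr => j _.
  by rewrite -[in RHS]key; ring.
have eul := euler_homog hf.
transitivity (phi (\sum_k th k * mderiv k f) - phi (th i) * phi (\sum_k 'X_k * mderiv k f)).
  rewrite /phi !chart_map_sum mulr_sumr -sumrB; apply: eq_bigr => k _.
  by rewrite !chart_mapM /V /phi; ring.
rewrite hth eul /phi chart_mapM -[n%:R](mpolyC_nat 3 F n) chart_mapC.
have -> : chart_map vh b e 0 = 0 by rewrite -mpolyC0 chart_mapC cst0.
by rewrite /cst !polyC_natr; ring.
Qed.

Lemma linform_lcoef (F : numClosedFieldType) (l : poly3 F) : l \is 1.-homog -> linform (lcoef l) = l.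
Proof. by move/linformE => {2}->. Qed.

(** The final inequality reads o >= a - 1 - eps_p, rearranged to avoid subtraction. The transverse
    component of the derivation restricts to [T] on L, so the o of [local_tjurina] is the order of
    [T]. *)
Lemma point_inequality (F : numClosedFieldType) (f l : poly3 F) (th : 'I_3 -> poly3 F) (v B : 'I_3 -> F)
    n m a h o k :
  let i := chart_index v in
  let T := \sum_j (lcoef l j)%:MP * th j in
  f \is n.-homog -> square_free f -> l \is 1.-homog -> l != 0 ->
  v i != 0 -> l.@[v] = 0 -> l.@[B] = 0 -> (exists j, B j != B i * (v j / v i)) ->
  \sum_j th j * mderiv j f = 0 -> T \is m.-homog ->
  line_poly v B f = 'X^a * h -> h.[0] != 0 -> (0 < a)%N ->
  line_poly v B T = 'X^o * k -> k.[0] != 0 ->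
  exists mu mu' tau tau', [/\ is_length (milnor_gens f v) v mu, is_length (tjurina_gens f v) v tau,
    is_length (milnor_gens (f * l) v) v mu', is_length (tjurina_gens (f * l) v) v tau' &
    (a + mu + tau' <= mu' + tau + o.+1)%N].
Proof.
move=> i T hf sf hl l0 vi lv lB hB hth hT Ef h0 a0 ET k0.
have lvh : l.@[fun j => v j / v i] = 0.
  rewrite (linform_eval _ hl); under eq_bigr => j _ do rewrite mulrA.
  by rewrite -mulr_suml -(linform_eval _ hl) lv mul0r.
have [|e [be hc]] := @affine_chart_exists _ l i (fun j => v j / v i) B hl l0 _ lvh lB hB.
  by rewrite divff.
set b := (fun j => B j - B i * (v j / v i)) in hc.
pose vh := fun j => v j / v i; rewrite -/vh in hc.
pose g := chart_map vh b e f.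
have [h' [Eg h'0]] := line_poly_chart hf vi Ef h0.
have eg : map0 g = 'X^a * h' by rewrite map0_chart_map.
have [M hM] := reduced_finite hc hf sf.
have [k' [Ek k'0]] := line_poly_chart hT vi ET k0.
have log := chart_log_derivation hc hf hth; rewrite /= -/g in log.
have ex : map0 (chart_map vh b e T - chart_map vh b e (th i) * \w) = 'X^o * k'.
  by rewrite rmorphB rmorphM /= map0_w mulr0 subr0 map0_chart_map.
have [mu [N1 [c1 c2 w1 w2]]] := local_milnor eg h'0 a0 hM.
have [tau [tau' [N2 [c3 c4 le w3 w4]]]] := local_tjurina eg h'0 a0 hM log ex k'0.
have Efl : chart_map vh b e (f * l) = \w * g.
  by rewrite chart_mapM -[in X in _ * X](linform_lcoef hl) (chart_map_w hc) mulrC.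
have [Eu Ew] := loc2_w_deriv g.
have eb : map0 (dw (\w * g)) = 'X^a * h' by rewrite Ew map0_add_w.
have [r Er] : exists r, a = r.+1 by exists a.-1; rewrite prednK.
have [h2 [ea h20]] : exists h2, map0 g^`() = 'X^r * h2 /\ h2.[0] != 0.
  by apply: map0_deriv_order h'0; rewrite eg Er.
exists mu, (mu + a.*2.-1)%N, tau, tau'; split.
- apply: (milnor_length hc) c1.
  exact: (primary_of_order (loc2_ideal _ _) (@loc2_sat _ _ _) (loc2l _ _) ea h20 w1).
- apply: (tjurina_length hc) c3.
  exact: (primary_of_order (loc3_ideal _ _ _) (@loc3_sat _ _ _ _) (loc31 _ _ _) eg h'0 w3).
- apply: (milnor_length hc); rewrite -/i -/vh Efl //.
  exact: (primary_of_order (loc2_ideal _ _) (@loc2_sat _ _ _) (loc2r _ _) eb h'0 w2).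
- apply: (tjurina_length hc); rewrite -/i -/vh Efl //.
  exact: (primary_of_order (loc3_ideal _ _ _) (@loc3_sat _ _ _ _) (loc33 _ _ _) eb h'0 w4).
- by clear -le a0; lia.
Qed.

Lemma sum_mup_le (F : fieldType) (zs : seq F) (Q : {poly F}) :
  uniq zs -> Q != 0 -> (\sum_(z <- zs) mup z Q < size Q)%N.
Proof.
elim: zs Q => [|z zs IH] Q; first by rewrite big_nil size_poly_gt0.
move=> /= /andP [zn uz] Q0; rewrite big_cons.
have [m [R]] := multiplicity_XsubC Q z; rewrite Q0 /= => Rz EQ.
have R0 : R != 0 by apply: contraNneq Rz => ->; rewrite root0.
have -> : mup z Q = m by rewrite EQ mupMr // mup_XsubCX eqxx.
have -> : \sum_(y <- zs) mup y Q = \sum_(y <- zs) mup y R.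
  rewrite big_seq [RHS]big_seq; apply: eq_bigr => y yz.
  rewrite EQ mupMl // /root horner_exp hornerXsubC expf_neq0 // subr_eq0.
  by apply: contraNneq zn => <-.
rewrite EQ size_Mmonic ?monic_exp ?monicXsubC // size_exp_XsubC addnS /= addnC ltn_add2r.
exact: IH.
Qed.

Lemma sum_mup_ge (F : closedFieldType) (zs : seq F) (Q : {poly F}) :
  Q != 0 -> (forall z, root Q z -> z \in zs) -> uniq zs -> (size Q <= (\sum_(z <- zs) mup z Q).+1)%N.
Proof.
elim: zs Q => [|z zs IH] Q Q0 hz.
  by rewrite big_nil leqNgt => _; apply/negP => s1; have /closed_rootP [z /hz] : size Q != 1%N by rewrite gtn_eqF.
move=> /= /andP [zn uz]; rewrite big_cons.
have [m [R]] := multiplicity_XsubC Q z; rewrite Q0 /= => Rz EQ.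
have R0 : R != 0 by apply: contraNneq Rz => ->; rewrite root0.
have -> : mup z Q = m by rewrite EQ mupMr // mup_XsubCX eqxx.
have -> : \sum_(y <- zs) mup y Q = \sum_(y <- zs) mup y R.
  rewrite big_seq [RHS]big_seq; apply: eq_bigr => y yz.
  rewrite EQ mupMl // /root horner_exp hornerXsubC expf_neq0 // subr_eq0.
  by apply: contraNneq zn => <-.
rewrite EQ size_Mmonic ?monic_exp ?monicXsubC // size_exp_XsubC addnS /= addnC -addnS leq_add2l.
apply: IH => // y Ry; have : y \in z :: zs by apply: hz; rewrite EQ rootM Ry.
by rewrite inE => /orP [/eqP yz|//]; rewrite yz (negPf Rz) in Ry.
Qed.

(** Compares the order in a parameter centred at [v] with a root multiplicity in the one parameter
    used for all of L: the two differ by an affine change. *)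
Lemma line_poly_at_root (F : numClosedFieldType) (A B v : 'I_3 -> F) (p : poly3 F) k c z :
  p \is k.-homog -> c != 0 -> (forall j, v j = c * (A j + z * B j)) -> line_poly A B p != 0 ->
  exists h, line_poly v B p = 'X^(mup z (line_poly A B p)) * h /\ h.[0] != 0.
Proof.
move=> hp c0 Ev P0; set P := line_poly A B p in P0 *.
have E : line_poly v B p = (c ^+ k) *: (P \Po (z%:P + c^-1%:P * 'X)).
  apply: poly_eq_eval => s; rewrite line_poly_eval hornerZ horner_comp.
  rewrite hornerD hornerM !hornerC hornerX /P line_poly_eval -(homog_eval _ _ hp).
  by apply: meval_eq => j; rewrite Ev; field.
have [m [R]] := multiplicity_XsubC P z; rewrite P0 /= => Rz EP.
have -> : mup z P = m by rewrite EP mupMr // mup_XsubCX eqxx.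
exists ((c ^+ k * c^-1 ^+ m) *: (R \Po (z%:P + c^-1%:P * 'X))); split; last first.
  rewrite hornerZ horner_comp hornerD hornerM !hornerC hornerX mulr0 addr0.
  by rewrite !mulf_neq0 ?expf_neq0 ?invr_eq0.
rewrite E EP comp_polyM rmorphXn /= rmorphB /= comp_polyX comp_polyC [z%:P + _]addrC addrK.
rewrite exprMn -polyC_exp -!mul_polyC polyCM; ring.
Qed.

Lemma plane_basis (F : numClosedFieldType) (l : poly3 F) (B : 'I_3 -> F) :
  l \is 1.-homog -> l != 0 -> l.@[B] = 0 -> (exists j, B j != 0) ->
  exists A : 'I_3 -> F, [/\ l.@[A] = 0,
    (forall x, l.@[x] = 0 -> exists s t, forall j, x j = s * A j + t * B j) &
    (forall s t, (forall j, s * A j + t * B j = 0) -> s = 0)].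
Proof.
move=> hl l0 lB [j0 hj0]; have [i li] := linform_neq0 hl l0.
have lE (x : 'I_3 -> F) : l.@[x] = lcoef l i * x i + \sum_(k < 2) lcoef l (lift i k) * x (lift i k).
  by rewrite (linform_eval _ hl) (bigD1_ord i).
have key (j k : 'I_2) : j != k -> B (lift i j) != 0 -> exists A : 'I_3 -> F, [/\ l.@[A] = 0,
    (forall x, l.@[x] = 0 -> exists s t, forall j, x j = s * A j + t * B j) &
    (forall s t, (forall j, s * A j + t * B j = 0) -> s = 0)].
  move=> jk Bj.
  pose A p := if unlift i p is Some q then (if q == k then 1 else 0) else - (lcoef l (lift i k) / lcoef l i).
  have Ai : A i = - (lcoef l (lift i k) / lcoef l i) by rewrite /A unlift_none.
  have Al q : A (lift i q) = (q == k)%:R by rewrite /A liftK; case: eqP.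
  have lA : l.@[A] = 0.
    rewrite lE Ai (bigD1 k) //= Al eqxx mulr1 big1 ?addr0 => [|q /negPf qk]; last by rewrite Al qk mulr0.
    by field.
  have two (q : 'I_2) : q = j \/ q = k.
    by clear -jk; case: q j k jk => [[|[|//]] hq] [[|[|//]] hj] [[|[|//]] hk]; rewrite // => _;
      ((left; exact: val_inj) || (right; exact: val_inj)).
  exists A; split=> //.
    move=> x lx; pose t := x (lift i j) / B (lift i j); pose s := x (lift i k) - t * B (lift i k).
    exists s, t.
    have hlift q : x (lift i q) = s * A (lift i q) + t * B (lift i q).
      rewrite Al; have [->|->] := two q; first by rewrite (negPf jk) mulr0 add0r /t divfK.
      by rewrite eqxx mulr1 /s subrK.
    move=> p; case: (unliftP i p) => [q ->|->]; [exact: hlift | apply: (mulfI li)].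
    have -> : lcoef l i * x i = - \sum_(q < 2) lcoef l (lift i q) * x (lift i q).
      by apply/eqP; rewrite -addr_eq0 -lE lx.
    have -> : lcoef l i * (s * A i + t * B i) = s * (lcoef l i * A i) + t * (lcoef l i * B i) by ring.
    have hh (y : 'I_3 -> F) : l.@[y] = 0 -> lcoef l i * y i = - \sum_(q < 2) lcoef l (lift i q) * y (lift i q).
      by move=> ly; apply/eqP; rewrite -addr_eq0 -lE ly.
    rewrite !hh // !mulrN !mulr_sumr -opprD -big_split /=; congr (- _); apply: eq_bigr => q _.
    by rewrite hlift; ring.
  move=> s t h; have := h (lift i j); rewrite Al (negPf jk) mulr0 add0r => /eqP.
  rewrite mulf_eq0 (negPf Bj) orbF => /eqP t0; have := h (lift i k).
  by rewrite Al eqxx mulr1 t0 mul0r addr0.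
have [hB|hB] := boolP (B (lift i ord0) != 0); first by apply: (key ord0 ord_max).
apply: (key ord_max ord0) => //; apply: contraNneq hj0 => hB1.
move: hB; rewrite negbK => /eqP hB.
have Bl q : B (lift i q) = 0.
  by case: q => [[|[|//]] hq]; [rewrite -[RHS]hB | rewrite -[RHS]hB1]; congr (B (lift i _)); apply: val_inj.
case: (unliftP i j0) => [q ->|->]; first by rewrite Bl.
move: lB; rewrite lE big1 ?addr0 => [/eqP|q _]; last by rewrite Bl mulr0.
by rewrite mulf_eq0 (negPf li).
Qed.

(** * Counting orders along the line *)

Lemma ler_sum_In (T : Type) (pts : seq T) (f g : T -> int) :
  (forall v, List.In v pts -> f v <= g v) -> \sum_(v <- pts) f v <= \sum_(v <- pts) g v.
Proof.
elim: pts => [|v pts IH] h; first by rewrite !big_nil.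
by rewrite !big_cons; apply: lerD; [apply: h; left | apply: IH => w hw; apply: h; right].
Qed.

Lemma nth_In (T : Type) (x0 : T) (pts : seq T) i : (i < size pts)%N -> List.In (nth x0 pts i) pts.
Proof.
elim: pts i => [|v pts IH] [|i] //= hi; first by left.
by right; apply: IH.
Qed.

Lemma In_nth (T : Type) (x0 v : T) (pts : seq T) : List.In v pts ->
  exists2 i, (i < size pts)%N & nth x0 pts i = v.
Proof.
elim: pts => [//|w pts IH] [->|/IH [i hi E]]; first by exists 0%N.
by exists i.+1.
Qed.

(** A nonzero restriction of [T] to L would have at least [n - size pts - sum eps = d] zeros, while
    its degree in the affine parameter is below d. *)
Lemma restriction_dvd (F : numClosedFieldType) (f l T : poly3 F) n k (d : nat) (B : 'I_3 -> F)
    (pts : seq ('I_3 -> F)) (eps : ('I_3 -> F) -> int) :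
  f \is n.-homog -> (0 < n)%N -> l \is 1.-homog -> l != 0 -> l.@[B] = 0 -> f.@[B] != 0 ->
  T \is k.-homog ->
  (forall v, List.In v pts -> [/\ exists i, v i != 0, f.@[v] = 0 & l.@[v] = 0]) ->
  (forall i j, (i < j < size pts)%N -> ~ exists c : F, c != 0 /\
     forall t, nth (fun=> 0) pts j t = c * nth (fun=> 0) pts i t) ->
  (forall w : 'I_3 -> F, (exists i, w i != 0) -> f.@[w] = 0 -> l.@[w] = 0 ->
     exists2 v, List.In v pts & exists c : F, c != 0 /\ forall t, w t = c * v t) ->
  (forall v a h o h', List.In v pts -> line_poly v B f = 'X^a * h -> h.[0] != 0 ->
     line_poly v B T = 'X^o * h' -> h'.[0] != 0 -> a%:Z - 1 - o%:Z <= eps v) ->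
  d%:Z = n%:Z - (size pts)%:Z - \sum_(v <- pts) eps v ->
  (k < d)%N \/ (k = d /\ T.@[B] = 0) -> ldvd l T.
Proof.
move=> hf n0 hl l0 lB fB hT hin hpr hall heps Ed hk.
have B0 : exists j, B j != 0.
  apply: NNPP => h; case/eqP: fB.
  have E : B =1 (fun j => 0 * B j).
    by move=> j; rewrite mul0r; apply/eqP/negPn/negP => Bj; apply: h; exists j.
  by rewrite (meval_eq _ E) (homog_eval _ _ hf) expr0n (gtn_eqF n0) mul0r.
have [A [lA span ind]] := plane_basis hl l0 lB B0.
pose P := line_poly A B f; pose Q := line_poly A B T.
(* The point [B] is at infinity for the parametrisation A + sB; as it is off the curve, [P] has full
   degree n and no intersection point is lost. *)
have Pn : P`_n = f.@[B] := line_poly_lead A B hf.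
have P0 : P != 0 by apply: contraNneq fB => P0; rewrite -Pn P0 coef0.
have sP : size P = n.+1.
  apply/eqP; rewrite eqn_leq (size_line_poly A B hf) ltnNge; apply/negP => h.
  by case/eqP: fB; rewrite -Pn nth_default.
have [Q0|Q0] := eqVneq Q 0.
  apply: ldvd_vanish => // x /span [s [t Ex]].
  rewrite (meval_eq _ Ex) (line_poly_homog _ _ _ _ hT) -/Q Q0 big1 // => j _.
  by rewrite coef0 !mul0r.
(* In degree d the leading coefficient is the value at [B], which is assumed to vanish. *)
have sQ : (size Q <= d)%N.
  case: hk => [kd|[kd TB]]; first by apply: leq_trans (size_line_poly A B hT) _.
  apply/leq_sizeP => j dj; have [->|jd] := eqVneq j d; first by rewrite -kd line_poly_lead.
  rewrite nth_default //; apply: leq_trans (size_line_poly A B hT) _.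
  by rewrite kd ltn_neqAle eq_sym jd.
pose on v z := exists c : F, c != 0 /\ forall j, v j = c * (A j + z * B j).
have onP v : List.In v pts -> exists z, on v z.
  move=> /hin [[i vi] fv lv]; have [s [t E]] := span _ lv.
  have s0 : s != 0.
    apply/eqP => s0; move: fv.
    have E' : v =1 (fun j => t * B j) by move=> j; rewrite E s0 mul0r add0r.
    rewrite (meval_eq _ E') (homog_eval _ _ hf) => /eqP; rewrite mulf_eq0 (negPf fB) orbF expf_eq0.
    by case/andP => _ /eqP t0; rewrite E s0 t0 !mul0r addr0 eqxx in vi.
  by exists (t / s), s; split=> // j; rewrite E; field.
pose zf v := epsilon (inhabits (0 : F)) (on v).
have zfP v : List.In v pts -> on v (zf v) by move=> /onP h; apply: epsilon_spec.
pose zs := map zf pts.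
have uzs : uniq zs.
  have H i j : (i < j < size pts)%N -> nth 0 zs i <> nth 0 zs j.
    move=> ij E; apply: (hpr i j ij); have /andP [lij lj] := ij.
    have li := ltn_trans lij lj; rewrite !(nth_map (fun=> 0)) // in E.
    have [c [c0 Ec]] := zfP _ (nth_In (fun=> 0) li).
    have [c' [c0' Ec']] := zfP _ (nth_In (fun=> 0) lj).
    exists (c' / c); split; first by rewrite mulf_neq0 ?invr_eq0.
    by move=> t; rewrite Ec Ec' E; field.
  apply/(uniqP 0) => i j; rewrite !inE !size_map => hi hj E.
  case: (ltngtP i j) => // ij; last by case: (H j i); rewrite ?ij.
  by case: (H i j); rewrite ?ij.
have rzs z : root P z -> z \in zs.
  rewrite /root /P line_poly_eval => /eqP fz.
  pose w j := A j + B j * z.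
  have w0 : exists i, w i != 0.
    apply: NNPP => h; have : (1 : F) = 0.
      apply: (ind 1 z) => j; rewrite mul1r mulrC; apply/eqP/negPn/negP => hj; apply: h; by exists j.
    by move/eqP; rewrite oner_eq0.
  have lw : l.@[w] = 0.
    rewrite (linform_eval _ hl) /w; under eq_bigr => j _ do rewrite mulrDr mulrA.
    by rewrite big_split /= -mulr_suml -!(linform_eval _ hl) lA lB mul0r addr0.
  have [v hv [c [c0 Ew]]] := hall w w0 fz lw.
  have [c' [c0' Ev]] := zfP v hv.
  have E1 j : (1 - c * c') * A j + (z - c * c' * zf v) * B j = 0.
    have := Ew j; rewrite Ev /w => E.
    have -> : (1 - c * c') * A j + (z - c * c' * zf v) * B j = (A j + B j * z) - c * (c' * (A j + zf v * B j)) by ring.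
    by rewrite E subrr.
  have cc : c * c' = 1.
    by apply/esym/eqP; rewrite -subr_eq0; apply/eqP; apply: ind E1.
  have -> : z = zf v.
    have [j Bj] := B0; have := E1 j; rewrite cc subrr mul0r add0r mul1r => /eqP.
    by rewrite mulf_eq0 (negPf Bj) orbF subr_eq0 => /eqP.
  have [i hi <-] := In_nth (fun=> 0) hv.
  by rewrite -(nth_map _ 0) // mem_nth // size_map.
have le1 := sum_mup_le uzs Q0.
have le2 := sum_mup_ge P0 rzs uzs.
have le3 : \sum_(v <- pts) ((mup (zf v) P)%:Z - 1 - (mup (zf v) Q)%:Z) <= \sum_(v <- pts) eps v.
  apply: ler_sum_In => v hv; have [c [c0 Ev]] := zfP v hv.
  have [h [E1 h0]] := line_poly_at_root hf c0 Ev P0.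
  have [h' [E2 h0']] := line_poly_at_root hT c0 Ev Q0.
  exact: (heps v _ _ _ _ hv E1 h0 E2 h0').
have Esum (g : F -> nat) : \sum_(v <- pts) (g (zf v))%:Z = (\sum_(z <- zs) g z)%N%:Z.
  by rewrite big_map (big_morph Posz PoszD (erefl (Posz 0))).
move: le3; rewrite !sumrB (Esum (fun z => mup z P)) (Esum (fun z => mup z Q)).
have -> : \sum_(v <- pts) (1 : int) = (size pts)%:Z.
  by rewrite big_const_seq count_predT iter_addr_0 natz.
rewrite sP in le2; move: le1 le2 sQ Ed.
move: (\sum_(z <- zs) mup z P)%N (\sum_(z <- zs) mup z Q)%N (\sum_(v <- pts) eps v) (size Q) (size pts).
by clear=> p q ep sq sp; lia.
Qed.

(** * Modules of derivations *)

Definition dapp (F : numClosedFieldType) (th : 'I_3 -> poly3 F) (g : poly3 F) : poly3 F :=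
  \sum_(i < 3) th i * mderiv i g.

Lemma dapp_comb2 (F : numClosedFieldType) (a b g : poly3 F) (x y : 'I_3 -> poly3 F) :
  dapp (fun i => a * x i + b * y i) g = a * dapp x g + b * dapp y g.
Proof. by rewrite /dapp !mulr_sumr -big_split; apply: eq_bigr => i _ /=; ring. Qed.

Lemma dapp_comb3 (F : numClosedFieldType) (a b c g : poly3 F) (x y z : 'I_3 -> poly3 F) :
  dapp (fun i => a * x i + b * y i + c * z i) g = a * dapp x g + b * dapp y g + c * dapp z g.
Proof. by rewrite /dapp !mulr_sumr -!big_split; apply: eq_bigr => i _ /=; ring. Qed.

Lemma eq_dapp (F : numClosedFieldType) (g : poly3 F) (x y : 'I_3 -> poly3 F) :
  x =1 y -> dapp x g = dapp y g.
Proof. by move=> E; apply: eq_bigr => i _; rewrite E. Qed.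

Lemma dappM (F : numClosedFieldType) (g h : poly3 F) (x : 'I_3 -> poly3 F) :
  dapp x (g * h) = dapp x g * h + g * dapp x h.
Proof.
rewrite /dapp mulr_suml mulr_sumr -big_split; apply: eq_bigr => i _ /=.
by rewrite mderivM; ring.
Qed.

Lemma dapp_euler (F : numClosedFieldType) (g : poly3 F) n : g \is n.-homog ->
  dapp (fun i => 'X_i) g = n%:R * g.
Proof. exact: euler_homog. Qed.

Lemma natr_mpoly_neq0 (F : numClosedFieldType) n : (0 < n)%N -> (n%:R : poly3 F) != 0.
Proof. by move=> n0; rewrite -mpolyC_nat mpolyC_eq0 pnatr_eq0 -lt0n. Qed.

Lemma mderiv_homog (F : numClosedFieldType) (g : poly3 F) n i : g \is n.-homog -> mderiv i g \is n.-1.-homog.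
Proof.
move=> hg; apply/dhomogP => m; rewrite mcoeff_msupp mcoeff_mderiv => hm.
have hm' : (m + U_(i))%MM \in msupp g by rewrite mcoeff_msupp; apply: contraNneq hm => ->; rewrite mul0rn.
have /dhomogP /(_ _ hm') := hg; rewrite /= mdegD mdeg1 => <-.
by rewrite addn1.
Qed.

Lemma dapp_homog (F : numClosedFieldType) (g : poly3 F) (x : 'I_3 -> poly3 F) n k :
  g \is n.-homog -> (forall i, x i \is k.-homog) -> dapp x g \is (k + n.-1).-homog.
Proof. by move=> hg hx; apply: rpred_sum => i _; apply: dhomogM => //; apply: mderiv_homog. Qed.

Lemma homog_eval0 (F : numClosedFieldType) (p : poly3 F) k : p \is k.-homog -> (0 < k)%N ->
  p.@[fun=> 0] = 0.
Proof.
move=> hp k0; have E : (fun=> 0) =1 (fun j : 'I_3 => 0 * (0 : F)) by move=> j; rewrite mul0r.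
by rewrite (meval_eq _ E) (homog_eval _ (fun=> 0) hp) expr0n (gtn_eqF k0) mul0r.
Qed.

Lemma homog0E (F : numClosedFieldType) (p : poly3 F) : p \is 0.-homog -> exists c : F, p = c%:MP.
Proof.
move=> /dhomogP hp; exists p@_0; apply/mpolyP => m; rewrite mcoeffC.
have [->|m0] := eqVneq m 0%MM; first by rewrite mulr1.
rewrite mulr0; apply/eqP/negPn/negP => pm.
have := hp m; rewrite mcoeff_msupp => /(_ pm) /= /eqP.
by rewrite mdeg_eq0 (negPf m0).
Qed.

(** A presentation of D_0(f) by three generators whose syzygies are the multiples of [(p, q, r)];
    the Euler field has been split off. *)
Definition presents (F : numClosedFieldType) (f : poly3 F) (x y z : 'I_3 -> poly3 F) (p q r : poly3 F) : Prop :=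
  [/\ [/\ dapp x f = 0, dapp y f = 0 & dapp z f = 0],
      (forall th, dapp th f = 0 -> exists a b c, forall i, th i = a * x i + b * y i + c * z i),
      (forall i, p * x i + q * y i + r * z i = 0) &
      (forall a b c, (forall i, a * x i + b * y i + c * z i = 0) ->
         exists h, [/\ a = h * p, b = h * q & c = h * r])].

Lemma presents_swap12 (F : numClosedFieldType) (f : poly3 F) x y z p q r :
  presents f x y z p q r -> presents f y x z q p r.
Proof.
case=> [[hx hy hz] hg hr hu]; split=> //.
- move=> th /hg [a [b [c E]]]; exists b, a, c => i; rewrite E; ring.
- by move=> i; rewrite -[RHS](hr i); ring.
- move=> a b c E; have [|h [E1 E2 E3]] := hu b a c; last by exists h.
  by move=> i; rewrite -[RHS](E i); ring.
Qed.

Lemma presents_swap13 (F : numClosedFieldType) (f : poly3 F) x y z p q r :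
  presents f x y z p q r -> presents f z y x r q p.
Proof.
case=> [[hx hy hz] hg hr hu]; split=> //.
- move=> th /hg [a [b [c E]]]; exists c, b, a => i; rewrite E; ring.
- by move=> i; rewrite -[RHS](hr i); ring.
- move=> a b c E; have [|h [E1 E2 E3]] := hu c b a; last by exists h.
  by move=> i; rewrite -[RHS](E i); ring.
Qed.

Lemma presents_shear (F : numClosedFieldType) (f : poly3 F) x y z p q r s :
  presents f x y z p q r -> presents f (fun i => x i - s * z i) y z p q (r + s * p).
Proof.
case=> [[hx hy hz] hg hr hu]; split.
- split=> //; rewrite (eq_dapp _ (y := fun i => 1 * x i + (- s) * z i)).
    by rewrite dapp_comb2 hx hz !mulr0 addr0.
  by move=> i; rewrite mul1r mulNr.
- move=> th /hg [a [b [c E]]]; exists a, b, (c + a * s) => i; rewrite E; ring.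
- by move=> i; rewrite -[RHS](hr i); ring.
- move=> a b c E; have [|h [E1 E2 E3]] := hu a b (c - a * s).
    by move=> i; rewrite -[RHS](E i); ring.
  exists h; split=> //; rewrite mulrDr -E3 E1; ring.
Qed.

(** With [p = 0] the prime [r] divides [q] or every entry of [y]. Dividing it out gives in the first
    case a relation with coefficient 1; in the second, a derivation whose expression in the
    generators gives a relation with coefficient [r * b - 1]. Neither is a multiple of a coefficient
    vanishing at the origin. *)
Lemma presents_no_zero (F : numClosedFieldType) (f : poly3 F) x y z q r :
  presents f x y z 0 q r -> r \is 1.-homog -> r != 0 -> q.@[fun=> 0] = 0 -> False.
Proof.
case=> [[hx hy hz] hg hr hu] hr1 r0 q0.
have r00 : r.@[fun=> 0] = 0 := homog_eval0 hr1 (ltn0Sn 0).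
have one0 h : (1 : poly3 F) = h -> h.@[fun=> 0] = 0 -> False.
  by move=> <-; rewrite meval1 => /eqP; rewrite oner_eq0.
have hdv i : ldvd r (q * y i).
  exists (- z i); apply/eqP; rewrite -subr_eq0 mulrN opprK.
  by have := hr i; rewrite mul0r add0r => ->.
have [[k Ek]|nq] := classic (ldvd r q).
  have [|h [_ _ E]] := hu 0 k 1.
    move=> i; apply: (mulfI r0); rewrite mulr0 -[RHS](hr i) Ek; ring.
  by apply: (one0 _ E); rewrite mevalM r00 mulr0.
have /fin_all_exists [eta heta] : forall i, exists e, y i = r * e.
  by move=> i; have [] := linear_prime hr1 r0 (hdv i).
have eta0 : dapp eta f = 0.
  apply: (mulfI r0); rewrite mulr0 -[RHS]hy (eq_dapp f heta) /dapp mulr_sumr.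
  by apply: eq_bigr => i _; rewrite mulrA.
have [a [b [c E]]] := hg _ eta0.
have [|h [_ Eb _]] := hu (r * a) (r * b - 1) (r * c).
  move=> i; have := heta i; rewrite E => Ey.
  have -> : r * a * x i + (r * b - 1) * y i + r * c * z i =
    r * (a * x i + b * y i + c * z i) - y i by ring.
  by rewrite -Ey subrr.
apply: (@one0 (r * b - h * q)); first by rewrite -Eb; ring.
by rewrite mevalB !mevalM r00 q0 mul0r mulr0 subr0.
Qed.

Lemma natV_mpoly (F : numClosedFieldType) n : (0 < n)%N -> (n%:R^-1 : F)%:MP * n%:R = 1 :> poly3 F.
Proof. by move=> n0; rewrite -mpolyC_nat -mpolyCM mulVf ?mpolyC1 // pnatr_eq0 -lt0n. Qed.

Lemma euler_correction (F : numClosedFieldType) (g be : poly3 F) (x : 'I_3 -> poly3 F) n k :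
  g \is n.-homog -> g != 0 -> (0 < n)%N -> (forall i, x i \is k.-homog) -> dapp x g = be * g ->
  let y := fun i => x i - (n%:R^-1)%:MP * be * 'X_i in
  (forall i, y i \is k.-homog) /\ dapp y g = 0.
Proof.
move=> hg g0 n0 hx E; split.
  have hh := dapp_homog hg hx; rewrite E in hh.
  (* For a derivation with constant coefficients [be] would have degree -1, so it is zero. *)
  case: k hx hh => [|k] hx hh.
    have b0 : be = 0 by apply: (homog_quot_lt hg g0 hh); rewrite add0n prednK.
    by move=> i; rewrite b0 mulr0 mul0r subr0.
  have hb : be \is k.-homog by apply: (homog_quot hg g0); rewrite -[n]prednK // addnS -addSn.
  move=> i; apply: rpredB => //; rewrite -mulrA mul_mpolyC; apply: dhomogZ.
  by have := dhomogM hb (X_homog F i); rewrite addn1.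
rewrite (eq_dapp _ (y := fun i => 1 * x i + (- ((n%:R^-1)%:MP * be)) * 'X_i)); last first.
  by move=> i; rewrite mul1r mulNr.
rewrite dapp_comb2 E (dapp_euler hg).
have -> : 1 * (be * g) + - (n%:R^-1%:MP * be) * (n%:R * g) = be * g * (1 - n%:R^-1%:MP * n%:R) by ring.
by rewrite natV_mpoly // subrr mulr0.
Qed.

Definition free_exponents (F : numClosedFieldType) (f : poly3 F) (d1 d2 : nat) : Prop :=
  exists th1 th2 : 'I_3 -> poly3 F,
    [/\ (forall i, th1 i \is d1.-homog) /\ (forall i, th2 i \is d2.-homog),
        dapp th1 f = 0 /\ dapp th2 f = 0,
        (forall th, dapp th f = 0 -> exists a b : poly3 F, forall i, th i = a * th1 i + b * th2 i) &
        (forall a b : poly3 F, (forall i, a * th1 i + b * th2 i = 0) -> a = 0 /\ b = 0)].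

Lemma euler_coef0 (F : numClosedFieldType) (g a : poly3 F) (x : 'I_3 -> poly3 F) n :
  g \is n.-homog -> g != 0 -> (0 < n)%N -> dapp x g = 0 -> dapp (fun i => x i + a * 'X_i) g = 0 -> a = 0.
Proof.
move=> hg g0 n0 hx; rewrite (eq_dapp _ (y := fun i => 1 * x i + a * 'X_i)); last by move=> i; rewrite mul1r.
rewrite dapp_comb2 hx mulr0 add0r (dapp_euler hg) => /eqP; rewrite !mulf_eq0 (negPf g0).
by rewrite (negPf (natr_mpoly_neq0 F n0)) !orbF => /eqP.
Qed.

(** In a derivation tangent to L the coefficient of [z] must be divisible by [l], since [z] is not
    tangent. The relation then rewrites [l * z] through [x] and [y], and any relation between these
    two alone is a multiple h of the unique one with [h * c * l = 0]. *)
Lemma free_of_presents (F : numClosedFieldType) (f l p q be1 be2 : poly3 F) (c : F) n x y z d1 d2 :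
  presents f x y z p q (c%:MP * l) -> c != 0 ->
  f \is n.-homog -> f != 0 -> (0 < n)%N -> l \is 1.-homog -> l != 0 -> ~ ldvd l f ->
  dapp x l = be1 * l -> dapp y l = be2 * l -> ~ ldvd l (dapp z l) ->
  (forall i, x i \is d1.-homog) -> (forall i, y i \is d2.-homog) ->
  free_exponents (f * l) d1 d2.
Proof.
move=> [[hx hy hz] hg hr hu] c0 hf f0 n0 hl l0 nlf Ex Ey nlz hx1 hy2.
have hfl : f * l \is n.+1.-homog by have := dhomogM hf hl; rewrite addn1.
have fl0 : f * l != 0 by rewrite mulf_neq0.
have Exfl : dapp x (f * l) = be1 * (f * l) by rewrite dappM hx Ex; ring.
have Eyfl : dapp y (f * l) = be2 * (f * l) by rewrite dappM hy Ey; ring.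
have [h1 k1] := euler_correction hfl fl0 (ltn0Sn n) hx1 Exfl.
have [h2 k2] := euler_correction hfl fl0 (ltn0Sn n) hy2 Eyfl.
set m := (n.+1%:R^-1)%:MP in h1 k1 h2 k2.
set th1 := (fun i => x i - m * be1 * 'X_i) in h1 k1.
set th2 := (fun i => y i - m * be2 * 'X_i) in h2 k2.
exists th1, th2; split=> //.
- move=> th; rewrite dappM => E.
  have [be Ebe] : ldvd l (dapp th l).
    have hd : ldvd l (f * dapp th l).
      by exists (- dapp th f); apply/eqP; rewrite mulrN -addr_eq0 addrC [l * _]mulrC E.
    by have [] := linear_prime hl l0 hd.
  have Ef : dapp th f = (- be) * f.
    apply: (mulIf l0); apply/eqP; rewrite -subr_eq0; apply/eqP.
    by rewrite -[RHS]E Ebe; ring.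
  pose et i := th i - (n%:R^-1)%:MP * (- be) * 'X_i.
  have et0 : dapp et f = 0.
    rewrite (eq_dapp _ (y := fun i => 1 * th i + (- (n%:R^-1%:MP * - be)) * 'X_i)); last first.
      by move=> i; rewrite /et mul1r mulNr.
    rewrite dapp_comb2 Ef (dapp_euler hf).
    have -> : 1 * (- be * f) + - (n%:R^-1%:MP * - be) * (n%:R * f) = - be * f * (1 - n%:R^-1%:MP * n%:R) by ring.
    by rewrite natV_mpoly // subrr mulr0.
  have [a [b [w Eet]]] := hg _ et0.
  have Eetl : dapp et l = (be + n%:R^-1%:MP * be) * l.
    rewrite (eq_dapp _ (y := fun i => 1 * th i + (- (n%:R^-1%:MP * - be)) * 'X_i)); last first.
      by move=> i; rewrite /et mul1r mulNr.
    by rewrite dapp_comb2 Ebe (dapp_euler hl); ring.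
  have [w' Ew] : ldvd l w.
    have hd : ldvd l (w * dapp z l).
      exists (be + n%:R^-1%:MP * be - a * be1 - b * be2).
      have := Eetl; rewrite (eq_dapp _ Eet) dapp_comb3 Ex Ey => E'.
      have -> : w * dapp z l = (a * (be1 * l) + b * (be2 * l) + w * dapp z l) - a * be1 * l - b * be2 * l by ring.
      by rewrite E'; ring.
    by have [] := linear_prime hl l0 hd.
  pose s := (c^-1)%:MP * w'.
  have Eth i : th i = (a - s * p) * th1 i + (b - s * q) * th2 i +
     ((a - s * p) * (m * be1) + (b - s * q) * (m * be2) - n%:R^-1%:MP * be) * 'X_i.
    have E1 : w * z i = - s * (p * x i + q * y i).
      have Ez : p * x i + q * y i = - (c%:MP * l * z i) by apply/eqP; rewrite -addr_eq0 hr.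
      have cc : (c^-1)%:MP * c%:MP = 1 :> poly3 F by rewrite -mpolyCM mulVf ?mpolyC1.
      rewrite Ez Ew /s.
      have -> : - (c^-1%:MP * w') * - (c%:MP * l * z i) = (c^-1%:MP * c%:MP) * (l * w' * z i) by ring.
      by rewrite cc mul1r.
    have E2 : th i = a * x i + b * y i + w * z i - n%:R^-1%:MP * be * 'X_i.
      by rewrite -Eet /et; ring.
    by rewrite E2 E1 /th1 /th2; ring.
  exists (a - s * p), (b - s * q) => i.
  rewrite Eth; move: Eth; set g := (_ - n%:R^-1%:MP * be) => Eth.
  suff -> : g = 0 by rewrite mul0r addr0.
  apply: (euler_coef0 hfl fl0 (ltn0Sn n) (x := fun i => (a - s * p) * th1 i + (b - s * q) * th2 i)).
    by rewrite dapp_comb2 k1 k2 !mulr0 addr0.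
  by rewrite -(eq_dapp _ Eth) dappM.
- move=> a b E.
  have g0 : - (a * (m * be1) + b * (m * be2)) = 0.
    apply: (euler_coef0 hf f0 n0 (x := fun i => a * x i + b * y i)).
      by rewrite dapp_comb2 hx hy !mulr0 addr0.
    rewrite (eq_dapp _ (y := fun=> 0)); last by move=> i; rewrite -[RHS](E i) /th1 /th2; ring.
    by rewrite /dapp big1 // => i _; rewrite mul0r.
  have [|h [Ea Eb Ec]] := hu a b 0.
    move=> i; have := E i; rewrite /th1 /th2 => E'.
    have -> : a * x i + b * y i + 0 * z i = (a * (x i - m * be1 * 'X_i) + b * (y i - m * be2 * 'X_i))
        - (- (a * (m * be1) + b * (m * be2))) * 'X_i by ring.
    by rewrite E' g0 mul0r subrr.
  have h0 : h = 0.
    move/esym/eqP: Ec; rewrite !mulf_eq0 mpolyC_eq0 (negPf c0) (negPf l0) !orbF.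
    by move/eqP.
  by rewrite Ea Eb h0 !mul0r.
Qed.

(** After the shears, applying the relation to [l] gives that [l] divides [r' * dapp z l], hence the
    linear form [r']; so [r'] is a scalar times [l]. *)
Lemma free_of_pivot (F : numClosedFieldType) (f l p q r : poly3 F) (B : 'I_3 -> F) n d x y z d1 d2 :
  presents f x y z p q r ->
  f \is n.-homog -> f != 0 -> (0 < n)%N -> l \is 1.-homog -> l != 0 -> ~ ldvd l f -> l.@[B] = 0 ->
  (forall th k, dapp th f = 0 -> (forall i, th i \is k.-homog) ->
     (k < d)%N \/ (k = d /\ (dapp th l).@[B] = 0) -> ldvd l (dapp th l)) ->
  (forall i, x i \is d1.-homog) -> (forall i, y i \is d2.-homog) -> (forall i, z i \is d.-homog) ->
  (d1 <= d)%N -> (d2 <= d)%N -> p \is (d.+1 - d1).-homog -> q \is (d.+1 - d2).-homog ->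
  r \is 1.-homog -> r != 0 -> (dapp z l).@[B] != 0 ->
  free_exponents (f * l) d1 d2.
Proof.
move=> hpr hf f0 n0 hl l0 nlf lB star hx hy hz le1 le2 hp hq hr r0 zB.
(* Below degree d tangency is automatic; in degree d the scalar makes the value at [B] vanish. *)
pose sc (t : 'I_3 -> poly3 F) (k : nat) : F := if k == d then (dapp t l).@[B] / (dapp z l).@[B] else 0.
have nlz : ~ ldvd l (dapp z l).
  by move=> [k E]; case/eqP: zB; rewrite E mevalM lB mul0r.
have p0 : p.@[fun=> 0] = 0 by apply: homog_eval0 hp _; rewrite subn_gt0 ltnS.
have q0 : q.@[fun=> 0] = 0 by apply: homog_eval0 hq _; rewrite subn_gt0 ltnS.
have corr t k : dapp t f = 0 -> (forall i, t i \is k.-homog) -> (k <= d)%N ->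
    (forall i, t i - (sc t k)%:MP * z i \is k.-homog) /\ ldvd l (dapp (fun i => t i - (sc t k)%:MP * z i) l).
  move=> ht htk kd; have [[_ _ hz0] _ _ _] := hpr.
  have hh i : t i - (sc t k)%:MP * z i \is k.-homog.
    rewrite /sc; case: eqP => [kd'|_]; last by rewrite mpolyC0 mul0r subr0.
    apply: rpredB => //; rewrite mul_mpolyC; apply: dhomogZ; rewrite kd'; exact: hz.
  have E g : dapp (fun i => t i - (sc t k)%:MP * z i) g = dapp t g - (sc t k)%:MP * dapp z g.
    rewrite (eq_dapp _ (y := fun i => 1 * t i + (- (sc t k)%:MP) * z i)); last by move=> i; rewrite mul1r mulNr.
    by rewrite dapp_comb2 mul1r mulNr.
  split=> //; apply: (star _ k) => //; first by rewrite E ht hz0 mulr0 subr0.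
  move: kd; rewrite leq_eqVlt => /orP [/eqP kd|kd]; [right|by left]; split=> //.
  by rewrite E mevalB mevalM mevalC /sc kd eqxx divfK // subrr.
have [[hx0 hy0 hz0] _ _ _] := hpr.
have [hx' [be1 Ex']] := corr x d1 hx0 hx le1.
have [hy' [be2 Ey']] := corr y d2 hy0 hy le2.
set s1 := sc x d1 in hx' Ex'; set s2 := sc y d2 in hy' Ey'.
set x' := (fun i => x i - s1%:MP * z i) in hx' Ex'.
set y' := (fun i => y i - s2%:MP * z i) in hy' Ey'.
have hpr' : presents f x' y' z p q (r + s1%:MP * p + s2%:MP * q).
  have /presents_swap12 h1 := presents_shear s1%:MP hpr.
  exact: (presents_swap12 (presents_shear s2%:MP h1)).
have hs1 : s1 = 0 \/ p \is 1.-homog.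
  by rewrite /s1 /sc; case: eqP => [e|_]; [right; move: hp; rewrite e subSnn | left].
have hs2 : s2 = 0 \/ q \is 1.-homog.
  by rewrite /s2 /sc; case: eqP => [e|_]; [right; move: hq; rewrite e subSnn | left].
set r' := (r + _ + _) in hpr'.
have hr' : r' \is 1.-homog.
  apply: rpredD; first apply: rpredD => //.
    by case: hs1 => [->|h]; [rewrite mpolyC0 mul0r rpred0 | rewrite mul_mpolyC; apply: dhomogZ].
  by case: hs2 => [->|h]; [rewrite mpolyC0 mul0r rpred0 | rewrite mul_mpolyC; apply: dhomogZ].
have [ka Eka] : ldvd l r'.
  have hd : ldvd l (r' * dapp z l).
    have [_ _ rel _] := hpr'.
    have : dapp (fun i => p * x' i + q * y' i + r' * z i) l = 0.
      by rewrite (eq_dapp _ rel) /dapp big1 // => i _; rewrite mul0r.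
    rewrite dapp_comb3 Ex' Ey' => E; exists (- (p * be1 + q * be2)).
    have -> : r' * dapp z l = (p * (l * be1) + q * (l * be2) + r' * dapp z l) - (p * (l * be1) + q * (l * be2)) by ring.
    by rewrite E; ring.
  by have [] := linear_prime hl l0 hd.
have [c Ec] : exists c : F, ka = c%:MP.
  by apply: homog0E; apply: (homog_quot hl l0); rewrite mulrC -Eka.
(* If [r'] were zero, then, [r] being nonzero, one of the shears would have a nonzero scalar and a
   nonzero linear [p] or [q]; [presents_no_zero] then excludes the zero coefficient. *)
have c0 : c != 0.
  apply/eqP => c0; have r'0 : r' = 0 by rewrite Eka Ec c0 mpolyC0 mulr0.
  rewrite r'0 in hpr'.
  have [s1p|s1p] := eqVneq (s1%:MP * p) 0; last first.
    have [s10|hp1] := hs1; first by rewrite s10 mpolyC0 mul0r eqxx in s1p.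
    apply: (presents_no_zero (presents_swap13 hpr') hp1 _ q0).
    by apply: contraNneq s1p => ->; rewrite mulr0.
  have [s2q|s2q] := eqVneq (s2%:MP * q) 0.
    by move: r'0; rewrite /r' s1p s2q !addr0 => e; rewrite e eqxx in r0.
  have [s20|hq1] := hs2; first by rewrite s20 mpolyC0 mul0r eqxx in s2q.
  apply: (presents_no_zero (presents_swap13 (presents_swap12 hpr')) hq1 _ p0).
  by apply: contraNneq s2q => ->; rewrite mulr0.
have Er' : r' = c%:MP * l by rewrite Eka Ec mulrC.
rewrite Er' in hpr'; rewrite mulrC in Ex'; rewrite mulrC in Ey'.
exact: (free_of_presents hpr' c0 hf f0 n0 hl l0 nlf Ex' Ey' nlz hx' hy').
Qed.

Lemma pihomogM_lt (F : numClosedFieldType) (g f : poly3 F) n k : f \is n.-homog -> (k < n)%N ->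
  pihomog mdeg k (g * f) = 0.
Proof.
move=> hf kn; rewrite [in LHS](pihomog_partitionE (leqnn (msize g))) mulr_suml raddf_sum /=.
apply: big1 => d _; apply: (@pihomog_ne0 _ _ _ (d + n)%N); last by rewrite dhomogM // pihomogP.
by rewrite gtn_eqF // (leq_trans kn) // leq_addl.
Qed.

(** The component of degree d + 1 of the relation is again a relation, hence a multiple of it;
    comparing the coefficients [al] shows that the multiplier is 1. *)
Lemma relation_homog (F : numClosedFieldType) (f f2 f3 al : poly3 F) x y z d2 d3 d :
  presents f x y z f2 f3 al -> al \is 1.-homog -> al != 0 ->
  (forall i, x i \is d2.-homog) -> (forall i, y i \is d3.-homog) -> (forall i, z i \is d.-homog) ->
  f2 = 0 \/ ((d2 <= d.+1)%N /\ f2 \is (d.+1 - d2).-homog).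
Proof.
move=> [_ _ hr hu] hal al0 hx hy hz.
(* The test on [e] matters: for [e > d.+1] truncated subtraction would pick the constant term
   instead of nothing. *)
pose comp (g : poly3 F) e := if (e <= d.+1)%N then pihomog mdeg (d.+1 - e) g else 0.
have compE (t : 'I_3 -> poly3 F) g e i : (forall i, t i \is e.-homog) -> pihomog mdeg d.+1 (g * t i) = comp g e * t i.
  move=> ht; rewrite /comp; case: leqP => he; last by rewrite mul0r (pihomogM_lt g (ht i) he).
  by rewrite -[in LHS](subnK he) pihomogM.
have [|h [E2 _ Eal]] := hu (comp f2 d2) (comp f3 d3) al.
  move=> i; rewrite -(compE x) // -(compE y) //.
  have hz1 : pihomog mdeg d.+1 (al * z i) = al * z i.
    by apply: pihomog_dE; have := dhomogM hal (hz i); rewrite add1n.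
  transitivity (pihomog mdeg d.+1 (f2 * x i + f3 * y i + al * z i)).
    by rewrite !raddfD /= hz1.
  by rewrite hr raddf0.
have h1 : h = 1 by apply: (mulIf al0); rewrite mul1r -Eal.
rewrite h1 mul1r in E2; rewrite -E2 /comp; case: leqP => he; [right|by left].
by split=> //; apply: pihomogP.
Qed.

(** Minimality enters through the degrees: a generator of degree d + 1 would have a constant
    coefficient in the relation, and if this were nonzero the generator would be redundant. Zero
    coefficients are excluded by [presents_no_zero]. *)
Lemma presents_of_pog (F : numClosedFieldType) (f f1 f2 f3 al : poly3 F) (th2 th3 psi : 'I_3 -> poly3 F) n d2 d3 d :
  f \is n.-homog -> f != 0 -> (0 < n)%N ->
  (forall i, th2 i \is d2.-homog) -> (forall i, th3 i \is d3.-homog) -> (forall i, psi i \is d.-homog) ->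
  (exists g, dapp th2 f = g * f) -> (exists g, dapp th3 f = g * f) -> (exists g, dapp psi f = g * f) ->
  (forall th, (exists g, dapp th f = g * f) -> exists c0 c1 c2 c3, forall i,
     th i = c0 * 'X_i + c1 * th2 i + c2 * th3 i + c3 * psi i) ->
  (~ exists c0 c2 c3, forall i, th2 i = c0 * 'X_i + c2 * th3 i + c3 * psi i) ->
  (~ exists c0 c1 c3, forall i, th3 i = c0 * 'X_i + c1 * th2 i + c3 * psi i) ->
  al \is 1.-homog -> al != 0 ->
  (forall i, f1 * 'X_i + f2 * th2 i + f3 * th3 i + al * psi i = 0) ->
  (forall c0 c1 c2 c3, (forall i, c0 * 'X_i + c1 * th2 i + c2 * th3 i + c3 * psi i = 0) ->
     exists h, [/\ c1 = h * f2, c2 = h * f3 & c3 = h * al]) ->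
  exists x y z, [/\ presents f x y z f2 f3 al,
    [/\ forall i, x i \is d2.-homog, forall i, y i \is d3.-homog & forall i, z i \is d.-homog],
    f2 != 0 /\ f3 != 0,
    (d2 <= d)%N /\ (d3 <= d)%N &
    f2 \is (d.+1 - d2).-homog /\ f3 \is (d.+1 - d3).-homog].
Proof.
move=> hf f0 n0 h2 h3 h4 [q2 Q2] [q3 Q3] [q4 Q4] hgen hm2 hm3 hal al0 hrel hun.
have [hx kx] := euler_correction hf f0 n0 h2 Q2.
have [hy ky] := euler_correction hf f0 n0 h3 Q3.
have [hz kz] := euler_correction hf f0 n0 h4 Q4.
set m := (n%:R^-1)%:MP in hx kx hy ky hz kz.
set x := (fun i => th2 i - m * q2 * 'X_i) in hx kx.
set y := (fun i => th3 i - m * q3 * 'X_i) in hy ky.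
set z := (fun i => psi i - m * q4 * 'X_i) in hz kz.
have E2 i : th2 i = x i + m * q2 * 'X_i by rewrite /x subrK.
have E3 i : th3 i = y i + m * q3 * 'X_i by rewrite /y subrK.
have E4 i : psi i = z i + m * q4 * 'X_i by rewrite /z subrK.
have comb0 a b c e (t : 'I_3 -> poly3 F) : dapp t f = 0 ->
    (forall i, t i = a * x i + b * y i + c * z i + e * 'X_i) ->
    forall i, t i = a * x i + b * y i + c * z i.
  move=> ht Et; have e0 : e = 0.
    apply: (euler_coef0 hf f0 n0 (x := fun i => a * x i + b * y i + c * z i)).
      by rewrite dapp_comb3 kx ky kz !mulr0 !addr0.
    by rewrite -(eq_dapp _ Et).
  by move=> i; rewrite Et e0 mul0r addr0.
have hpr : presents f x y z f2 f3 al.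
  split=> //.
  - move=> th hth; have [|c0 [c1 [c2 [c3 E]]]] := hgen th; first by exists 0; rewrite mul0r.
    exists c1, c2, c3; apply: (comb0 _ _ _ (c0 + c1 * (m * q2) + c2 * (m * q3) + c3 * (m * q4))) => // i.
    by rewrite E E2 E3 E4; ring.
  - move=> i; apply/esym; move: i.
    apply: (comb0 f2 f3 al (f1 + f2 * (m * q2) + f3 * (m * q3) + al * (m * q4)) (fun=> 0)).
      by rewrite /dapp big1 // => i _; rewrite mul0r.
    by move=> i; rewrite -[LHS](hrel i) E2 E3 E4; ring.
  - move=> a b c E; apply: (hun (- (a * (m * q2) + b * (m * q3) + c * (m * q4)))) => i.
    by rewrite -[RHS](E i) E2 E3 E4; ring.
have unitc c : c != 0 -> (c^-1)%:MP * c%:MP = 1 :> poly3 F.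
  by move=> c0; rewrite -mpolyCM mulVf // mpolyC1.
have [_ _ hr _] := hpr.
have H2 : f2 = 0 \/ ((d2 <= d)%N /\ f2 \is (d.+1 - d2).-homog).
  have [->|[le hh]] := relation_homog hpr hal al0 hx hy hz; first by left.
  move: le; rewrite leq_eqVlt ltnS => /orP [/eqP e|le]; [left|by right].
  rewrite e subnn in hh; have [c Ec] := homog0E hh.
  have [c00|c0] := eqVneq c 0; first by rewrite Ec c00 mpolyC0.
  case: hm2; exists (m * q2 + (c^-1)%:MP * (f3 * (m * q3) + al * (m * q4))), (- (c^-1)%:MP * f3), (- (c^-1)%:MP * al) => i.
  have : x i = - (c^-1)%:MP * (f3 * y i + al * z i).
    have := hr i; rewrite Ec => e'; rewrite -[LHS]mul1r -(unitc c c0).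
    have -> : c^-1%:MP * c%:MP * x i = c^-1%:MP * (c%:MP * x i + f3 * y i + al * z i) - c^-1%:MP * (f3 * y i + al * z i) by ring.
    by rewrite e'; ring.
  by rewrite E2 => ->; rewrite E3 E4; ring.
have H3 : f3 = 0 \/ ((d3 <= d)%N /\ f3 \is (d.+1 - d3).-homog).
  have [->|[le hh]] := relation_homog (presents_swap12 hpr) hal al0 hy hx hz; first by left.
  move: le; rewrite leq_eqVlt ltnS => /orP [/eqP e|le]; [left|by right].
  rewrite e subnn in hh; have [c Ec] := homog0E hh.
  have [c00|c0] := eqVneq c 0; first by rewrite Ec c00 mpolyC0.
  case: hm3; exists (m * q3 + (c^-1)%:MP * (f2 * (m * q2) + al * (m * q4))), (- (c^-1)%:MP * f2), (- (c^-1)%:MP * al) => i.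
  have : y i = - (c^-1)%:MP * (f2 * x i + al * z i).
    have := hr i; rewrite Ec => e'; rewrite -[LHS]mul1r -(unitc c c0).
    have -> : c^-1%:MP * c%:MP * y i = c^-1%:MP * (f2 * x i + c%:MP * y i + al * z i) - c^-1%:MP * (f2 * x i + al * z i) by ring.
    by rewrite e'; ring.
  by rewrite E3 => ->; rewrite E2 E4; ring.
have ev0 (g : poly3 F) (e : nat) : g = 0 \/ ((e <= d)%N /\ g \is (d.+1 - e).-homog) -> g.@[fun=> 0] = 0.
  case=> [->|[le hh]]; first by rewrite meval0.
  by apply: homog_eval0 hh _; rewrite subn_gt0 ltnS.
have f20 : f2 != 0.
  by apply/eqP => e; move: hpr; rewrite e => hpr; apply: (presents_no_zero hpr hal al0 (ev0 _ _ H3)).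
have f30 : f3 != 0.
  apply/eqP => e; move: hpr; rewrite e => /presents_swap12 hpr.
  exact: (presents_no_zero hpr hal al0 (ev0 _ _ H2)).
case: H2 => [e|[le2 hf2]]; first by rewrite e eqxx in f20.
case: H3 => [e|[le3 hf3]]; first by rewrite e eqxx in f30.
by exists x, y, z.
Qed.

(** The derivations f_j d_i - f_i d_j kill [f]. Weighting their values on [l] by x_j and summing
    gives, by Euler's formula, [n * l_i * f - f_i * l], so tangency of all of them would force [l]
    to divide [f]. *)
Lemma koszul_not_all (F : numClosedFieldType) (f l : poly3 F) n :
  f \is n.-homog -> (0 < n)%N -> l \is 1.-homog -> l != 0 ->
  (forall th, dapp th f = 0 -> ldvd l (dapp th l)) -> ldvd l f.
Proof.
move=> hf n0 hl l0 h; have [i li] := linform_neq0 hl l0.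
have hij j : ldvd l (mderiv j f * mderiv i l - mderiv i f * mderiv j l).
  pose th (k : 'I_3) : poly3 F := (k == i)%:R * mderiv j f - (k == j)%:R * mderiv i f.
  have thE g : dapp th g = mderiv j f * mderiv i g - mderiv i f * mderiv j g.
    rewrite /dapp /th; under eq_bigr => k _ do rewrite mulrBl; rewrite sumrB; congr (_ - _).
      by rewrite (bigD1 i) //= eqxx mul1r big1 ?addr0 // => k /negPf ->; rewrite !mul0r.
    by rewrite (bigD1 j) //= eqxx mul1r big1 ?addr0 // => k /negPf ->; rewrite !mul0r.
  by rewrite -thE; apply: h; rewrite thE mulrC subrr.
have : ldvd l (\sum_j 'X_j * (mderiv j f * mderiv i l - mderiv i f * mderiv j l)).
  by apply: ldvd_sum => j; apply: ldvdM.
have -> : \sum_j 'X_j * (mderiv j f * mderiv i l - mderiv i f * mderiv j l) =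
   mderiv i l * (\sum_j 'X_j * mderiv j f) - mderiv i f * (\sum_j 'X_j * mderiv j l).
  by rewrite !mulr_sumr -sumrB; apply: eq_bigr => j _; ring.
rewrite (euler_homog hf) (euler_homog hl) (linform_deriv i hl) => h1.
have h2 : ldvd l (mderiv i f * (1%:R * l)) by exists (mderiv i f); rewrite mul1r mulrC.
have h3 := ldvdD h1 h2; rewrite subrK in h3.
have -> : f = ((lcoef l i)^-1%:MP * (n%:R^-1)%:MP) * ((lcoef l i)%:MP * (n%:R * f)).
  have e1 : (lcoef l i)^-1%:MP * (lcoef l i)%:MP = 1 :> poly3 F by rewrite -mpolyCM mulVf // mpolyC1.
  have e2 := natV_mpoly F n0.
  have -> : ((lcoef l i)^-1%:MP * (n%:R^-1)%:MP) * ((lcoef l i)%:MP * (n%:R * f))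
    = ((lcoef l i)^-1%:MP * (lcoef l i)%:MP) * ((n%:R^-1)%:MP * n%:R) * f by ring.
  by rewrite e1 e2 !mul1r.
exact: ldvdM.
Qed.

(** * Assembly: from the local inequalities to freeness *)

Definition local_length (F : numClosedFieldType) k (gens : 'I_k -> poly3 F) (v : 'I_3 -> F) : nat :=
  epsilon (inhabits 0%N) (is_length gens v).

Lemma local_lengthE (F : numClosedFieldType) k (gens : 'I_k -> poly3 F) (v : 'I_3 -> F) n :
  is_length gens v n -> local_length gens v = n.
Proof.
move=> h; apply: (is_length_unique _ h); apply: epsilon_spec; by exists n.
Qed.

Definition eps_at (F : numClosedFieldType) (f l : poly3 F) (v : 'I_3 -> F) : int :=
  ((local_length (milnor_gens (f * l) v) v)%:Z - (local_length (tjurina_gens (f * l) v) v)%:Z)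
  - ((local_length (milnor_gens f v) v)%:Z - (local_length (tjurina_gens f v) v)%:Z).

Lemma chart_index_neq0 (F : numClosedFieldType) (v : 'I_3 -> F) : (exists i, v i != 0) -> v (chart_index v) != 0.
Proof.
by move=> [i vi]; rewrite /chart_index; case: pickP => [j //|/(_ i)]; rewrite vi.
Qed.

Lemma low_degree_tangent (F : numClosedFieldType) (f l : poly3 F) n (d : nat) (B : 'I_3 -> F) (pts : seq ('I_3 -> F)) :
  square_free f -> f \is n.-homog -> (0 < n)%N -> l \is 1.-homog -> l != 0 -> l.@[B] = 0 -> f.@[B] != 0 ->
  (forall v, List.In v pts -> [/\ exists i, v i != 0, f.@[v] = 0 & l.@[v] = 0]) ->
  (forall i j, (i < j < size pts)%N -> ~ exists c : F, c != 0 /\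
     forall t, nth (fun=> 0) pts j t = c * nth (fun=> 0) pts i t) ->
  (forall w : 'I_3 -> F, (exists i, w i != 0) -> f.@[w] = 0 -> l.@[w] = 0 ->
     exists2 v, List.In v pts & exists c : F, c != 0 /\ forall t, w t = c * v t) ->
  d%:Z = n%:Z - (size pts)%:Z - \sum_(v <- pts) eps_at f l v ->
  forall th k, dapp th f = 0 -> (forall i, th i \is k.-homog) ->
     (k < d)%N \/ (k = d /\ (dapp th l).@[B] = 0) -> ldvd l (dapp th l).
Proof.
move=> sf hf n0 hl l0 lB fB hin hpr hall Ed th k hth hk.
have hT : dapp th l \is k.-homog by have := dapp_homog hl hk; rewrite addn0.
apply: (restriction_dvd hf n0 hl l0 lB fB hT hin hpr hall _ Ed).
move=> v a h o h' hv Ef h0 ET h0'.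
have [v0 fv lv] := hin v hv; have vi := chart_index_neq0 v0.
have a0 : (0 < a)%N.
  rewrite lt0n; apply: contraNneq h0 => a0.
  have := congr1 (fun p : {poly F} => p.[0]) Ef; rewrite a0 expr0 mul1r line_poly_eval => <-.
  by rewrite -[X in _ == X]fv; apply/eqP/meval_eq => j; rewrite mulr0 addr0.
(* Otherwise [B] would be proportional to [v], and [f] would vanish at [B]. *)
have hB : exists j, B j != B (chart_index v) * (v j / v (chart_index v)).
  apply: NNPP => hn; case/eqP: fB.
  have E : B =1 (fun j => (B (chart_index v) / v (chart_index v)) * v j).
    move=> j; apply/eqP/negPn/negP => hj; apply: hn; exists j.
    by apply: contraNneq hj => {1}->; apply/eqP; ring.
  by rewrite (meval_eq _ E) (homog_eval _ _ hf) fv mulr0.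
have TE : dapp th l = \sum_j (lcoef l j)%:MP * th j.
  by apply: eq_bigr => j _; rewrite (linform_deriv j hl) mulrC.
rewrite TE in hT ET.
have [mu [mu' [tau [tau' [L1 L2 L3 L4 le]]]]] :=
  point_inequality hf sf hl l0 vi lv lB hB hth hT Ef h0 a0 ET h0'.
rewrite /eps_at (local_lengthE L1) (local_lengthE L2) (local_lengthE L3) (local_lengthE L4).
by clear -le; lia.
Qed.

(** The pivot is any generator of degree d whose value on [l] is nonzero at [B]. If it is [x] or [y]
    rather than [z], its degree equals d, so trading it with [z] leaves the exponents unchanged.
    With no pivot all generators are tangent to L, against [koszul_not_all]. *)
Lemma addition_free (F : numClosedFieldType) (f l f1 f2 f3 al : poly3 F) (th2 th3 psi : 'I_3 -> poly3 F)
    n d2 d3 d (pts : seq ('I_3 -> F)) :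
  square_free f -> f \is n.-homog -> (0 < n)%N -> l \is 1.-homog -> l != 0 -> ~ ldvd l f ->
  (forall i, th2 i \is d2.-homog) -> (forall i, th3 i \is d3.-homog) -> (forall i, psi i \is d.-homog) ->
  (exists g, dapp th2 f = g * f) -> (exists g, dapp th3 f = g * f) -> (exists g, dapp psi f = g * f) ->
  (forall th, (exists g, dapp th f = g * f) -> exists c0 c1 c2 c3, forall i,
     th i = c0 * 'X_i + c1 * th2 i + c2 * th3 i + c3 * psi i) ->
  (~ exists c0 c2 c3, forall i, th2 i = c0 * 'X_i + c2 * th3 i + c3 * psi i) ->
  (~ exists c0 c1 c3, forall i, th3 i = c0 * 'X_i + c1 * th2 i + c3 * psi i) ->
  al \is 1.-homog -> al != 0 ->
  (forall i, f1 * 'X_i + f2 * th2 i + f3 * th3 i + al * psi i = 0) ->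
  (forall c0 c1 c2 c3, (forall i, c0 * 'X_i + c1 * th2 i + c2 * th3 i + c3 * psi i = 0) ->
     exists h, [/\ c1 = h * f2, c2 = h * f3 & c3 = h * al]) ->
  (forall v, List.In v pts -> [/\ exists i, v i != 0, f.@[v] = 0 & l.@[v] = 0]) ->
  (forall i j, (i < j < size pts)%N -> ~ exists c : F, c != 0 /\
     forall t, nth (fun=> 0) pts j t = c * nth (fun=> 0) pts i t) ->
  (forall w : 'I_3 -> F, (exists i, w i != 0) -> f.@[w] = 0 -> l.@[w] = 0 ->
     exists2 v, List.In v pts & exists c : F, c != 0 /\ forall t, w t = c * v t) ->
  d%:Z = n%:Z - (size pts)%:Z - \sum_(v <- pts) eps_at f l v ->
  free_exponents (f * l) d2 d3.
Proof.
move=> sf hf n0 hl l0 nlf h2 h3 h4 D2 D3 D4 hgen hm2 hm3 hal al0 hrel hun hin hpr hall Ed.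
have f0 : f != 0 by case: sf.
have [B [lB fB]] : exists B : 'I_3 -> F, l.@[B] = 0 /\ f.@[B] != 0.
  apply: NNPP => h; apply: nlf; apply: ldvd_vanish => // v lv.
  by apply/eqP/negPn/negP => fv; apply: h; exists v.
have star := low_degree_tangent sf hf n0 hl l0 lB fB hin hpr hall Ed.
have [x [y [z [pr [hx hy hz] [f20 f30] [le2 le3] [hf2 hf3]]]]] :=
  presents_of_pog hf f0 n0 h2 h3 h4 D2 D3 D4 hgen hm2 hm3 hal al0 hrel hun.
have [[kx ky kz] gen _ _] := pr.
have [zB|zB] := eqVneq (dapp z l).@[B] 0; last first.
  exact: (free_of_pivot pr hf f0 n0 hl l0 nlf lB star hx hy hz le2 le3 hf2 hf3 hal al0 zB).
have hal' : al \is (d.+1 - d).-homog by rewrite subSnn.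
have [/andP [/eqP e2 xB]|nx] := boolP ((d2 == d) && ((dapp x l).@[B] != 0)).
  subst d2; rewrite subSnn in hf2.
  exact: (free_of_pivot (presents_swap13 pr) hf f0 n0 hl l0 nlf lB star hz hy hx (leqnn d) le3 hal' hf3 hf2 f20 xB).
have [/andP [/eqP e3 yB]|ny] := boolP ((d3 == d) && ((dapp y l).@[B] != 0)).
  subst d3; rewrite subSnn in hf3.
  have pr' := presents_swap12 (presents_swap13 (presents_swap12 pr)).
  exact: (free_of_pivot pr' hf f0 n0 hl l0 nlf lB star hx hz hy le2 (leqnn d) hf2 hal' hf3 f30 yB).
exfalso; apply: nlf; apply: (koszul_not_all hf n0 hl l0) => th /gen [a [b [c E]]].
have lz : ldvd l (dapp z l) by apply: (star z d) => //; right.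
have lx : ldvd l (dapp x l).
  apply: (star x d2) => //; move: le2; rewrite leq_eqVlt => /orP [/eqP e|]; [right|by left].
  by split=> //; move: nx; rewrite e eqxx /= negbK => /eqP.
have ly : ldvd l (dapp y l).
  apply: (star y d3) => //; move: le3; rewrite leq_eqVlt => /orP [/eqP e|]; [right|by left].
  by split=> //; move: ny; rewrite e eqxx /= negbK => /eqP.
rewrite (eq_dapp _ E) dapp_comb3; apply: ldvdD; first apply: ldvdD; exact: ldvdM.
Qed.

Lemma sum_ord4 (V : nmodType) (f : 'I_4 -> V) :
  \sum_(k < 4) f k = f (@Ordinal 4 0 isT) + f (@Ordinal 4 1 isT) + f (@Ordinal 4 2 isT) + f (@Ordinal 4 3 isT).
Proof.
rewrite !big_ord_recl big_ord0 addr0 !addrA.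
by congr (_ + _ + _ + _); congr f; apply: val_inj.
Qed.

Theorem theorem3p3 (f' l : S) (n d2 d3 d : nat) (pts : seq vec) :
  reduced f' -> f' \is n.-homog -> (0 < n)%N ->
  l \is 1.-homog -> l != 0 -> ~ (exists h : S, f' = l * h) ->
  plus_one_generated f' d2 d3 d ->
  intersection_points f' l pts ->
  d%:Z = n%:Z - (size pts)%:Z - eps_CL f' l pts ->
  free_with_exponents (f' * l) d2 d3.
Proof.
move=> red hf n0 hl l0 nlf.
move=> [th2 [th3 [psi [f1 [f2 [f3 [al [[h2 [h3 h4]] [D2 [D3 D4]] gen min [hal al0 rel uni]]]]]]]]].
move=> [hin hpr hall] Ed.
have combE (c : 'I_4 -> S) (a b p q : Der) i : comb c (fam4 a b p q) i =
    c (@Ordinal 4 0 isT) * a i + c (@Ordinal 4 1 isT) * b i + c (@Ordinal 4 2 isT) * p i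
    + c (@Ordinal 4 3 isT) * q i by exact: sum_ord4.
apply: (@addition_free CC f' l f1 f2 f3 al th2 th3 psi n d2 d3 d pts red hf n0 hl l0 nlf h2 h3 h4
  D2 D3 D4 _ _ _ hal al0 _ _ hin hpr hall Ed).
- move=> th hD; have [c E] := gen th hD.
  by do 4!eexists; move=> i; etransitivity; [exact: E | exact: combE].
- move=> [c0 [c2 [c3 E]]]; apply: (min (@Ordinal 4 1 isT)); exists (coef4 c0 0 c2 c3); split=> // i.
  etransitivity; first exact: E.
  etransitivity; last by apply/esym; exact: combE.
  by rewrite /= mul0r addr0.
- move=> [c0 [c1 [c3 E]]]; apply: (min (@Ordinal 4 2 isT)); exists (coef4 c0 c1 0 c3); split=> // i.
  etransitivity; first exact: E.
  etransitivity; last by apply/esym; exact: combE.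
  by rewrite /= mul0r addr0.
- by move=> i; etransitivity; last exact: (rel i); apply/esym; exact: combE.
- move=> c0 c1 c2 c3 E; have [|h hk] := uni (coef4 c0 c1 c2 c3).
    by move=> i; etransitivity; [exact: combE | exact: E].
  exists h; split; [exact: (hk (@Ordinal 4 1 isT)) | exact: (hk (@Ordinal 4 2 isT)) | exact: (hk (@Ordinal 4 3 isT))].
Qed.
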